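(* Let $\Omega\subset\mathbb{R}^D$ be a $d$-rectifiable set and let $P$ be a probability measure on $\Omega$ with density $p$ with respect to $\mathcal{H}^d$. Let $X_1,X_2,\ldots$ be i.i.d. with law $P$. Assume: (A.1) $K:[0,\infty)\to\mathbb{R}$ is continuous, vanishes outside $[0,1]$, and $\int_{\mathbb{R}^d}K(\|u\|)\,du=1$; (A.2) there is a fixed $m>0$ such that for $\mathcal{H}^d$-almost every $x\in\Omega$, $\Omega$ has an approximate tangent space $T_x\Omega$ with respect to $p$ at $x$ satisfying, for every continuous compactly supported $f:\mathbb{R}^D\to\mathbb{R}$, $$\int_{(\Omega-x)/h}f(y)\,p(x+hy)\,d\mathcal{H}^d(y)=p(x)\int_{T_x\Omega}f(y)\,d\mathcal{H}^d(y)+O(h^m)\quad (h\to0).$$ Then, if the bandwidths are chosen as $h_n=c\,n^{-1/(d+2m)}$ for a constant $c>0$, for $\mathcal{H}^d$-almost every $x\in\Omega$, $$\mathrm{MSE}(\hat p_n(x))=\mathbb{E}\big[(\hat p_n(x)-p(x))^2\big]=O\!\left(n^{-2m/(d+2m)}\right)\quad (n\to\infty).$$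
   Context: $\mathcal{H}^d$ denotes $d$-dimensional Hausdorff measure on $\mathbb{R}^D$. A set $\Omega\subset\mathbb{R}^D$ is $d$-rectifiable if $\Omega=\Omega_0\cup\bigcup_{j\in\mathbb{N}}F_j(A_j)$ with $\mathcal{H}^d(\Omega_0)=0$, $A_j\subset\mathbb{R}^d$, and each $F_j:\mathbb{R}^d\to\mathbb{R}^D$ Lipschitz. For a positive $\mathcal{H}^d$-measurable $\theta$ on $\Omega$ with $\int_{\Omega\cap C}\theta\,d\mathcal{H}^d<\infty$ for all compact $C$, a $d$-dimensional linear subspace $T_x\Omega\subset\mathbb{R}^D$ is an approximate tangent space to $\Omega$ at $x$ with respect to $\theta$ if $\lim_{h\to0}\int_{(\Omega-x)/h}f(y)\theta(x+hy)\,d\mathcal{H}^d(y)=\theta(x)\int_{T_x\Omega}f\,d\mathcal{H}^d$ for all continuous compactly supported $f$, where $(\Omega-x)/h=\{y\in\mathbb{R}^D: x+hy\in\Omega\}$. Given i.i.d. samples $X_1,\dots,X_n\sim P$, a kernel $K$ and bandwidth $h_n>0$, the estimator is $\hat p_n(x)=\frac{1}{n h_n^d}\sum_{i=1}^n K\!\left(\frac{\|X_i-x\|}{h_n}\right)$. *)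

(* Defs.v *)
From HB Require Import structures.
From mathcomp Require Import all_boot all_order all_algebra.
From mathcomp Require Import all_classical all_reals all_analysis.
Import Order.TTheory GRing.Theory Num.Theory.
Import numFieldNormedType.Exports.
Set Implicit Arguments. Unset Strict Implicit. Unset Printing Implicit Defensive.
Local Open Scope classical_set_scope.
Local Open Scope ring_scope.

Section methodI.
Local Open Scope ereal_scope.
Context (T : Type) (R : realType) (adm : set (set T)) (zeta : set T -> \bar R).
Hypotheses (adm0 : adm set0) (zeta0 : zeta set0 = 0) (zeta_ge0 : forall A, 0 <= zeta A).

Definition adm_cover (X : set T) := [set F : (set T)^nat |
  (forall k, adm (F k)) /\ X `<=` \bigcup_k F k].

Definition methodI (X : set T) : \bar R :=
  ereal_inf [set \sum_(k <oo) zeta (F k) | F in adm_cover X].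

Lemma le_methodI : {homo methodI : A B / A `<=` B >-> A <= B}.
Proof.
move=> A B AB; apply/ereal_inf_le_tmp => x [B' [mB' BB']].
by move=> <-{x}; exists B' => //; split => //; apply: subset_trans AB BB'.
Qed.

Lemma methodI_ge0 A : 0 <= methodI A.
Proof.
apply: le_ereal_inf_tmp => x [B [mB AB] <-{x}]; exact: nneseries_ge0.
Qed.

Lemma methodI0 : methodI set0 = 0.
Proof.
apply/eqP; rewrite eq_le; apply/andP; split; last exact/methodI_ge0.
rewrite /methodI; apply: ereal_inf_lbound; exists (fun=> set0); first by split.
by rewrite eseries0.
Qed.

Lemma methodI_sigma_subadditive : sigma_subadditive methodI.
Proof.
move=> A; have [[i ioo]|] := pselect (exists i, methodI (A i) = +oo).
  rewrite (eseries_pinfty _ _ ioo) ?leey// => n _.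
  by rewrite -ltNye (lt_le_trans _ (methodI_ge0 _)).
rewrite -forallNE => Aoo.
suff add2e (e : {posnum R}) :
    methodI (\bigcup_n A n) <= \sum_(i <oo) methodI (A i) + e%:num%:E.
  by apply/lee_addgt0Pr => _/posnumP[].
rewrite (le_trans _ (epsilon_trick _ _ _))//; last first.
  by move=> n; exact: methodI_ge0.
pose P n (B : (set T)^nat) := adm_cover (A n) B /\
  \sum_(k <oo) zeta (B k) <= methodI (A n) + (e%:num / (2 ^ n.+1)%:R)%:E.
have [G PG] : {G : ((set T)^nat)^nat & forall n, P n (G n)}.
  apply: (@choice _ _ P) => n; rewrite /P /methodI.
  set S := (X in ereal_inf X); move infS : (ereal_inf S) => iS.
  case: iS infS => [r Sr|Soo|Soo].
  - have en1 : (0 < e%:num / (2 ^ n.+1)%:R)%R by [].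
    have /(lb_ereal_inf_adherent en1) : ereal_inf S \is a fin_num by rewrite Sr.
    move=> [x [B [mB AnB muBx] xS]].
    by exists B; split => //; rewrite muBx -Sr; exact/ltW.
  - by have := Aoo n; rewrite /methodI Soo.
  - suff : lbound S 0 by move/le_ereal_inf_tmp; rewrite Soo.
    by move=> /= _ [B [mB AnB] <-]; exact: nneseries_ge0.
have muG_ge0 x : 0 <= (zeta \o uncurry G) x by exact: zeta_ge0.
apply: (@le_trans _ _ (\esum_(i in setT) (zeta \o uncurry G) i)).
  rewrite /methodI; apply: ereal_inf_lbound => /=.
  have /card_esym/ppcard_eqP[f] := card_nat2.
  exists (uncurry G \o f).
    split => [i|]; first by rewrite /= /uncurry; case: (f i) => a b; exact: (PG a).1.1.
    apply: (@subset_trans _  (\bigcup_n \bigcup_k G n k)) => [t [i _]|].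
      by move=> /((PG i).1.2) -[j _ ?]; exists i => //; exists j.
    move=> t [i _ [j _ Bijt]]; exists (f^-1%FUN (i, j)) => //=.
    by rewrite invK ?inE.
  rewrite -(esum_pred_image (zeta \o uncurry G) _ xpredT) ?[fun=> _]set_true//.
  by rewrite image_eq.
rewrite (_ : esum _ _ = \sum_(i <oo) \sum_(j <oo ) zeta (G i j)); last first.
  pose J : nat -> set (nat * nat) := fun i => [set (i, j) | j in setT].
  rewrite (_ : setT = \bigcup_k J k); last first.
    by rewrite predeqE => -[a b]; split => // _; exists a => //; exists b.
  rewrite esum_bigcupT /=; last 2 first.
    - apply/trivIsetP => i j _ _ ij.
      rewrite predeqE => -[n m] /=; split => //= -[] [_] _ [<-{n} _].
      by move=> [m' _] [] /esym/eqP; rewrite (negbTE ij).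
    - by move=> /= [n m]; apply: zeta_ge0.
  rewrite -(image_id [set: nat]) -fun_true esum_pred_image//; last first.
    by move=> n _; exact: esum_ge0.
  apply: eq_eseriesr => /= j _.
  rewrite -(esum_pred_image (zeta \o uncurry G) (pair j) predT)//=; last first.
    by move=> ? ? _ _; exact: (@can_inj _ _ _ snd).
  by congr esum; rewrite predeqE => -[a b]; split; move=> [i _ <-]; exists i.
apply: lee_lim.
- apply: is_cvg_nneseries => n *.
  by apply: nneseries_ge0 => m *; exact: (muG_ge0 (n, m)).
- by apply: is_cvg_nneseries => n *; apply: adde_ge0 => //; exact: methodI_ge0.
- by near=> n; apply: lee_sum => i _; exact: (PG i).2.
Unshelve. all: by end_near. Qed.

End methodI.

Section hausdorff.
Variable R : realType.

Definition enorm (n : nat) (v : 'rV[R]_n) : R := Num.sqrt (\sum_(i < n) v 0 i ^+ 2).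

Definition diam (D : nat) (C : set 'rV[R]_D) : \bar R :=
  ereal_sup [set (enorm (x - y))%:E | x in C & y in C].

Fixpoint dfact (n : nat) : nat :=
  match n with 0 => 1 | 1 => 1 | (k.+2) as n' => (n' * dfact k)%N end.

Definition omega (d : nat) : R :=
  if odd d then 2 ^+ (d./2).+1 * pi ^+ d./2 / (dfact d)%:R
  else pi ^+ d./2 / (d./2)`!%:R.

Lemma omega_ge0 d : 0 <= omega d.
Proof.
rewrite /omega; case: ifP => _; apply: divr_ge0 => //;
  by rewrite ?mulr_ge0 ?exprn_ge0 ?pi_ge0.
Qed.

Definition haus_adm (D : nat) (delta : R) : set (set 'rV[R]_D) :=
  [set C | (diam C <= delta%:E)%E].
Arguments haus_adm : clear implicits.

Definition haus_zeta (D d : nat) (C : set 'rV[R]_D) : \bar R :=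
  if `[< C = set0 >] then 0%E else (omega d * (fine (diam C) / 2) ^+ d)%:E.

Lemma diam_ge0 D (C : set 'rV[R]_D) : C !=set0 -> (0 <= diam C)%E.
Proof.
move=> [x Cx]; apply: le_ereal_sup_tmp; exists (enorm (x - x))%:E.
  by exists x => //; exists x.
by rewrite lee_fin /enorm sqrtr_ge0.
Qed.

Lemma haus_zeta_ge0 D d (C : set 'rV[R]_D) : (0 <= haus_zeta d C)%E.
Proof.
rewrite /haus_zeta; case: asboolP => // /eqP/set0P C0.
rewrite lee_fin mulr_ge0 ?omega_ge0// exprn_ge0// divr_ge0// fine_ge0//.
exact: diam_ge0.
Qed.

Lemma haus_zeta0 D d : haus_zeta d (set0 : set 'rV[R]_D) = 0%E.
Proof. by rewrite /haus_zeta; case: asboolP. Qed.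

Lemma haus_adm0 D (delta : R) : haus_adm D delta set0.
Proof.
rewrite /haus_adm /= /diam (_ : [set _ | x in set0 & y in set0] = set0).
  by rewrite ereal_sup0 leNye.
by apply/seteqP; split => // z [x []].
Qed.

Definition hausdorff_delta (D d : nat) (delta : R) : set 'rV[R]_D -> \bar R :=
  methodI (haus_adm D delta) (haus_zeta d).
Arguments hausdorff_delta : clear implicits.

Definition hausdorff_om (D d : nat) (A : set 'rV[R]_D) : \bar R :=
  ereal_sup [set hausdorff_delta D d delta A | delta in `]0, +oo[%classic].
Arguments hausdorff_om : clear implicits.

Local Open Scope ereal_scope.

Lemma hausdorff_om0 D d : hausdorff_om D d set0 = 0.
Proof.
apply/eqP; rewrite eq_le; apply/andP; split.
  apply: ge_ereal_sup => _ [delta _ <-].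
  rewrite /hausdorff_delta methodI0 //; [exact: haus_adm0|exact: haus_zeta0|exact: haus_zeta_ge0].
apply: le_ereal_sup_tmp; exists (hausdorff_delta D d 1 set0) => //.
  by exists 1%R => //=; rewrite in_itv /= andbT.
by apply: methodI_ge0 => C; exact: haus_zeta_ge0.
Qed.

Lemma hausdorff_om_ge0 D d A : 0 <= hausdorff_om D d A.
Proof.
apply: le_ereal_sup_tmp; exists (hausdorff_delta D d 1 A).
  by exists 1%R => //=; rewrite in_itv /= andbT.
by apply: methodI_ge0 => C; exact: haus_zeta_ge0.
Qed.

Lemma le_hausdorff_om D d : {homo hausdorff_om D d : A B / A `<=` B >-> A <= B}.
Proof.
move=> A B AB; apply: ge_ereal_sup => _ [delta dp <-].
apply: le_trans (le_methodI _ _ AB) _.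
by apply: ereal_sup_ubound; exists delta.
Qed.

Lemma hausdorff_om_sigma_subadditive D d : sigma_subadditive (hausdorff_om D d).
Proof.
move=> F; apply: ge_ereal_sup => _ [delta dp <-].
apply: (le_trans (methodI_sigma_subadditive (haus_adm D delta) (fun C => haus_zeta_ge0 d C) F)).
apply: lee_nneseries => [i _ _|i _]; first by apply: methodI_ge0 => C; exact: haus_zeta_ge0.
by apply: ereal_sup_ubound; exists delta.
Qed.

HB.instance Definition _ (D d : nat) := isOuterMeasure.Build R _ (hausdorff_om D d)
  (hausdorff_om0 D d) (@hausdorff_om_ge0 D d) (@le_hausdorff_om D d)
  (@hausdorff_om_sigma_subadditive D d).

End hausdorff.
Arguments haus_adm : clear implicits.
Arguments hausdorff_delta : clear implicits.
Arguments hausdorff_om : clear implicits.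
Arguments diam : clear implicits.

Definition HdT (R : realType) (D d : nat) := caratheodory_type (hausdorff_om R D d).
(** [Hd R D d] : the d-dimensional Hausdorff measure on R^D, as a measure on
    the sigma-algebra of Caratheodory (i.e. H^d-) measurable sets. *)
Notation Hd R D d := (hausdorff_om R D d : set (HdT R D d) -> \bar R).

Section defs.
Variable R : realType.
Local Open Scope ring_scope.

Definition Hint (D d : nat) (A : set 'rV[R]_D) (g : 'rV[R]_D -> R) : R :=
  fine (\int[Hd R D d]_(y in (A : set (HdT R D d))) (g y)%:E)%E.

Definition lipschitz (n k : nat) (F : 'rV[R]_n -> 'rV[R]_k) : Prop :=
  exists L : R, forall a b, enorm (F a - F b) <= L * enorm (a - b).

Definition rectifiable (D d : nat) (Om : set 'rV[R]_D) : Prop :=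
  exists (Om0 : set 'rV[R]_D) (A : nat -> set 'rV[R]_d)
         (F : nat -> 'rV[R]_d -> 'rV[R]_D),
    [/\ hausdorff_om R D d Om0 = 0%E, (forall j, lipschitz (F j)) &
       Om = Om0 `|` \bigcup_j (F j @` A j)].

Definition cc_fun (D : nat) (f : 'rV[R]_D -> R) : Prop :=
  continuous f /\ exists C : set 'rV[R]_D, compact C /\ forall y, ~ C y -> f y = 0.

Definition blowup (D : nat) (Om : set 'rV[R]_D) (x : 'rV[R]_D) (h : R) :
  set 'rV[R]_D := [set y | Om (x + h *: y)].

Definition weight_on (D d : nat) (Om : set 'rV[R]_D) (theta : 'rV[R]_D -> R) :=
  [/\ measurable_fun (Om : set (HdT R D d)) (theta : HdT R D d -> R),
      (forall x, Om x -> 0 < theta x) &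
      forall C : set 'rV[R]_D, compact C ->
        (\int[Hd R D d]_(y in (Om `&` C : set (HdT R D d))) (theta y)%:E < +oo)%E].

Definition approx_tangent (D d : nat) (Om : set 'rV[R]_D) (theta : 'rV[R]_D -> R)
  (x : 'rV[R]_D) (T : {vspace 'rV[R]_D}) : Prop :=
  \dim T = d /\
  forall f, cc_fun f ->
    (fun h : R => Hint d (blowup Om x h) (fun y => f y * theta (x + h *: y)))
      @ 0^'+ --> theta x * Hint d [set y | y \in T] f.

Fixpoint leb_iter (n : nat) (g : seq R -> R) : R :=
  match n with
  | 0 => g [::]
  | k.+1 => Rintegral (@lebesgue_measure R) setT (fun t => leb_iter k (fun s => g (t :: s)))
  end.

Definition kde (D d : nat) {T : Type} (K : R -> R) (X : nat -> T -> 'rV[R]_D)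
  (n : nat) (h : R) (x : 'rV[R]_D) (w : T) : R :=
  (n%:R * h ^+ d)^-1 * \sum_(i < n) K (enorm (X i w - x) / h).

End defs.

(* Main.v *)
(** If [Y_i = K (|X_i - x| / h)], then [h ^- d * E Y_i] is the integral of [K (|y|) p (x + h y)] over the blow-up of
    [Om] at [x], and [h ^- d * E (Y_i ^ 2)] is the same integral with [K ^ 2]. Applied to [K (|.|)] and to [K (|.|) ^ 2],
    (A.2) therefore bounds the bias by [O (h ^ m)] and, by pairwise independence, the variance by [O (1 / (n h ^ d))];
    the bandwidth balances the two.

    This needs the main term of (A.2) for [K (|.|)] to be [p x], that is, [K (|.|)] must have the same integral for
    [H^d] on a [d]-plane as for Lebesgue measure on [R^d]. Radial integrals only depend on the measures of the balls, so
    it suffices that a ball of radius [r] in a [d]-plane has [H^d]-measure [omega d * r ^ d]. Since [H^d] is defined by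
    arbitrary covers, this is where the isodiametric inequality comes in; it is derived from the Prekopa-Leindler
    inequality. *)
Require Import Defs.
From HB Require Import structures.
From mathcomp Require Import all_boot all_order all_algebra.
From mathcomp Require Import all_classical all_reals all_analysis.
From mathcomp Require Import measurable_realfun ring lra.
Import Order.TTheory GRing.Theory Num.Theory.
Import numFieldNormedType.Exports.
Set Implicit Arguments. Unset Strict Implicit. Unset Printing Implicit Defensive.
Local Open Scope classical_set_scope.
Local Open Scope ring_scope.

(** The normalizing constant of [H^d] is the explicit formula [omega d]. That it is the volume of
    the unit ball is itself proved, by computing the Gaussian integral over [R^n] in two ways
    instead of passing to polar coordinates.

    The isodiametric inequality only shows that a ball of radius [r] in a plane has measure at least
    [omega d * r ^ d]. The opposite bound needs economical covers. In place of a Vitali covering, it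
    uses self-similarity: all balls centred on the plane are scaled copies of one of them, so a
    crude packing filling a fixed proportion is enough.

    The sigma-algebra in force is that of the Caratheodory-measurable sets of [H^d]. Norms,
    coordinates and planes must be shown to be measurable for it, which rests on the additivity of
    [H^d] on sets at positive distance.

    The kernel may change sign and [Hint] is the finite part of an extended integral. Identities
    between integrals are therefore proved for nonnegative functions and carried over to positive
    and negative parts, with attention to infinite values. *)

Section product_sigma_finite.
Local Open Scope ereal_scope.
Context (R : realType) d1 d2 (T1 : measurableType d1) (T2 : measurableType d2).
Variables (m1 : {sigma_finite_measure set T1 -> \bar R})
  (m2 : {sigma_finite_measure set T2 -> \bar R}).

(** An alias of the product measure that can carry a sigma-finite structure, so that a product can
    again be a factor of the next one. *)
Definition product_sfm : set (T1 * T2) -> \bar R := m1 \x m2.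
HB.instance Definition _ := Measure.on product_sfm.

Let product_sigma_finite : sigma_finite setT product_sfm.
Proof.
have /sigma_finiteP[F [TF ndF Foo]] := sigma_finiteT m1.
have /sigma_finiteP[G [TG ndG Goo]] := sigma_finiteT m2.
exists (fun n => F n `*` G n).
  apply/esym; rewrite -subTset => -[x y] _.
  have [n _ Fx] : (\bigcup_i F i) x by rewrite -TF.
  have [k _ Gy] : (\bigcup_i G i) y by rewrite -TG.
  exists (maxn n k) => //; split => /=.
    by move: x Fx; exact/subsetPset/ndF/leq_maxl.
  by move: y Gy; exact/subsetPset/ndG/leq_maxr.
move=> k; have [? ?] := Foo k; have [? ?] := Goo k.
split; first exact: measurableX.
by rewrite /product_sfm product_measure1E// lte_mul_pinfty// ge0_fin_numE.
Qed.

HB.instance Definition _ :=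
  Measure_isSigmaFinite.Build _ _ _ product_sfm product_sigma_finite.

End product_sigma_finite.

Section image_measure.
Local Open Scope ereal_scope.
Context (R : realType) d1 d2 (T1 : measurableType d1) (T2 : measurableType d2).
Variables (mu : {measure set T1 -> \bar R}) (f : T1 -> T2).
Hypothesis mf : measurable_fun setT f.

Definition image_measure : {measure set T2 -> \bar R} :=
  measure_function_pushforward__canonical__measure_function_Measure mu mf.

Lemma image_measureE A : image_measure A = mu (f @^-1` A). Proof. by []. Qed.

Lemma integral_image_measure D (g : T2 -> \bar R) :
  measurable D -> measurable_fun D g -> (forall y, D y -> 0 <= g y) ->
  \int[image_measure]_(y in D) g y = \int[mu]_(x in f @^-1` D) g (f x).
Proof.
move=> mD mg g0; apply: (ge0_integral_pushforward mf) => //.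
by move=> y; rewrite inE; exact: g0.
Qed.

End image_measure.

(** * Lebesgue measure on R^n and the volume of balls *)

Section lebesgue_rn.
Variable R : realType.

(** A recursion on the dimension has to return the type, its sigma-algebra and its measure together,
    hence the bundle. *)
Record msp := Msp { msp_disp : measure_display;
  msp_car :> measurableType msp_disp;
  msp_mu : {sigma_finite_measure set msp_car -> \bar R} }.

(* R^n as the iterated product R * (R * ...), so that Fubini's theorem for two factors drives every
   induction on [n]; [coords] reads off the row vector. *)
Fixpoint Rn (n : nat) : msp :=
  match n with
  | 0 => @Msp _ unit (@dirac _ unit tt R)
  | k.+1 => @Msp _ (measurableTypeR R * msp_car (Rn k))%type
              (product_sfm lebesgue_measure (msp_mu (Rn k)))
  end.

Fixpoint coords (n : nat) : Rn n -> 'rV[R]_n :=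
  match n with
  | 0 => fun=> 0
  | k.+1 => fun v => row_mx (v.1 : R)%:M (coords v.2 : 'rV[R]_k)
  end.

Notation lamn n := (msp_mu (Rn n)).

Lemma measurable_coords n (i : 'I_n) : measurable_fun setT (fun v : Rn n => coords v 0 i).
Proof.
elim: n i => [|n IH] i; first by case: i.
have -> : (fun v : Rn n.+1 => coords v 0 i) = 
   fun v : Rn n.+1 => if @fintype.split 1 n i is inr j then coords v.2 0 j else v.1.
  apply/funext => v; rewrite /= mxE; case: (@fintype.split 1 n i) => // j.
  by rewrite ord1 mxE eqxx mulr1n.
case: (@fintype.split 1 n i) => j.
  exact: measurable_fst.
exact: (measurableT_comp (IH j) (measurable_snd)).
Qed.
Local Notation leb := (@lebesgue_measure R).

(** The right-hand side is a measure in [A], so by uniqueness only half-open intervals need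
    comparing. A negative slope turns the preimage into an interval open on the other side, which
    does not affect its length. *)
Lemma lebesgue_measure_affine (a r : R) : r != 0 -> forall A : set R, measurable A ->
  leb A = (`|r|%:E * leb ((fun t => a + r * t)%R @^-1` A))%E.
Proof.
move=> r0 A mA.
have mphi : measurable_fun setT (fun t : measurableTypeR R => a + r * t : measurableTypeR R).
  by apply: measurable_funD => //; exact: measurable_funM.
pose nu : {measure set (measurableTypeR R) -> \bar R} := mscale (NngNum (normr_ge0 r)) (image_measure leb mphi).
rewrite (@lebesgue_measure_unique R nu)// => _ [[x y] /= xy <-].
rewrite /nu /mscale /= /pushforward /=.
have [rp|rn|] := ltgtP 0 r; last by move=> /esym/eqP; rewrite (negbTE r0).
- have -> : (fun t => a + r * t) @^-1` `]x, y]%classic = `](x - a) / r, (y - a) / r]%classic.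
    apply/seteqP; split => t /=; rewrite !in_itv/= ltr_pdivrMr// ler_pdivlMr// ltrBlDl lerBrDl mulrC//.
  rewrite !lebesgue_measure_itv/= !lte_fin ltr_pM2r ?invr_gt0// ltrD2r.
  case: ifP => _; last by rewrite mule0.
  by rewrite -!EFinB -EFinM gtr0_norm//; congr EFin; field.
- have -> : (fun t => a + r * t) @^-1` `]x, y]%classic = `[(y - a) / r, (x - a) / r[%classic.
    apply/seteqP; split => t /=; rewrite !in_itv/= ltr_ndivlMr// ler_ndivrMr// ltrBlDl lerBrDl (mulrC t) andbC//.
  rewrite !lebesgue_measure_itv/= !lte_fin ltr_nM2r ?invr_lt0// ltrD2r.
  case: ifP => _; last by rewrite mule0.
  by rewrite -!EFinB -EFinM ltr0_norm//; congr EFin; field.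
Qed.
Lemma integral_affine1 (a r : R) (f : R -> \bar R) : r != 0 ->
  measurable_fun setT f -> (forall t, 0 <= f t)%E ->
  (\int[leb]_t f t = `|r|%:E * \int[leb]_t f (a + r * t)%R)%E.
Proof.
move=> r0 mf f0.
have mphi : measurable_fun setT (fun t : measurableTypeR R => a + r * t : measurableTypeR R).
  by apply: measurable_funD => //; exact: measurable_funM.
transitivity (\int[mscale (NngNum (normr_ge0 r)) (image_measure leb mphi)]_t f t)%E.
  by apply: eq_measure_integral => A mA _; exact: (lebesgue_measure_affine a r0 mA).
rewrite ge0_integral_mscale//; congr (_ * _)%E.
exact: (integral_image_measure leb mphi).
Qed.
Lemma rowDE n (u v : 'rV[R]_n) i : (u + v) 0 i = u 0 i + v 0 i.
Proof. exact: mxE. Qed.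

Lemma rowZE n a (v : 'rV[R]_n) i : (a *: v) 0 i = a * v 0 i.
Proof. exact: mxE. Qed.

(** [coords] on [Rn n.+1] unfolds to exactly this, so slices of the product are refolded into it by
    conversion. *)
Definition vcons n (t : R) (v : 'rV[R]_n) : 'rV[R]_n.+1 := row_mx (t%:M : 'M[R]_1) v.

Lemma vconsE n t (v : 'rV[R]_n) (i : 'I_n.+1) :
  vcons t v 0 i = if @fintype.split 1 n i is inr j then v 0 j else t.
Proof.
rewrite /vcons mxE; case: (@fintype.split 1 n i) => // j.
by rewrite ord1 mxE eqxx mulr1n.
Qed.

Lemma vcons0E n t (v : 'rV[R]_n) : vcons t v 0 ord0 = t.
Proof. by rewrite vconsE; case: fintype.splitP => // j /= ; case: j. Qed.

Lemma vconsSE n t (v : 'rV[R]_n) (i : 'I_n) : vcons t v 0 (lift ord0 i) = v 0 i.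
Proof.
rewrite vconsE; case: fintype.splitP => [j|k /=].
  by rewrite ord1 /= /bump.
by rewrite /bump leq0n !add1n => -[] /val_inj ->.
Qed.

Lemma vconsD n a b t s (u v : 'rV[R]_n) :
  a *: vcons t u + b *: vcons s v = vcons (a * t + b * s) (a *: u + b *: v).
Proof.
apply/rowP => i; rewrite rowDE !rowZE !vconsE.
by case: fintype.splitP => j _ //; rewrite rowDE !rowZE.
Qed.

Definition sqn n (v : 'rV[R]_n) := \sum_(i < n) v 0 i ^+ 2.

Lemma sqn_ge0 n (v : 'rV[R]_n) : 0 <= sqn v.
Proof. by apply: sumr_ge0 => i _; exact: sqr_ge0. Qed.

Lemma sqn_vcons n t (v : 'rV[R]_n) : sqn (vcons t v) = t ^+ 2 + sqn v.
Proof.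
rewrite /sqn big_ord_recl vcons0E; congr (_ + _).
by apply: eq_bigr => i _; rewrite vconsSE.
Qed.

Lemma measurable_slice n d' (T' : measurableType d') (f : 'rV[R]_n.+1 -> T') (t : R) :
  measurable_fun setT (f \o @coords n.+1) ->
  measurable_fun setT ((fun v => f (vcons t v)) \o @coords n).
Proof.
move=> mf; apply: (measurableT_comp mf (_ : measurable_fun setT (pair t))).
exact: pair1_measurable.
Qed.

Definition vtail n (v : 'rV[R]_n.+1) : 'rV[R]_n := \row_i v 0 (lift ord0 i).

Lemma vcons_affine n (a : 'rV[R]_n.+1) r t v :
  a + r *: vcons t v = vcons (a 0 ord0 + r * t) (vtail a + r *: v).
Proof.
apply/rowP => i; rewrite rowDE rowZE; case: (unliftP ord0 i) => [j ->|->].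
  by rewrite !vconsSE rowDE rowZE mxE.
by rewrite !vcons0E.
Qed.

Lemma integral_coordsS n (f : 'rV[R]_n.+1 -> \bar R) :
  measurable_fun setT (f \o @coords n.+1) -> (forall v, 0 <= f v)%E ->
  (\int[lamn n.+1]_v f (coords v) =
   \int[leb]_t \int[lamn n]_v f (vcons t (coords v)))%E.
Proof.
move=> mf f0.
exact: (@fubini_tonelli1 _ _ _ _ R leb (lamn n) (f \o @coords n.+1) mf (fun v => f0 (@coords n.+1 v))).
Qed.

Lemma measurable_integral_slice n (f : 'rV[R]_n.+1 -> \bar R) :
  measurable_fun setT (f \o @coords n.+1) -> (forall v, 0 <= f v)%E ->
  measurable_fun setT (fun t : R => \int[lamn n]_v f (vcons t (coords v)))%E.
Proof.
move=> mf f0.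
exact: (@measurable_fun_fubini_tonelli_F _ _ _ _ R (lamn n) (f \o @coords n.+1) mf (fun v => f0 (@coords n.+1 v))).
Qed.

(** Lebesgue measurability lives on [Rn n]: an affine map of row vectors can be composed with
    measurable functions only once lifted through [coords]. *)
Lemma lift_affine n (a : 'rV[R]_n) (r : R) : exists A : Rn n -> Rn n,
  measurable_fun setT A /\ forall v, coords (A v) = a + r *: coords v.
Proof.
elim: n a => [|n IH] a.
  by exists id; split; [exact: measurable_id|move=> v; apply/rowP => -[]].
have [A [mA AE]] := IH (vtail a).
exists (fun v => (a 0 ord0 + r * v.1, A v.2)); split.
  apply/measurable_fun_pairP; split.
    apply: (measurable_funD (measurable_cst _)).
    by apply: (measurable_funM (measurable_cst _)); exact: measurable_fst.
  exact: (measurableT_comp mA measurable_snd).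
move=> v.
rewrite -[LHS]/(vcons (a 0 ord0 + r * v.1) (coords (A v.2))) AE.
by rewrite -[coords v]/(vcons v.1 (coords v.2)) vcons_affine.
Qed.

Lemma measurable_affine n d' (T' : measurableType d') (a : 'rV[R]_n) (r : R) (f : 'rV[R]_n -> T') :
  measurable_fun setT (f \o @coords n) ->
  measurable_fun setT ((fun v => f (a + r *: v)) \o @coords n).
Proof.
move=> mf; have [A [mA AE]] := lift_affine a r.
rewrite (_ : _ \o _ = (f \o @coords n) \o A); first exact: (measurableT_comp mf mA).
by apply/funext => v /=; rewrite AE.
Qed.

(** Fubini: the one-dimensional change of variables acts on the first coordinate, the induction
    hypothesis on each slice. *)
Lemma integral_affine n (a : 'rV[R]_n) (r : R) (f : 'rV[R]_n -> \bar R) :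
  r != 0 -> measurable_fun setT (f \o @coords n) -> (forall v, 0 <= f v)%E ->
  (\int[lamn n]_v f (coords v) =
  (`|r| ^+ n)%:E * \int[lamn n]_v f (a + r *: coords v)%R)%E.
Proof.
move=> r0; elim: n a f => [|n IH] a f mf f0.
  rewrite expr0 mul1e; apply: eq_integral => v _; congr f.
  by apply/rowP => -[].
rewrite integral_coordsS// (integral_coordsS (measurable_affine a r mf))//.
pose G s := (\int[lamn n]_v f (vcons s (coords v)))%E.
have G0 s : (0 <= G s)%E by exact: integral_ge0.
have mG : measurable_fun setT G by exact: measurable_integral_slice.
have rn0 : `|r| ^+ n != 0 by rewrite expf_neq0// normr_eq0.
have E : forall t : R, (\int[lamn n]_v f (a + r *: vcons t (coords v))%R
  = (`|r| ^+ n)^-1%:E * G (a 0 ord0 + r * t)%R)%E.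
  move=> t; pose s := a 0 ord0 + r * t.
  rewrite /G (IH (vtail a) (fun v => f (vcons s v)) (measurable_slice s mf))//.
  rewrite muleA -EFinM mulVf// mul1e.
  by apply: eq_integral => v _; rewrite vcons_affine.
under [in RHS]eq_integral do rewrite E.
rewrite ge0_integralZl//=; last first.
  apply: (measurableT_comp mG).
  by apply: measurable_funD => //; exact: measurable_funM.
rewrite muleA -EFinM exprS -mulrA mulfV// mulr1.
exact: integral_affine1.
Qed.

Lemma measurable_sqn n : measurable_fun setT (@sqn n \o @coords n).
Proof.
rewrite (_ : _ \o _ = fun v => \sum_(i < n) (coords v 0 i) ^+ 2)//.
by apply: measurable_sum => i; apply: measurable_funX; exact: measurable_coords.
Qed.

Lemma measurable_gauss n : measurable_fun setT ((fun v => (expR (- sqn v))%:E) \o @coords n).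
Proof.
apply/measurable_EFinP; apply: (measurableT_comp (@measurable_expR R)).
exact: measurable_funN (@measurable_sqn n).
Qed.

Lemma integral_gauss n :
  (\int[lamn n]_v (expR (- sqn (coords v)))%:E = ((Num.sqrt pi) ^+ n)%:E)%E.
Proof.
elim: n => [|n IH].
  rewrite integral_dirac//= diracT mul1e expr0.
  by rewrite /sqn big_ord0 oppr0 expR0.
rewrite (integral_coordsS (f := fun v => (expR (- sqn v))%:E)); last 2 first.
- exact: measurable_gauss.
- by move=> v; rewrite lee_fin expR_ge0.
under eq_integral.
  move=> t _.
  under eq_integral do rewrite sqn_vcons opprD expRD EFinM.
  rewrite ge0_integralZl//; last exact: measurable_gauss.
  rewrite IH muleC.
  over.
rewrite ge0_integralZl//=.
  by rewrite (@integralT_gauss R) -EFinM exprSr.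
by apply/measurable_EFinP; exact: measurable_gauss_fun.
Qed.

Definition vol n (A : set 'rV[R]_n) : \bar R := lamn n (@coords n @^-1` A).

(** Distinct from measurability in [HdT R n d], the Caratheodory sigma-algebra that the same row
    vectors carry for Hausdorff measure. *)
Definition mrset n (A : set 'rV[R]_n) : Prop := measurable (@coords n @^-1` A).

Definition cball n (r : R) : set 'rV[R]_n := [set v | sqn v <= r ^+ 2].

Lemma mrset_cball n r : mrset (@cball n r).
Proof.
rewrite /mrset; have := @measurable_sqn n measurableT _ (measurable_itv `]-oo, r ^+ 2]).
by rewrite setTI set_itvE.
Qed.

Lemma sqnZ n a (v : 'rV[R]_n) : sqn (a *: v) = a ^+ 2 * sqn v.
Proof. by rewrite /sqn mulr_sumr; apply: eq_bigr => i _; rewrite rowZE exprMn. Qed.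

Lemma integral_indic_coords n (A : set 'rV[R]_n) : mrset A ->
  (\int[lamn n]_v (\1_A (coords v))%:E = vol A)%E.
Proof.
move=> mA; rewrite /vol -[X in _ = lamn n X]setIT -integral_indic//.
Qed.

(** Minus the derivative of [exp (- r ^ 2)], so that its tail integrals are explicit. *)
Definition halfgauss (r : R) := 2 * r * expR (- r ^+ 2).

Lemma continuous_halfgauss : continuous halfgauss.
Proof.
move=> x; apply: continuousM; last exact: continuous_gauss_fun.
by apply: continuousM; [exact: cst_continuous|exact: cvg_id].
Qed.

Lemma integral_halfgauss (s : R) : 0 <= s ->
  (\int[leb]_(r in `[s, +oo[) (halfgauss r)%:E = (expR (- s ^+ 2))%:E)%E.
Proof.
move=> s0.
have D : forall x : R, is_derive x 1 (fun r => - gauss_fun r) (halfgauss x).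
  move=> x; rewrite /gauss_fun /halfgauss.
  apply: is_derive_eq.
  by rewrite /GRing.scale /=; ring.
rewrite (@ge0_continuous_FTC2y _ _ (fun r => - gauss_fun r) _ 0).
- by rewrite sub0e -EFinN opprK.
- move=> x sx; rewrite /halfgauss mulr_ge0 ?expR_ge0// mulr_ge0//.
  exact: le_trans sx.
- exact/continuous_subspaceT/continuous_halfgauss.
- by rewrite -oppr0; apply: cvgN; exact: cvg_gauss_fun.
- by move=> x _; apply: ex_derive.
- apply: cvgN; apply: cvg_at_right_filter; exact: continuous_gauss_fun.
- by move=> x _; rewrite derive1E; apply: derive_val.
Qed.

Lemma mrset_affine n (a : 'rV[R]_n) (r : R) (A : set 'rV[R]_n) :
  mrset A -> mrset [set v | A (a + r *: v)].
Proof.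
move=> mA; have [B [mB BE]] := lift_affine a r.
have := mB measurableT _ mA; rewrite setTI /mrset; congr measurable.
by apply/seteqP; split => v /=; rewrite BE.
Qed.

Lemma vol_affine n (a : 'rV[R]_n) (r : R) (A : set 'rV[R]_n) : r != 0 -> mrset A ->
  (vol A = (`|r| ^+ n)%:E * vol [set v | A (a + r *: v)%R])%E.
Proof.
move=> r0 mA; rewrite -integral_indic_coords//.
have mf : measurable_fun setT ((fun v => (\1_A v)%:E : \bar R) \o @coords n).
  apply/measurable_EFinP.
  exact: (measurable_indic (mA : measurable (@coords n @^-1` A))).
rewrite (integral_affine a r0 mf) => [|v]; last by rewrite lee_fin.
by congr (_ * _)%E; rewrite -integral_indic_coords//; exact: mrset_affine.
Qed.

Lemma vol_cballZ n r : 0 < r -> (vol (@cball n r) = (r ^+ n)%:E * vol (@cball n 1))%E.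
Proof.
move=> r0; rewrite (vol_affine 0 (lt0r_neq0 r0) (@mrset_cball n r)) gtr0_norm//.
congr (_ * vol _)%E; apply/seteqP; split => v; rewrite /cball /= add0r sqnZ expr1n.
  by rewrite -[leRHS]mulr1 ler_pM2l// exprn_gt0.
by move=> v1; rewrite -[leRHS]mulr1 ler_pM2l// exprn_gt0.
Qed.

Lemma vol_ge0 n (A : set 'rV[R]_n) : (0 <= vol A)%E.
Proof. exact: measure_ge0. Qed.

(** On the unit ball the Gaussian is at least [exp (-1)], and its total integral is finite. *)
Lemma vol_cball1_fin n : vol (@cball n 1) \is a fin_num.
Proof.
rewrite ge0_fin_numE ?vol_ge0//.
have : ((expR (-1))%:E * vol (@cball n 1) <= ((Num.sqrt pi) ^+ n)%:E :> \bar R)%E.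
  rewrite -integral_gauss -integral_indic_coords//; last exact: mrset_cball.
  have mi : measurable_fun setT (fun v : Rn n => (\1_(@cball n 1) (coords v))%:E : \bar R).
    by apply/measurable_EFinP; exact: (measurable_indic (mrset_cball n 1)).
  rewrite -ge0_integralZl//.
  apply: ge0_le_integral => //.
  - exact: measurable_funeM.
  - exact: measurable_gauss.
  - move=> v _; rewrite -EFinM lee_fin indicE; case: (boolP (_ \in _)) => [|_]; last by rewrite mulr0 expR_ge0.
    by rewrite inE /cball /= expr1n mulr1 ler_expR lerN2.
have := vol_ge0 (@cball n 1).
case: (vol (@cball n 1)) => [x|_|]//; first by rewrite ltry.
by rewrite mulry gtr0_sg ?expR_gt0// mul1e leye_eq.
Qed.

Definition cvol n : R := fine (vol (@cball n 1)).

Lemma cvol_ge0 n : 0 <= cvol n. Proof. by rewrite /cvol fine_ge0// vol_ge0. Qed.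

Lemma vol_cball n r : 0 < r -> vol (@cball n r) = (cvol n * r ^+ n)%:E.
Proof. by move=> r0; rewrite vol_cballZ// mulrC EFinM fineK// vol_cball1_fin. Qed.

(** By the substitution [u = r ^ 2] this is Gamma (n / 2 + 1), the denominator in the classical
    formula for the volume of the unit ball. *)
Definition gmom n : \bar R := (\int[leb]_(r in `]0%R, +oo[) (halfgauss r * r ^+ n)%:E)%E.

Local Open Scope ereal_scope.

Lemma tonelli_swap d1 d2 (T1 : measurableType d1) (T2 : measurableType d2)
  (m1 : {sigma_finite_measure set T1 -> \bar R}) (m2 : {sigma_finite_measure set T2 -> \bar R})
  (f : T1 -> T2 -> \bar R) : measurable_fun setT (fun z => f z.1 z.2) ->
  (forall x y, 0 <= f x y) ->
  \int[m1]_x \int[m2]_y f x y = \int[m2]_y \int[m1]_x f x y.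
Proof.
move=> mf f0.
exact: (@fubini_tonelli _ _ _ _ _ m1 m2 (fun z => f z.1 z.2) mf (fun z => f0 z.1 z.2)).
Qed.

Lemma measurable_halfgauss : measurable_fun setT halfgauss.
Proof. exact: continuous_measurable_fun continuous_halfgauss. Qed.

(* Both sides are [\int \int_(r > |v|) 2 r exp (- r^2) dr dv], since the inner integral is [exp (- |v|^2)]. *)
Lemma gmomE n : (cvol n)%:E * gmom n = ((Num.sqrt pi) ^+ n)%:E.
Proof.
rewrite -integral_gauss /gmom.
pose f (v : Rn n) (r : measurableTypeR R) : \bar R :=
  ((if (0 < r)%R && (sqn (coords v) <= r ^+ 2)%R then halfgauss r else 0)%R)%:E.
have f0 v r : 0 <= f v r.
  rewrite /f lee_fin; case: ifP => // /andP[r0 _].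
  by rewrite /halfgauss !mulr_ge0// ?expR_ge0// ltW.
have mf : measurable_fun setT (fun z : Rn n * measurableTypeR R => f z.1 z.2).
  apply/measurable_EFinP; apply: measurable_fun_if => //=.
  - apply: measurable_and.
      by apply: measurable_fun_ltr => //; exact: measurable_snd.
    apply: measurable_fun_ler.
      exact: (measurableT_comp (@measurable_sqn n) measurable_fst).
    by apply: measurable_funX; exact: measurable_snd.
  - apply: measurable_funTS.
    exact: (measurableT_comp measurable_halfgauss measurable_snd).
rewrite -ge0_integralZl//; last 3 first.
- apply/measurable_funTS/measurable_EFinP/measurable_funM => //.
  exact: measurable_halfgauss.
- move=> r; rewrite /= in_itv/= andbT => r0.
  by rewrite lee_fin /halfgauss !mulr_ge0// ?expR_ge0 ?exprn_ge0// ltW.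
- by rewrite lee_fin cvol_ge0.
rewrite integral_mkcond.
transitivity (\int[leb]_r \int[lamn n]_v f v r).
  apply: eq_integral => r _; rewrite patchE mem_setE in_itv/= andbT.
  case: ifPn => r0; last first.
    by rewrite integral0_eq// => v _; rewrite /f (negbTE r0).
  rewrite -EFinM mulrCA EFinM -vol_cball// -integral_indic_coords; last exact: mrset_cball.
  rewrite -ge0_integralZl//; last 2 first.
  - by apply/measurable_EFinP; exact: (measurable_indic (mrset_cball n r)).
  - by rewrite lee_fin /halfgauss !mulr_ge0// ?expR_ge0// ltW.
  apply: eq_integral => v _; rewrite /f r0 /= indicE -EFinM.
  have -> : (coords v \in cball r) = (sqn (coords v) <= r ^+ 2)%R by apply/idP/idP; rewrite inE.
  by case: ifP; rewrite ?mulr1 ?mulr0.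
rewrite -tonelli_swap//; apply: eq_integral => v _.
rewrite -[sqn _](sqr_sqrtr (sqn_ge0 _)) -integral_halfgauss ?sqrtr_ge0//.
rewrite [RHS]integral_mkcond; apply: eq_integral => r _.
rewrite patchE mem_setE in_itv/= andbT /f.
have [sr|sr] := leP (Num.sqrt (sqn (coords v))) r; last first.
  case: ifP => // /andP[r0]; rewrite -ler_sqrt ?sqr_ge0// sqrtr_sqr gtr0_norm//.
  by rewrite leNgt sr.
have r0 : (0 <= r)%R by apply: le_trans sr; exact: sqrtr_ge0.
move: sr; rewrite -(ler_pXn2r (n := 2))// ?nnegrE ?sqrtr_ge0// sqr_sqrtr ?sqn_ge0// => ->.
rewrite andbT; case: ltgtP r0 => // <- _.
by rewrite /halfgauss mulr0 mul0r.
Qed.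

Lemma integral_pow n (r : R) : (0 < r)%R ->
  \int[leb]_(s in `[0%R, r]) (n.+2%:R * s ^+ n.+1)%:E = (r ^+ n.+2)%:E.
Proof.
move=> r0; pose F (s : R) := (s ^+ n.+2)%R.
have C : continuous (fun s : R => n.+2%:R * s ^+ n.+1)%R.
  by move=> x; apply: cvgM; [exact: cvg_cst|exact: exprn_continuous].
have := @continuous_FTC2 R (fun s : R => n.+2%:R * s ^+ n.+1)%R F _ _ r0.
rewrite /F expr0n/= sube0; apply.
- exact/continuous_subspaceT/C.
- split => //.
  + by move=> x _; exact: exprn_derivable.
  + by apply: cvg_at_right_filter; exact: exprn_continuous.
  + by apply: cvg_at_left_filter; exact: exprn_continuous.
- by move=> x _; rewrite derive1E exp_derive// /GRing.scale/= mulr1 mulrC.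
Qed.

(** The functional equation of Gamma. Integration by parts is replaced by Tonelli: write [r ^ n.+2]
    as the integral of its derivative over [[0, r]] and integrate in [r] first, over the tail [[s,
    +oo[]. *)
Lemma gmomSS n : gmom n.+2 = (n.+2%:R / 2)%:E * gmom n.
Proof.
pose f (r s : measurableTypeR R) : \bar R :=
  ((if (0 <= s)%R && (s <= r)%R then halfgauss r * (n.+2%:R * s ^+ n.+1) else 0)%R)%:E.
have f0 r s : 0 <= f r s.
  rewrite /f lee_fin; case: ifP => // /andP[s0 sr].
  by rewrite /halfgauss !mulr_ge0// ?expR_ge0// ?exprn_ge0// (le_trans s0).
have mf : measurable_fun setT (fun z : measurableTypeR R * measurableTypeR R => f z.1 z.2).
  apply/measurable_EFinP; apply: measurable_fun_if => //=.
  - apply: measurable_and.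
      by apply: measurable_fun_ler => //; exact: measurable_snd.
    by apply: measurable_fun_ler; [exact: measurable_snd|exact: measurable_fst].
  - apply: measurable_funTS; apply: measurable_funM.
      exact: (measurableT_comp measurable_halfgauss measurable_fst).
    apply: measurable_funM => //.
    by apply: measurable_funX; exact: measurable_snd.
transitivity (\int[leb]_r \int[leb]_s f r s).
  rewrite /gmom integral_mkcond; apply: eq_integral => r _.
  rewrite patchE mem_setE in_itv/= andbT.
  case: ifPn => [r0|]; last first.
    rewrite -leNgt => r0; rewrite integral0_eq// => s _; rewrite /f.
    case: ifP => // /andP[s0 sr].
    have -> : r = 0%R by apply/eqP; rewrite eq_le r0 (le_trans s0 sr).
    by rewrite /halfgauss mulr0 !mul0r.
  have -> : (halfgauss r * r ^+ n.+2)%:E =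
      (halfgauss r)%:E * \int[leb]_(s in `[0%R, r]) (n.+2%:R * s ^+ n.+1)%:E.
    by rewrite integral_pow.
  rewrite -ge0_integralZl//; last 3 first.
  - by apply/measurable_EFinP/measurable_funTS/measurable_funM.
  - move=> s; rewrite /= in_itv/= => /andP[s0 _].
    by rewrite lee_fin mulr_ge0// exprn_ge0.
  - by rewrite lee_fin /halfgauss !mulr_ge0// ?expR_ge0// ltW.
  rewrite integral_mkcond; apply: eq_integral => s _.
  by rewrite patchE mem_setE in_itv/= /f; case: ifP.
rewrite tonelli_swap// /gmom -ge0_integralZl//; last 2 first.
- apply/measurable_funTS/measurable_EFinP/measurable_funM => //.
  exact: measurable_halfgauss.
- move=> r; rewrite /= in_itv/= andbT => r0.
  by rewrite lee_fin /halfgauss !mulr_ge0// ?expR_ge0 ?exprn_ge0// ltW.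
rewrite [RHS]integral_mkcond; apply: eq_integral => s _.
rewrite patchE mem_setE in_itv/= andbT.
have [s0|s0] := ltP 0%R s; last first.
  rewrite integral0_eq// => r _; rewrite /f; case: ifP => // /andP[s0' _].
  have -> : s = 0%R by apply/eqP; rewrite eq_le s0 s0'.
  by rewrite expr0n/= !mulr0.
transitivity ((n.+2%:R * s ^+ n.+1)%:E * \int[leb]_(r in `[s, +oo[) (halfgauss r)%:E).
  rewrite -ge0_integralZl//; last 3 first.
  - by apply/measurable_EFinP/measurable_funTS; exact: measurable_halfgauss.
  - move=> r; rewrite /= in_itv/= andbT => r0.
    by rewrite lee_fin /halfgauss !mulr_ge0// ?expR_ge0// (le_trans (ltW s0)).
  - by rewrite lee_fin mulr_ge0// exprn_ge0// ltW.
  rewrite [RHS]integral_mkcond; apply: eq_integral => r _.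
  rewrite patchE mem_setE in_itv/= andbT /f (ltW s0)/=.
  by case: ifP => // _; rewrite -EFinM mulrC.
rewrite integral_halfgauss ?(ltW s0)// -!EFinM; congr EFin.
by rewrite /halfgauss exprS; field.
Qed.

Lemma cvol0 : cvol 0 = 1%R.
Proof.
rewrite /cvol /vol /= (_ : _ @^-1` _ = setT); first by rewrite /dirac indicT.
apply/seteqP; split => // v _; rewrite /cball /= /sqn big_ord0 expr1n//.
Qed.

Lemma cvol1 : cvol 1 = 2%R.
Proof.
have sq1 (t : R) : (t ^+ 2 <= 1)%R = (`|t| <= 1)%R.
  by rewrite -[in RHS](@ler_pXn2r _ 2)// ?nnegrE// expr1n real_normK// num_real.
rewrite /cvol /vol (_ : _ @^-1` _ = `[(-1)%R, 1%R] `*` setT); last first.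
  apply/seteqP; split => -[t u]; rewrite /cball /= -[row_mx _ _]/(vcons t (coords (u : Rn 0))) sqn_vcons
    /sqn big_ord0 addr0 expr1n in_itv/= sq1 ler_norml.
  - by split.
  - by case.
rewrite /= /product_sfm product_measure1E//= lebesgue_measure_itv/= lte_fin.
rewrite ifT; last by lra.
by rewrite /dirac indicT mule1 /= opprK -[2%R]/(1 + 1)%R.
Qed.

Lemma dfact_gt0 n : (0 < dfact n)%N.
Proof.
suff : (0 < dfact n)%N && (0 < dfact n.+1)%N by case/andP.
by elim: n => // n /andP[n0 n1]; rewrite n1/= muln_gt0.
Qed.

Lemma omegaSS n : omega R n.+2 = (omega R n * (2 * pi / n.+2%:R))%R.
Proof.
rewrite /omega /= negbK; case: ifPn => on.
  have d0 : (dfact n)%:R != 0%R :> R by rewrite pnatr_eq0 -lt0n dfact_gt0.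
  have : n.+2%:R != 0%R :> R by [].
  rewrite natrM !exprS; move: (n.+2%:R : R) ((dfact n)%:R : R) d0 => N d d0 N0.
  by field; rewrite ?d0 ?N0.
have n2 : n.+2%:R = (2 * (n./2).+1%:R)%R :> R.
  by rewrite -natrM mul2n doubleS -{1}(odd_double_half n) (negbTE on).
have : (n./2).+1%:R != 0%R :> R by [].
have : (n./2)`!%:R != 0%R :> R by rewrite pnatr_eq0 -lt0n fact_gt0.
rewrite n2 factS natrM exprS.
move: ((n./2).+1%:R : R) ((n./2)`!%:R : R) => N d d0 N0.
by field; rewrite ?d0 ?N0.
Qed.

Lemma gmom_ge0 n : 0 <= gmom n.
Proof.
apply: integral_ge0 => r; rewrite /= in_itv/= andbT => r0.
by rewrite lee_fin /halfgauss !mulr_ge0// ?expR_ge0 ?exprn_ge0// ltW.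
Qed.

(** [omega] and [cvol] have the same product with [gmom]: for [omega] by a two-step induction that
    follows its split by parity, started at the volumes in dimensions 0 and 1. That product being
    positive and finite, [gmom n] can be cancelled. *)
Lemma cvolE n : cvol n = omega R n.
Proof.
have H : (omega R n)%:E * gmom n = ((Num.sqrt pi) ^+ n)%:E.
  suff : (omega R n)%:E * gmom n = ((Num.sqrt pi) ^+ n)%:E /\
     (omega R n.+1)%:E * gmom n.+1 = ((Num.sqrt pi) ^+ n.+1)%:E by case.
  elim: n => [|n [IH1 IH2]].
    split; rewrite -gmomE.
      by rewrite cvol0 /omega /= expr0 divr1.
    by rewrite cvol1 /omega /= expr1 expr0 mulr1 divr1.
  split => //; rewrite gmomSS omegaSS muleCA muleA -EFinM.
  have -> : (n.+2%:R / 2 * (omega R n * (2 * pi / n.+2%:R)) = pi * omega R n)%R.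
    have : n.+2%:R != 0%R :> R by [].
    by move: (n.+2%:R : R) => N N0; field.
  rewrite EFinM -muleA IH1 -EFinM; congr EFin.
  by rewrite -[X in (X * _)%R](sqr_sqrtr (pi_ge0 _)) !exprS; ring.
have s0 : 0 < (Num.sqrt pi ^+ n)%:E :> \bar R.
  by rewrite lte_fin exprn_gt0// sqrtr_gt0 pi_gt0.
have := gmomE n; have := gmom_ge0 n; move: H s0 (cvol_ge0 n).
case: (gmom n) => [g| |]// => [[<-]|].
  rewrite lte_fin -EFinM => w0 _ _ [] /mulIf; apply.
  by apply/eqP => g0; move: w0; rewrite g0 mulr0 ltxx.
(* Were [gmom n] infinite, the product with [omega R n] would be infinite or 0, never the positive
   real [sqrt pi ^ n]. *)
move=> H s0 _ _; move: s0; rewrite -H.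
have [w0|w0|w0] := ltgtP 0%R (omega R n).
- by move: H; rewrite gt0_muley ?lte_fin.
- by move: H; rewrite lt0_muley ?lte_fin.
- by rewrite -w0 mul0e ltxx.
Qed.

End lebesgue_rn.

(** * The isodiametric inequality *)

Section brunn_minkowski.
Variable R : realType.
Local Notation leb := (@lebesgue_measure R).

(** Take [a] in [A] near its supremum and [b] in [B] near its infimum. Then [C] contains
    [(A + b) / 2] and [(a + B) / 2]. Cutting [A] above [a] and [B] below [b] costs at most [e / 2]
    each and puts these two sets on opposite sides of [(a + b) / 2]. *)
Lemma brunn_minkowski1 (A B C : set R) (M : R) :
  measurable A -> measurable B -> measurable C ->
  A !=set0 -> B !=set0 ->
  A `<=` [set x | `|x| <= M] -> B `<=` [set x | `|x| <= M] ->
  (forall x y, A x -> B y -> C ((x + y) / 2)) ->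
  (leb A + leb B <= 2%:E * leb C)%E.
Proof.
move=> mA mB mC A0 B0 AM BM ABC.
have sA : has_sup A by split => //; exists M => x /AM /= /ler_normlW.
have iB : has_inf B.
  by split => //; exists (- M) => x /BM /=; rewrite ler_norml => /andP[].
apply/lee_addgt0Pr => e e0.
have e2 : 0 < e / 2 by rewrite divr_gt0.
have [a Aa ae] := sup_adherent e2 sA.
have [b Bb be] := inf_adherent e2 iB.
pose A1 := A `&` `]-oo, a]; pose B1 := B `&` `]b, +oo[.
have mA1 : measurable A1 by exact: measurableI.
have mB1 : measurable B1 by exact: measurableI.
have lA : (leb A <= leb A1 + (e / 2)%:E)%E.
  apply: (@le_trans _ _ (leb (A1 `|` `[a, sup A]))).
    apply: le_measure; rewrite ?inE//; first exact: measurableU.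
    move=> x Ax; have [xa|xa] := leP x a; [left|right].
      by split => //=; rewrite in_itv.
    by rewrite /= in_itv/= (ltW xa)/=; apply: sup_upper_bound.
  apply: (le_trans (measureU2 _ _ _)) => //; apply: leeD => //.
  rewrite /= lebesgue_measure_itv/=; case: ifP => _; last by rewrite lee_fin ltW.
  by rewrite -EFinB lee_fin; lra.
have lB : (leb B <= leb B1 + (e / 2)%:E)%E.
  apply: (@le_trans _ _ (leb (B1 `|` `[inf B, b]))).
    apply: le_measure; rewrite ?inE//; first exact: measurableU.
    move=> x Bx; have [xb|xb] := leP x b; [right|left].
      by rewrite /= in_itv/= xb andbT; apply: ge_inf => //; exact: iB.2.
    by split => //=; rewrite in_itv/= xb.
  apply: (le_trans (measureU2 _ _ _)) => //; apply: leeD => //.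
  rewrite /= lebesgue_measure_itv/=; case: ifP => _; last by rewrite lee_fin ltW.
  by rewrite -EFinB lee_fin; lra.
have n2 : 2 != 0 :> R by [].
rewrite [e]splitr EFinD.
apply: (le_trans (leeD lA lB)); rewrite addeACA leeD2r//.
pose SA := (fun z => - b + 2 * z) @^-1` A1.
pose SB := (fun z => - a + 2 * z) @^-1` B1.
have mS c (X : set R) : measurable X -> measurable ((fun z => c + 2 * z) @^-1` X).
  move=> mX; rewrite -[X in measurable X]setTI.
  have : measurable_fun setT (fun z : R => c + 2 * z).
    by apply: measurable_funD => //; exact: measurable_funM.
  by apply.
rewrite (lebesgue_measure_affine (- b) n2 mA1) (lebesgue_measure_affine (- a) n2 mB1).
rewrite ger0_norm// -ge0_muleDr//; apply: lee_wpmul2l => //.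
rewrite -measureU//; [|exact: mS|exact: mS|].
  apply: le_measure; rewrite ?inE//; first by apply: measurableU; exact: mS.
  move=> z [[/= h _]|[/= h _]].
    have := ABC _ _ h Bb; congr C; by lra.
  have := ABC _ _ Aa h; congr C; by lra.
apply/seteqP; split => // z [[/= _ +] [/= _]].
rewrite !in_itv/= andbT; lra.
Qed.

Lemma measurable_superlevel d (T : measurableType d) (f : T -> R) (a : R) :
  measurable_fun setT f -> measurable [set x | a < f x].
Proof.
move=> mf; have := mf measurableT _ (measurable_itv `]a, +oo[).
by rewrite setTI set_itvE.
Qed.

Lemma measurable_superlevel_measure d (T : measurableType d)
  (mu : {sigma_finite_measure set T -> \bar R}) (f : T -> R) (c : R) :
  measurable_fun setT f ->
  measurable_fun setT (fun t : R => mu [set x | t * c < f x]).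
Proof.
move=> mf.
pose g (z : T * measurableTypeR R) : \bar R := ((if z.2 * c < f z.1 then 1 else 0 : R)%:E).
have mg : measurable_fun setT g.
  apply/measurable_EFinP; apply: measurable_fun_if => //.
  apply: measurable_fun_ltr; last exact: (measurableT_comp mf measurable_fst).
  by apply: measurable_funM => //; exact: measurable_snd.
have g0 z : (0 <= g z)%E by rewrite /g lee_fin; case: ifP.
have mG := @measurable_fun_fubini_tonelli_G _ _ _ _ R mu g mg g0.
suff -> : (fun t : R => mu [set x | t * c < f x]) = fubini_G mu g by [].
apply/esym/funext => t; rewrite -[X in _ = mu X]setIT -integral_indic//; last exact: measurable_superlevel.
apply: eq_integral => x _; rewrite /g /= indicE; congr EFin.
have -> : (x \in [set x0 | t * c < f x0]) = (t * c < f x) by apply/idP/idP; rewrite inE.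
by case: ifP.
Qed.

(** Levels are counted in units of [c], so that different functions can be compared at the same
    fraction of their suprema. *)
Lemma layer_cake d (T : measurableType d) (mu : {sigma_finite_measure set T -> \bar R})
  (f : T -> R) (c : R) : measurable_fun setT f -> (forall x, 0 <= f x) -> 0 < c ->
  (\int[mu]_x (f x)%:E =
   c%:E * \int[leb]_(t in `[0%R, +oo[) mu [set x | (t * c < f x)%R])%E.
Proof.
move=> mf f0 c0.
pose g (x : T) (t : measurableTypeR R) : \bar R :=
  (((0 <= t) && (t * c < f x))%:R : R)%:E.
have g0 x t : (0 <= g x t)%E by rewrite lee_fin.
have mg : measurable_fun setT (fun z : T * measurableTypeR R => g z.1 z.2).
  apply/measurable_EFinP.
  rewrite (_ : (fun _ => _) = (fun z => if (0 <= z.2) && (z.2 * c < f z.1) then 1 else 0)); last first.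
    by apply/funext => z; case: ifP.
  apply: measurable_fun_if => //; apply: measurable_and.
    by apply: measurable_fun_ler => //; exact: measurable_snd.
  apply: measurable_fun_ltr; last exact: (measurableT_comp mf measurable_fst).
  by apply: measurable_funM => //; exact: measurable_snd.
transitivity (c%:E * \int[mu]_x \int[leb]_t g x t)%E.
  rewrite -ge0_integralZl//; last 3 first.
  - exact: (@measurable_fun_fubini_tonelli_F _ _ _ _ R leb (fun z => g z.1 z.2) mg (fun z => g0 z.1 z.2)).
  - by move=> x _; exact: integral_ge0.
  - by rewrite lee_fin ltW.
  apply: eq_integral => x _.
  have -> : (\int[leb]_t g x t = leb `[0%R, (f x / c)%R[)%E.
    rewrite -[X in _ = leb X]setIT -integral_indic//; apply: eq_integral => t _.
    by rewrite /g indicE mem_setE in_itv/= ltr_pdivlMr.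
  rewrite lebesgue_measure_itv/= lte_fin; case: ifPn => [_|].
    by rewrite oppr0 adde0 -EFinM mulrC divfK// gt_eqF.
  rewrite -leNgt mule0 => fc; congr EFin; apply/eqP; rewrite eq_le f0 andbT.
  by move: fc; rewrite ler_pdivrMr// mul0r.
congr (_ * _)%E; rewrite tonelli_swap// [RHS]integral_mkcond.
apply: eq_integral => t _; rewrite patchE mem_setE in_itv/= andbT.
case: ifPn => t0; last by rewrite integral0_eq// => x _; rewrite /g (negbTE t0).
rewrite -[X in _ = mu X]setIT -integral_indic//; last exact: measurable_superlevel.
apply: eq_integral => x _; rewrite /g t0 indicE /=; congr ((nat_of_bool _)%:R)%:E.
by apply/idP/idP; rewrite inE.
Qed.

(* For [t < 1], [{F > t a} + {G > t b}] is contained in [2 {H > t s}], where [a] and [b] are the suprema of [F] and [G] and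
   [s ^ 2 = a b]. Integrate the one-dimensional Brunn-Minkowski inequality over [t] and use AM-GM. *)
Lemma prekopa_leindler1 (F G H : R -> R) (M : R) :
  measurable_fun setT F -> measurable_fun setT G -> measurable_fun setT H ->
  (forall x, 0 <= F x <= M) -> (forall x, 0 <= G x <= M) -> (forall x, 0 <= H x) ->
  (forall x, F x != 0 -> `|x| <= M) -> (forall x, G x != 0 -> `|x| <= M) ->
  (\int[leb]_x (H x)%:E < +oo)%E ->
  (forall x y, F x * G y <= H ((x + y) / 2) ^+ 2) ->
  (\int[leb]_x (F x)%:E * \int[leb]_x (G x)%:E <= (\int[leb]_x (H x)%:E) ^+ 2)%E.
Proof.
move=> mF mG mH FM GM H0 sF sG Hoo FGH.
have F0 x : 0 <= F x by case/andP: (FM x).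
have G0 x : 0 <= G x by case/andP: (GM x).
have I0 (K : R -> R) : (forall x, 0 <= K x) -> (0 <= \int[leb]_x (K x)%:E)%E.
  by move=> K0; apply: integral_ge0 => x _; rewrite lee_fin.
have hsF : has_sup (range F).
  split; first by exists (F 0); exists 0.
  by exists M => _ [x _ <-]; case/andP: (FM x).
have hsG : has_sup (range G).
  split; first by exists (G 0); exists 0.
  by exists M => _ [x _ <-]; case/andP: (GM x).
have Fa x : F x <= sup (range F) by apply: sup_upper_bound => //; exists x.
have Gb x : G x <= sup (range G) by apply: sup_upper_bound => //; exists x.
have [a0|a0] := leP (sup (range F)) 0.
  have -> : (\int[leb]_x (F x)%:E = 0)%E.
    apply: integral0_eq => x _.
    by congr EFin; apply/eqP; rewrite eq_le F0 (le_trans (Fa x)).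
  by rewrite mul0e expe_ge0// I0.
have [b0|b0] := leP (sup (range G)) 0.
  have -> : (\int[leb]_x (G x)%:E = 0)%E.
    apply: integral0_eq => x _.
    by congr EFin; apply/eqP; rewrite eq_le G0 (le_trans (Gb x)).
  by rewrite mule0 expe_ge0// I0.
set a := sup _ in a0 Fa; set b := sup _ in b0 Gb.
pose s := Num.sqrt (a * b).
have s0 : 0 < s by rewrite sqrtr_gt0 mulr_gt0.
pose IF := (\int[leb]_(t in `[0%R, +oo[) leb [set x | (t * a < F x)%R])%E.
pose IG := (\int[leb]_(t in `[0%R, +oo[) leb [set x | (t * b < G x)%R])%E.
pose IH := (\int[leb]_(t in `[0%R, +oo[) leb [set x | (t * s < H x)%R])%E.
have EF : (\int[leb]_x (F x)%:E = a%:E * IF)%E by exact: layer_cake.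
have EG : (\int[leb]_x (G x)%:E = b%:E * IG)%E by exact: layer_cake.
have EH : (\int[leb]_x (H x)%:E = s%:E * IH)%E by exact: layer_cake.
have key : (IF + IG <= 2%:E * IH)%E.
  have mF' := measurable_superlevel_measure leb a mF.
  have mG' := measurable_superlevel_measure leb b mG.
  have mH' := measurable_superlevel_measure leb s mH.
  rewrite -ge0_integralD//; [|exact: measurable_funTS..].
  rewrite -ge0_integralZl//; last exact: measurable_funTS.
  apply: ge0_le_integral => //.
  - by move=> t _; exact: adde_ge0.
  - by apply: measurable_funTS; exact: emeasurable_funD.
  - by apply: measurable_funTS; exact: measurable_funeM.
  move=> t; rewrite /= in_itv/= andbT => t0.
  have [t1|t1] := ltP t 1; last first.
    rewrite (_ : [set x | t * a < F x] = set0); last first.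
      apply/seteqP; split => // x /=; rewrite ltNge => /negP; apply.
      by rewrite (le_trans (Fa x))// ler_peMl// ltW.
    rewrite (_ : [set x | t * b < G x] = set0); last first.
      apply/seteqP; split => // x /=; rewrite ltNge => /negP; apply.
      by rewrite (le_trans (Gb x))// ler_peMl// ltW.
    by rewrite !measure0 adde0 mule_ge0.
  apply: (@brunn_minkowski1 _ _ _ M); try exact: measurable_superlevel.
  - have /(sup_adherent)/(_ hsF)[_ [x _ <-]] : 0 < a - t * a by rewrite subr_gt0 gtr_pMl.
    by rewrite subKr => ?; exists x.
  - have /(sup_adherent)/(_ hsG)[_ [x _ <-]] : 0 < b - t * b by rewrite subr_gt0 gtr_pMl.
    by rewrite subKr => ?; exists x.
  - by move=> x /= ax; apply: sF; rewrite gt_eqF// (le_lt_trans _ ax)// mulr_ge0// ltW.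
  - by move=> x /= ax; apply: sG; rewrite gt_eqF// (le_lt_trans _ ax)// mulr_ge0// ltW.
  - move=> x y /= ax by_; rewrite -(ltr_pXn2r (n := 2))// ?nnegrE ?mulr_ge0// ?(ltW s0)//.
    apply: lt_le_trans (FGH x y); rewrite exprMn sqr_sqrtr; last by rewrite mulr_ge0 ?ltW.
    rewrite expr2 mulrACA.
    by apply: ltr_pM => //; rewrite mulr_ge0// ltW.
have IF0 : (0 <= IF)%E by apply: integral_ge0.
have IG0 : (0 <= IG)%E by apply: integral_ge0.
have IH0 : (0 <= IH)%E by apply: integral_ge0.
move: Hoo; rewrite EF EG EH.
move=> Hoo'; clear EF EG EH; clearbody IF IG IH.
have IHf : IH \is a fin_num.
  rewrite ge0_fin_numE//; move: Hoo'; case: (IH) => [x _|+|]; rewrite ?ltry ?ltNyr//.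
  by rewrite gt0_muley ?lte_fin.
have IFGf : (IF + IG < +oo)%E.
  by apply: le_lt_trans key _; rewrite lte_mul_pinfty// ?lee_fin// -ge0_fin_numE.
have IFf : IF \is a fin_num.
  by rewrite ge0_fin_numE// (le_lt_trans _ IFGf)// leeDl.
have IGf : IG \is a fin_num.
  by rewrite ge0_fin_numE// (le_lt_trans _ IFGf)// leeDr.
rewrite -(fineK IFf) -(fineK IGf) -(fineK IHf) in key *.
move: (fine_ge0 IF0) (fine_ge0 IG0) (fine_ge0 IH0) key.
move: (fine IF) (fine IG) (fine IH) => f g h f0 g0 h0.
rewrite -EFinD -!EFinM !lee_fin => key.
have -> : (a * f * (b * g) = s ^+ 2 * (f * g)) by rewrite sqr_sqrtr ?mulr_ge0 ?ltW//; ring.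
rewrite -expr2 exprMn; apply: ler_wpM2l; first exact: sqr_ge0.
have : (f + g) ^+ 2 <= (2 * h) ^+ 2 by rewrite ler_pXn2r// nnegrE ?addr_ge0 ?mulr_ge0.
have := sqr_ge0 (f - g).
rewrite !expr2; lra.
Qed.

(** Bounded with bounded support: a class stable under slicing, on which all integrals are finite
    and may be replaced by their real values. *)
Definition boxfun n (M : R) (f : 'rV[R]_n -> R) : Prop :=
  [/\ measurable_fun setT (f \o @coords R n), (forall v, 0 <= f v <= M) &
      forall v i, f v != 0 -> `|v 0 i| <= M].

Definition lint n (f : 'rV[R]_n -> R) : \bar R :=
  (\int[msp_mu (Rn R n)]_v (f (coords v))%:E)%E.

Lemma boxfun_slice n M (f : 'rV[R]_n.+1 -> R) t :
  boxfun M f -> boxfun M (fun v => f (vcons t v)).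
Proof.
move=> [mf fM sf]; split => [|v|v i]; [exact: measurable_slice|exact: fM|].
by move=> /(sf _ (lift ord0 i)); rewrite vconsSE.
Qed.

Lemma lint_ge0 n M (f : 'rV[R]_n -> R) : boxfun M f -> (0 <= lint f)%E.
Proof.
by move=> [_ fM _]; apply: integral_ge0 => v _; rewrite lee_fin; case/andP: (fM (coords v)).
Qed.

Lemma lintS n M (f : 'rV[R]_n.+1 -> R) : boxfun M f ->
  lint f = (\int[leb]_t lint (fun v => f (vcons t v)))%E.
Proof.
move=> [mf fM _]; apply: (integral_coordsS (f := fun v => (f v)%:E)).
  exact/measurable_EFinP.
by move=> v; rewrite lee_fin; case/andP: (fM v).
Qed.

Lemma measurable_lint_slice n M (f : 'rV[R]_n.+1 -> R) : boxfun M f ->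
  measurable_fun setT (fun t : R => lint (fun v => f (vcons t v))).
Proof.
move=> [mf fM _]; apply: (measurable_integral_slice (f := fun v => (f v)%:E)).
  exact/measurable_EFinP.
by move=> v; rewrite lee_fin; case/andP: (fM v).
Qed.

Lemma lint_bound n M (f : 'rV[R]_n -> R) : 0 <= M -> boxfun M f ->
  (lint f <= (M * (2 * M) ^+ n)%:E)%E.
Proof.
move=> M0; elim: n f => [|n IH] f bf.
  rewrite /lint /= integral_dirac//= diracT mul1e expr0 mulr1 lee_fin.
  by case: bf => _ fM _; case/andP: (fM 0).
rewrite (lintS bf).
have E t : (lint (fun v => f (vcons t v)) <=
    (M * (2 * M) ^+ n)%:E * (\1_(`[- M, M]%classic : set R) t)%:E)%E.
  rewrite indicE mem_setE in_itv/= -ler_norml.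
    have [tM|tM] := boolP (`|t| <= M).
      by rewrite mule1; apply: IH; exact: boxfun_slice.
  rewrite mule0 /lint integral0_eq// => v _; congr EFin; apply/eqP.
  apply: contraNT tM => f0; case: bf => _ _ /(_ _ ord0 f0).
  by rewrite vcons0E.
apply: (@le_trans _ _ (\int[leb]_t ((M * (2 * M) ^+ n)%:E * (\1_(`[- M, M]%classic : set R) t)%:E))%E).
  apply: ge0_le_integral => //.
  - by move=> t _; apply: (@lint_ge0 _ M); exact: boxfun_slice.
  - exact: measurable_lint_slice bf.
  - by apply: measurable_funeM; apply/measurable_EFinP.
rewrite ge0_integralZl//; last first.
- by rewrite lee_fin mulr_ge0// exprn_ge0// mulr_ge0.
- by apply/measurable_EFinP.
rewrite integral_indic// setIT /= lebesgue_measure_itv/= lte_fin.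
case: ifP => _; last by rewrite mule0 lee_fin mulr_ge0// exprn_ge0// mulr_ge0.
rewrite -EFinB -EFinM lee_fin exprS.
by rewrite opprK -mulr2n -mulr_natl; lra.
Qed.

Lemma lint_fin n M (f : 'rV[R]_n -> R) : 0 <= M -> boxfun M f -> lint f \is a fin_num.
Proof.
move=> M0 bf; rewrite ge0_fin_numE ?(lint_ge0 bf)//.
by rewrite (le_lt_trans (lint_bound M0 bf))// ltry.
Qed.

(** Slice along the first coordinate. The induction hypothesis on the slices at [t], [s] and
    [(t + s) / 2] is precisely the one-dimensional hypothesis for the slice integrals. *)
Lemma prekopa_leindler n M (f g h : 'rV[R]_n -> R) : 0 <= M ->
  boxfun M f -> boxfun M g -> boxfun M h ->
  (forall u v, f u * g v <= h (2^-1 *: (u + v)) ^+ 2) ->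
  (lint f * lint g <= lint h ^+ 2)%E.
Proof.
move=> M0; elim: n f g h => [|n IH] f g h bf bg bh fgh.
  rewrite /lint /= !integral_dirac//= diracT !mul1e -EFinM lee_fin.
  by have := fgh 0 0; rewrite addr0 scaler0 expr2.
pose S k (t : R) := fine (lint (fun v : 'rV_n => k (vcons t v))).
have SE k (t : R) : boxfun M k -> (S k t)%:E = lint (fun v : 'rV_n => k (vcons t v)).
  by move=> bk; rewrite /S fineK// (lint_fin M0)//; exact: boxfun_slice.
have SI k : boxfun M k -> lint k = (\int[leb]_t (S k t)%:E)%E.
  by move=> bk; rewrite (lintS bk); apply: eq_integral => t _; rewrite SE.
have mS k : boxfun M k -> measurable_fun setT (S k).
  move=> bk.
  exact: (measurableT_comp (fine_measurable measurableT) (measurable_lint_slice bk)).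
have S0 k t : boxfun M k -> 0 <= S k t.
  by move=> bk; rewrite /S fine_ge0// (@lint_ge0 _ M)//; exact: boxfun_slice.
have SM k t : boxfun M k -> S k t <= M * (2 * M) ^+ n.
  by move=> bk; rewrite -lee_fin SE// lint_bound//; exact: boxfun_slice.
have sS k t : boxfun M k -> S k t != 0 -> `|t| <= M.
  move=> bk; apply: contraNT => tM; rewrite /S /lint integral0_eq// => v _; congr EFin; apply/eqP.
  apply: contraNT tM => k0; case: bk => _ _ /(_ _ ord0 k0).
  by rewrite vcons0E.
rewrite (SI f bf) (SI g bg) (SI h bh).
(* The slice integrals vanish off [[- M, M]] and are bounded by [M * (2 * M) ^+ n]; the
   one-dimensional lemma takes one constant for both. *)
apply: (@prekopa_leindler1 _ _ _ (Num.max M (M * (2 * M) ^+ n))); try exact: mS.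
- by move=> t; rewrite S0//= le_max SM ?orbT.
- by move=> t; rewrite S0//= le_max SM ?orbT.
- by move=> t; exact: S0.
- by move=> t /(sS _ _ bf) tM; rewrite le_max tM.
- by move=> t /(sS _ _ bg) tM; rewrite le_max tM.
- by rewrite -SI// -ge0_fin_numE ?(lint_fin M0)// (lint_ge0 bh).
- move=> t s; rewrite -lee_fin EFinM EFin_expe !SE//.
  apply: IH; try exact: boxfun_slice.
  move=> u v; apply: (le_trans (fgh _ _)).
  by rewrite scalerDr vconsD -mulrDr -scalerDr mulrC.
Qed.

Lemma sqn_ge_coord n (v : 'rV[R]_n) i : v 0 i ^+ 2 <= sqn v.
Proof.
by rewrite /sqn (bigD1 i)//= lerDl sumr_ge0// => j _; exact: sqr_ge0.
Qed.

Lemma sqn_coord_le n (v : 'rV[R]_n) i (r : R) : 0 <= r -> sqn v <= r ^+ 2 -> `|v 0 i| <= r.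
Proof.
move=> r0 vr; rewrite -(ler_pXn2r (n := 2))// ?nnegrE// real_normK ?num_real//.
exact: le_trans (sqn_ge_coord _ _) vr.
Qed.

(* Prekopa-Leindler for the indicators of [A], [-A] and the ball of radius [r]: the midpoint of [u] and [-v] is
   [(u - v) / 2]. Symmetrization of [A] is not needed. *)
Lemma isodiametric n (A : set 'rV[R]_n) (r : R) : 0 < r -> mrset A ->
  (forall u v, A u -> A v -> sqn (u - v) <= (2 * r) ^+ 2) ->
  (vol A <= (omega R n * r ^+ n)%:E)%E.
Proof.
move=> r0 mA dA; rewrite -cvolE -vol_cball//.
have [->|/set0P[x0 Ax0]] := eqVneq A set0.
  by rewrite /vol preimage_set0 measure0 vol_ge0.
(* Large enough for the values of indicators, for the coordinates of [A], whose points are within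
   [2 * r] of [x0], and for those of the ball. *)
pose M := 1 + \sum_i `|x0 0 i| + 2 * r.
have S0 : 0 <= \sum_i `|x0 0 i| by apply: sumr_ge0 => i _; exact: normr_ge0.
have M1 : 1 <= M by rewrite /M -addrA lerDl addr_ge0// mulr_ge0// ltW.
have M0 : 0 <= M by apply: le_trans M1.
have AM v i : A v -> `|v 0 i| <= M.
  move=> Av; have := sqn_coord_le (v := v - x0) i _ (dA _ _ Av Ax0).
  rewrite rowDE [(- x0) 0 i]mxE => /(_ _)/wrap[]; first by rewrite mulr_ge0// ltW.
  have := ler_normD (v 0 i - x0 0 i) (x0 0 i); rewrite subrK.
  have : `|x0 0 i| <= \sum_i `|x0 0 i|.
    by rewrite (bigD1 i)//= lerDl sumr_ge0// => j _.
  rewrite /M; lra.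
pose f : 'rV[R]_n -> R := \1_A.
(* Reflection written as an affine map, so that the change of variables gives it the same integral
   as [f]. *)
pose g : 'rV[R]_n -> R := fun v => f (0 + (-1) *: v).
pose h : 'rV[R]_n -> R := \1_(@cball R n r).
have mf : measurable_fun setT (f \o @coords R n).
  exact: (measurable_indic (mA : measurable (@coords R n @^-1` A))).
have fb v : 0 <= f v <= M.
  by rewrite /f indicE ler0n/=; case: (_ \in _) => //=.
have fs v : f v != 0 -> A v.
  by rewrite /f indicE; case: (boolP (v \in A)) => [/[!inE]//|]; rewrite eqxx.
have bf : boxfun M f by split => // v i /fs; exact: AM.
have bg : boxfun M g.
  split => [|v|v i]; [exact: measurable_affine|exact: fb|move=> /fs/(AM _ i)].
  by rewrite add0r rowZE mulN1r normrN.
have bh : boxfun M h.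
  split => [|v|v i].
  - exact: (measurable_indic (@mrset_cball R n r)).
  - by rewrite /h indicE ler0n/=; case: (_ \in _).
  - rewrite /h indicE; case: (boolP (v \in _)); last by rewrite eqxx.
    rewrite inE /cball /= => vr _; apply: le_trans (sqn_coord_le i (ltW r0) vr) _.
    rewrite /M; lra.
have := prekopa_leindler M0 bf bg bh.
have -> : lint g = lint f.
  have := @integral_affine R n 0 (-1) (fun v => (f v)%:E).
  rewrite normrN normr1 expr1n mul1e oppr_eq0 oner_eq0 /lint => /(_ isT) -> //.
    exact/measurable_EFinP.
  by move=> v; rewrite lee_fin; case/andP: (fb v).
have -> : lint f = vol A by exact: integral_indic_coords.
have -> : lint h = vol (@cball R n r) by apply: integral_indic_coords; exact: mrset_cball.
rewrite -expe2 vol_cball// -EFin_expe.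
move=> /(_ _)/wrap[]; last first.
  have := vol_ge0 A; case: (vol A) => [x| |]//; rewrite -?EFin_expe -?EFinM !lee_fin => x0' hx.
  by rewrite -(ler_pXn2r (n := 2))// ?nnegrE// mulr_ge0 ?cvol_ge0// exprn_ge0// ltW.
move=> u v; rewrite /h indicE.
have [h1|] := boolP (_ \in _).
  rewrite expr1n; case/andP: (fb u) => u0 _; rewrite /g /f !indicE.
  by case: (_ \in _); case: (_ \in _); rewrite ?mulr0 ?mul0r ?mulr1.
rewrite expr0n/= => /negP; rewrite inE => nh.
have [->|/fs Au] := eqVneq (f u) 0; first by rewrite mul0r.
have [->|/fs Av] := eqVneq (g v) 0; first by rewrite mulr0.
exfalso; apply: nh; rewrite /cball /= sqnZ.
have := dA _ _ Au Av; rewrite add0r scaleN1r opprK exprMn; lra.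
Qed.

End brunn_minkowski.

(** * Hausdorff measure *)

Section euclidean_norm.
Context {R : realType}.
Implicit Types n : nat.

Lemma enormE n (v : 'rV[R]_n) : enorm v = Num.sqrt (sqn v). Proof. by []. Qed.

Lemma enorm_ge0 n (v : 'rV[R]_n) : 0 <= enorm v. Proof. exact: sqrtr_ge0. Qed.

Lemma sqr_enorm n (v : 'rV[R]_n) : enorm v ^+ 2 = sqn v.
Proof. by rewrite enormE sqr_sqrtr// sqn_ge0. Qed.

Lemma enorm_le n (v : 'rV[R]_n) r : 0 <= r -> (enorm v <= r) = (sqn v <= r ^+ 2).
Proof.
by move=> r0; rewrite -sqr_enorm ler_pXn2r// nnegrE enorm_ge0.
Qed.

Lemma enormZ n a (v : 'rV[R]_n) : enorm (a *: v) = `|a| * enorm v.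
Proof. by rewrite !enormE sqnZ sqrtrM ?sqr_ge0// sqrtr_sqr. Qed.

Lemma enormN n (v : 'rV[R]_n) : enorm (- v) = enorm v.
Proof. by rewrite -scaleN1r enormZ normrN1 mul1r. Qed.

Lemma enorm_distC n (u v : 'rV[R]_n) : enorm (u - v) = enorm (v - u).
Proof. by rewrite -enormN opprB. Qed.

Lemma enorm0 n : enorm (0 : 'rV[R]_n) = 0.
Proof. by rewrite -(scale0r (0 : 'rV[R]_n)) enormZ normr0 mul0r. Qed.

Lemma enorm0_eq0 n (v : 'rV[R]_n) : enorm v = 0 -> v = 0.
Proof.
move=> /(congr1 (fun x => x ^+ 2)); rewrite sqr_enorm expr0n /= => v0.
apply/rowP => i; rewrite [RHS]mxE; apply/eqP; rewrite -sqrf_eq0 eq_le sqr_ge0 andbT.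
by have := sqn_ge_coord v i; rewrite v0.
Qed.

Definition dot n (u v : 'rV[R]_n) := \sum_i u 0 i * v 0 i.

Lemma dotC n (u v : 'rV[R]_n) : dot u v = dot v u.
Proof. by apply: eq_bigr => i _; rewrite mulrC. Qed.

Lemma dotDl n a b (u v w : 'rV[R]_n) : dot (a *: u + b *: v) w = a * dot u w + b * dot v w.
Proof.
rewrite /dot !mulr_sumr -big_split; apply: eq_bigr => i _.
by rewrite rowDE !rowZE /= mulrDl !mulrA.
Qed.

Lemma dotvv n (u : 'rV[R]_n) : dot u u = sqn u.
Proof. by apply: eq_bigr => i _; rewrite expr2. Qed.

Lemma sqnD n a b (u v : 'rV[R]_n) :
  sqn (a *: u + b *: v) = a ^+ 2 * sqn u + 2 * a * b * dot u v + b ^+ 2 * sqn v.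
Proof.
rewrite -dotvv dotDl 2![dot _ (_ + _)]dotC !dotDl !dotvv (dotC v u); ring.
Qed.

(** The squared norm of [|v| u - |u| v] equals [2 |u| |v| (|u| |v| - dot u v)]. *)
Lemma cauchy_schwarz n (u v : 'rV[R]_n) : dot u v <= enorm u * enorm v.
Proof.
have [/enorm0_eq0 ->|u0] := eqVneq (enorm u) 0.
  rewrite enorm0 mul0r /dot big1// => i _; by rewrite mxE mul0r.
have [/enorm0_eq0 ->|v0] := eqVneq (enorm v) 0.
  rewrite enorm0 mulr0 /dot big1// => i _; by rewrite mxE mulr0.
have up : 0 < enorm u by rewrite lt0r u0 enorm_ge0.
have vp : 0 < enorm v by rewrite lt0r v0 enorm_ge0.
have := sqn_ge0 (enorm v *: u + (- enorm u) *: v).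
rewrite sqnD -!sqr_enorm => h.
have : 0 <= 2 * (enorm u * enorm v) * (enorm u * enorm v - dot u v) by nra.
by rewrite pmulr_rge0 ?subr_ge0// !mulr_gt0.
Qed.

Lemma enormD n (u v : 'rV[R]_n) : enorm (u + v) <= enorm u + enorm v.
Proof.
rewrite enorm_le ?addr_ge0 ?enorm_ge0//.
rewrite -[u]scale1r -[v]scale1r sqnD !scale1r -!sqr_enorm.
have := cauchy_schwarz u v; nra.
Qed.

Lemma enorm_dist n (u v w : 'rV[R]_n) : enorm (u - w) <= enorm (u - v) + enorm (v - w).
Proof. by rewrite (le_trans _ (enormD _ _))// addrA subrK. Qed.

Lemma enormB_le n (u v : 'rV[R]_n) : `|enorm u - enorm v| <= enorm (u - v).
Proof.
have h1 := enormD (u - v) v; have h2 := enormD (v - u) u.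
rewrite !subrK (enorm_distC v u) in h1 h2.
by rewrite ler_norml; apply/andP; split; lra.
Qed.

End euclidean_norm.

Section hausdorff_images.
Variable R : realType.
Local Open Scope ereal_scope.

Lemma diam_ub n (C : set 'rV[R]_n) x y : C x -> C y -> (enorm (x - y))%:E <= diam R n C.
Proof. by move=> Cx Cy; apply: ereal_sup_ubound; exists x => //; exists y. Qed.

Lemma diam_le n (C : set 'rV[R]_n) (r : R) :
  (forall x y, C x -> C y -> (enorm (x - y) <= r)%R) -> diam R n C <= r%:E.
Proof.
by move=> h; apply: ge_ereal_sup => _ [x Cx [y Cy <-]]; rewrite lee_fin; exact: h.
Qed.

Lemma adm_diam_fin n (C : set 'rV[R]_n) delta : C !=set0 -> haus_adm R n delta C ->
  diam R n C \is a fin_num.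
Proof.
move=> C0 Cd; rewrite ge0_fin_numE; first exact: le_lt_trans Cd (ltry _).
exact: diam_ge0.
Qed.

Lemma adm_diam n (C : set 'rV[R]_n) delta x y : haus_adm R n delta C -> C x -> C y ->
  (enorm (x - y) <= fine (diam R n C))%R.
Proof.
move=> Cd Cx Cy; rewrite -lee_fin fineK; first exact: diam_ub.
by apply: adm_diam_fin Cd; exists x.
Qed.

Lemma haus_zeta_le n d (C : set 'rV[R]_n) (r : R) : (0 <= r)%R ->
  (forall x y, C x -> C y -> (enorm (x - y) <= 2 * r)%R) ->
  haus_zeta d C <= (omega R d * r ^+ d)%:E.
Proof.
move=> r0 Cr; rewrite /haus_zeta; case: asboolP => [_|/eqP/set0P C0].
  by rewrite lee_fin mulr_ge0 ?omega_ge0 ?exprn_ge0.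
have D := diam_le Cr; have D0 := diam_ge0 C0.
have f0 : (0 <= fine (diam R n C))%R by rewrite fine_ge0.
rewrite lee_fin ler_wpM2l ?omega_ge0// lerXn2r ?nnegrE ?divr_ge0//.
rewrite ler_pdivrMr// mulrC -lee_fin fineK// ge0_fin_numE//.
exact: le_lt_trans D (ltry _).
Qed.

Lemma le_hausdorff_om_delta n d delta (A : set 'rV[R]_n) : (0 < delta)%R ->
  hausdorff_delta R n d delta A <= hausdorff_om R n d A.
Proof.
by move=> d0; apply: ereal_sup_ubound; exists delta => //=; rewrite in_itv/= d0.
Qed.

Lemma hausdorff_delta_le_cover n d delta (A : set 'rV[R]_n) (F : (set 'rV[R]_n)^nat) :
  (forall k, haus_adm R n delta (F k)) -> A `<=` \bigcup_k F k ->
  hausdorff_delta R n d delta A <= \sum_(k <oo) haus_zeta d (F k).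
Proof. by move=> Fd AF; apply: ereal_inf_lbound; exists F. Qed.

Lemma hausdorff_delta_cover_le n d delta (A : set 'rV[R]_n) x :
  (forall F : (set 'rV[R]_n)^nat, (forall k, haus_adm R n delta (F k)) -> A `<=` \bigcup_k F k ->
    x <= \sum_(k <oo) haus_zeta d (F k)) -> x <= hausdorff_delta R n d delta A.
Proof. by move=> h; apply: le_ereal_inf_tmp => _ [F [Fd AF] <-]; exact: h. Qed.

Lemma hausdorff_delta_ge0 n d delta (A : set 'rV[R]_n) : 0 <= hausdorff_delta R n d delta A.
Proof. by apply: methodI_ge0 => C; exact: haus_zeta_ge0. Qed.

(** Push a cover forward. Its members are first cut down to [A], where the Lipschitz bound holds.
    Pieces that become empty are treated apart, because [haus_zeta] gives the empty set cost 0 even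
    when [d = 0]. *)
Lemma hausdorff_lipschitz n k d (A : set 'rV[R]_n) (phi : 'rV[R]_n -> 'rV[R]_k) (s : R) :
  (0 < s)%R ->
  (forall x y, A x -> A y -> (enorm (phi x - phi y) <= s * enorm (x - y))%R) ->
  hausdorff_om R k d (phi @` A) <= (s ^+ d)%:E * hausdorff_om R n d A.
Proof.
move=> s0 phis; apply: ge_ereal_sup => _ [delta /= + <-].
rewrite in_itv/= andbT => d0.
have ds0 : (0 < delta / s)%R by rewrite divr_gt0.
apply: (@le_trans _ _ ((s ^+ d)%:E * hausdorff_delta R n d (delta / s)%R A)); last first.
  by rewrite lee_pmul2l ?fin_numE ?lte_fin ?exprn_gt0// le_hausdorff_om_delta.
rewrite muleC -lee_pdivrMr ?exprn_gt0//.
apply: hausdorff_delta_cover_le => F Fd AF.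
rewrite lee_pdivrMr ?exprn_gt0// muleC.
rewrite -nneseriesZl//; last by move=> i _; exact: haus_zeta_ge0.
have key i x y : (phi @` (A `&` F i)) x -> (phi @` (A `&` F i)) y ->
    (enorm (x - y) <= s * fine (diam R n (F i)))%R.
  move=> [u [Au Fu] <-] [v [Av Fv] <-]; apply: (le_trans (phis _ _ Au Av)).
  by apply: ler_wpM2l; [exact: ltW|exact: (adm_diam (Fd i))].
apply: (@le_trans _ _ (\sum_(i <oo) haus_zeta d (phi @` (A `&` F i)))).
  apply: hausdorff_delta_le_cover => [i|_ [x Ax <-]]; last first.
    by have [i _ Fx] := AF _ Ax; exists i => //; exists x.
  have [->|/set0P[_ [x [Ax Fx] _]]] := eqVneq (phi @` (A `&` F i)) set0.
    exact: haus_adm0.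
  apply: diam_le => y z h1 h2; apply: (le_trans (key _ _ _ h1 h2)).
  rewrite mulrC -ler_pdivlMr// -lee_fin fineK; first exact: Fd.
  by apply: adm_diam_fin (Fd i); exists x.
apply: lee_nneseries => [i _ _|i _]; first exact: haus_zeta_ge0.
have [->|/set0P[_ [x [Ax Fx] _]]] := eqVneq (phi @` (A `&` F i)) set0.
  by rewrite haus_zeta0 mule_ge0 ?haus_zeta_ge0// lee_fin exprn_ge0// ltW.
have F0 : F i !=set0 by exists x.
have D0 : (0 <= fine (diam R n (F i)))%R by rewrite fine_ge0// diam_ge0.
rewrite {2}/haus_zeta; case: asboolP => [FE|_]; first by rewrite FE in Fx.
apply: (le_trans (haus_zeta_le d (r := s * (fine (diam R n (F i)) / 2))%R _ _)).
- by rewrite mulr_ge0 ?(ltW s0)// divr_ge0.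
- by move=> u v hu hv; rewrite mulrCA [(2 * _)%R]mulrC divfK//; exact: key hu hv.
- by rewrite exprMn -EFinM lee_fin mulrCA.
Qed.

(** The Lipschitz estimate for the dilation and for its inverse. *)
Lemma hausdorff_affine n d (A : set 'rV[R]_n) (x : 'rV[R]_n) (h : R) : (0 < h)%R ->
  hausdorff_om R n d A = (h ^+ d)%:E * hausdorff_om R n d [set y | A (x + h *: y)%R].
Proof.
move=> h0; have hn0 : h != 0%R by rewrite gt_eqF.
set B := [set y | _].
have EA : A = (fun y => x + h *: y)%R @` B.
  apply/seteqP; split => [y Ay|_ [y By <-]//].
  exists (h^-1 *: (y - x))%R; first by rewrite /B /= scalerA divff// scale1r subrKC.
  by rewrite scalerA divff// scale1r subrKC.
have EB : B = (fun y => h^-1 *: (y - x))%R @` A.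
  apply/seteqP; split => [y By|_ [y Ay <-]].
    by exists (x + h *: y)%R => //; rewrite [(x + _)%R]addrC addrK scalerA mulVf// scale1r.
  by rewrite /B /= scalerA divff// scale1r subrKC.
apply/eqP; rewrite eq_le; apply/andP; split.
  rewrite {1}EA; apply: hausdorff_lipschitz => // u v _ _.
  by rewrite opprD addrACA subrr add0r -scalerBr enormZ gtr0_norm.
rewrite muleC -lee_pdivlMr ?exprn_gt0// muleC -exprVn {1}EB.
apply: hausdorff_lipschitz => [|u v _ _]; first by rewrite invr_gt0.
by rewrite -scalerBr enormZ gtr0_norm ?invr_gt0// opprD addrACA subrr addr0.
Qed.

End hausdorff_images.

(** * Additivity on separated sets and Caratheodory's criterion *)

Section metric_outer_measure.
Variable R : realType.
Local Open Scope ereal_scope.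

Let hausdorff_delta0 n d delta : hausdorff_delta R n d delta set0 = 0.
Proof.
by apply: methodI0; [exact: haus_adm0|exact: haus_zeta0|exact: haus_zeta_ge0].
Qed.

HB.instance Definition _ n d delta := isOuterMeasure.Build R _
  (hausdorff_delta R n d delta) (hausdorff_delta0 n d delta)
  (fun A => methodI_ge0 _ (@haus_zeta_ge0 R n d) A)
  (@le_methodI _ R (haus_adm R n delta) (haus_zeta d))
  (methodI_sigma_subadditive (haus_adm R n delta) (@haus_zeta_ge0 R n d)).

Lemma le_hausdorff_delta n d (A : set 'rV[R]_n) delta delta' : (delta <= delta')%R ->
  hausdorff_delta R n d delta' A <= hausdorff_delta R n d delta A.
Proof.
move=> dd; apply: hausdorff_delta_cover_le => F Fd AF.
apply: hausdorff_delta_le_cover => // k; apply: (le_trans (Fd k)).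
by rewrite lee_fin.
Qed.

(** A set of diameter at most [delta < eta] cannot meet both [A] and [B]. Emptying the members that
    miss [A], or those that miss [B], splits a cover of the union into two covers that share no
    cost. *)
Lemma hausdorff_delta_separated n d (A B : set 'rV[R]_n) (delta eta : R) :
  (delta < eta)%R -> (forall x y, A x -> B y -> (eta <= enorm (x - y))%R) ->
  hausdorff_delta R n d delta A + hausdorff_delta R n d delta B <=
  hausdorff_delta R n d delta (A `|` B).
Proof.
move=> de AB; apply: hausdorff_delta_cover_le => F Fd ABF.
pose G (X : set 'rV[R]_n) k := if `[< X `&` F k = set0 >] then set0 else F k.
have Gd X k : haus_adm R n delta (G X k).
  by rewrite /G; case: ifP => _; [exact: haus_adm0|exact: Fd].
have GX (X : set 'rV[R]_n) : X `<=` A `|` B -> X `<=` \bigcup_k G X k.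
  move=> XAB x Xx; have [k _ Fx] := ABF _ (XAB _ Xx); exists k => //.
  rewrite /G; case: asboolP => // XF; have : (X `&` F k) x by [].
  by rewrite XF.
have HA := hausdorff_delta_le_cover d (Gd A) (GX A (@subsetUl _ _ _)).
have HB := hausdorff_delta_le_cover d (Gd B) (GX B (@subsetUr _ _ _)).
apply: (le_trans (leeD HA HB)).
rewrite -nneseriesD//; [|by move=> *; exact: haus_zeta_ge0..].
apply: lee_nneseries => k _.
  by move=> _; rewrite adde_ge0// haus_zeta_ge0.
rewrite /G; case: asboolP => [_|/eqP/set0P[x [Ax Fx]]].
  by rewrite haus_zeta0 add0e; case: asboolP => _; rewrite ?haus_zeta0 ?haus_zeta_ge0.
case: asboolP => [_|/eqP/set0P[y [By Fy]]]; first by rewrite haus_zeta0 adde0.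
exfalso; have := AB _ _ Ax By; apply/negP; rewrite -ltNge.
by apply: le_lt_trans de; rewrite -lee_fin (le_trans _ (Fd k))// diam_ub.
Qed.

Lemma hausdorff_separated n d (A B : set 'rV[R]_n) (eta : R) :
  (0 < eta)%R -> (forall x y, A x -> B y -> (eta <= enorm (x - y))%R) ->
  hausdorff_om R n d A + hausdorff_om R n d B <= hausdorff_om R n d (A `|` B).
Proof.
move=> e0 AB; set S := hausdorff_om R n d (A `|` B).
have [->|Sfin] := eqVneq S +oo; first by rewrite leey.
have S0 : 0 <= S by exact: hausdorff_om_ge0.
have Sf : S \is a fin_num by rewrite ge0_fin_numE// ltey.
have fin X : X `<=` A `|` B -> hausdorff_om R n d X \is a fin_num.
  move=> XAB; rewrite ge0_fin_numE ?hausdorff_om_ge0//.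
  by rewrite (le_lt_trans (le_hausdorff_om d XAB))// ltey.
have key d1 d2 : (0 < d1)%R -> (0 < d2)%R ->
    hausdorff_delta R n d d1 A + hausdorff_delta R n d d2 B <= S.
  (* The premeasure increases as [delta] decreases, so one scale below [d1], [d2] and [eta]
     dominates both terms. *)
  move=> d10 d20; pose dl := Num.min (Num.min d1 d2) (eta / 2)%R.
  have dl0 : (0 < dl)%R by rewrite !lt_min d10 d20 divr_gt0.
  have dle : (dl < eta)%R.
    by rewrite gt_min; apply/orP; right; rewrite ltr_pdivrMr// ltr_pMr// ltr1n.
  apply: le_trans (le_hausdorff_om_delta d _ dl0).
  apply: le_trans (hausdorff_delta_separated d dle AB).
  by apply: leeD; apply: le_hausdorff_delta; rewrite !ge_min lexx ?orbT.
rewrite addeC -leeBrDr; last by apply: fin; exact: subsetUl.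
apply: ge_ereal_sup => _ [d2 /= + <-]; rewrite in_itv/= andbT => d20.
rewrite leeBrDr; last by apply: fin; exact: subsetUl.
have d2fin : hausdorff_delta R n d d2 B \is a fin_num.
  rewrite ge0_fin_numE ?hausdorff_delta_ge0//.
  apply: le_lt_trans (le_hausdorff_om_delta d _ d20) _.
  by rewrite -ge0_fin_numE ?hausdorff_om_ge0//; apply: fin; exact: subsetUr.
rewrite addeC -leeBrDr//.
apply: ge_ereal_sup => _ [d1 /= + <-]; rewrite in_itv/= andbT => d10.
by rewrite leeBrDr//; exact: key.
Qed.

Lemma sum_even_odd (f : nat -> \bar R) N : \sum_(0 <= k < N.*2) f k =
  \sum_(k < N) f (k.*2 + 0)%N + \sum_(k < N) f (k.*2 + 1)%N.
Proof.
elim: N => [|M IH]; first by rewrite big_nil !big_ord0 adde0.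
by rewrite doubleS !big_nat_recr//= IH !big_ord_recr/= addn0 addn1 -addeA addeACA.
Qed.

(* Caratheodory's criterion: the shells [1/(k+3) < g <= 1/(k+2)] with [k] of fixed parity lie at positive mutual
   distance, so [mu] is additive on them and their measures are summable. *)
Lemma lipschitz_le0_caratheodory n d (g : 'rV[R]_n -> R) :
  (forall x y, (`|g x - g y| <= enorm (x - y))%R) ->
  (hausdorff_om R n d).-caratheodory [set x | (g x <= 0)%R].
Proof.
move=> lg; apply: le_caratheodory_measurable => X /=.
set mu := hausdorff_om R n d; set Z := [set x | _].
have [->|Xfin] := eqVneq (mu X) +oo; first by rewrite leey.
have Xf : mu X \is a fin_num by rewrite ge0_fin_numE ?ltey// outer_measure_ge0.
pose a k : R := (k.+1%:R^-1)%R.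
have a0 k : (0 < a k)%R by rewrite invr_gt0.
pose Y k := X `&` [set x | (a k < g x)%R].
pose S k := X `&` [set x | (a k.+2 < g x <= a k.+1)%R].
have adec k l : (k < l)%N -> (a l < a k)%R.
  by move=> kl; rewrite /a ltf_pV2 ?posrE// ltr_nat.
have sep k : mu (X `&` Z) + mu (Y k) <= mu X.
  apply: le_trans (hausdorff_separated d (a0 k) _) _.
    move=> x y [_ gx] [_ gy]; rewrite enorm_distC (le_trans _ (lg y x))//.
    rewrite /Z /= in gx gy; rewrite ler_normr; apply/orP; left; lra.
  by apply: le_outer_measure; rewrite -setIUr; exact: subIsetl.
have YX k : mu (Y k) <= mu X by apply: le_outer_measure; exact: subIsetl.
(* Shells of one parity are added one at a time: [g] exceeds [a (2N+p)] on [Y (2N+p)] and is at most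
   [a (2N+p+1)] on the next shell, and the union of the two lies in the next [Y]. *)
have half p N : \sum_(k < N) mu (S (k.*2 + p)%N) <= mu (Y (N.*2 + p)%N).
  elim: N => [|N IH]; first by rewrite big_ord0 outer_measure_ge0.
  rewrite big_ord_recr/=; apply: (le_trans (leeD2r _ IH)).
  have e0 : (0 < a (N.*2 + p)%N - a (N.*2 + p).+1)%R by rewrite subr_gt0 adec.
  apply: le_trans (hausdorff_separated d e0 _) _.
    move=> x y [_ gx] [_ /andP[_ gy]]; rewrite (le_trans _ (lg x y))//.
    rewrite /= in gx; rewrite ler_normr; apply/orP; left; lra.
  apply: le_outer_measure => x [[Xx gx]|[Xx /andP[gx _]]]; split => //=.
  by rewrite doubleS !addSn; apply: lt_trans gx; exact: adec.
have Sfin : \sum_(k <oo) mu (S k) < +oo.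
  apply: (@le_lt_trans _ _ (mu X + mu X)); last first.
    by rewrite lte_add_pinfty// ltey.
  apply: lime_le; first by apply: is_cvg_nneseries => *; exact: outer_measure_ge0.
  apply: nearW => N.
  apply: (@le_trans _ _ (\sum_(0 <= k < N.*2) mu (S k))).
    apply: lee_sum_nneg_natr => [*|]; first exact: outer_measure_ge0.
    by rewrite -addnn leq_addr.
  have -> : \sum_(0 <= k < N.*2) mu (S k) =
      \sum_(k < N) mu (S (k.*2 + 0)%N) + \sum_(k < N) mu (S (k.*2 + 1)%N).
    exact: (sum_even_odd (mu \o S)).
  by apply: leeD; exact: le_trans (half _ _) (YX _).
have tail N : mu (X `&` Z) + mu (X `&` ~` Z) <= mu X + \sum_(N <= k <oo) mu (S k).
  apply: (@le_trans _ _ (mu (X `&` Z) + (mu (Y N.+1) + \sum_(N <= k <oo) mu (S k)))).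
    apply: leeD2l.
    apply: (@le_trans _ _ (mu (Y N.+1 `|` \bigcup_(k in ~` `I_N) S k))).
      apply: le_outer_measure => x [Xx /negP]; rewrite -ltNge => gx.
      have [gN|gN] := ltP (a N.+1) (g x); [by left|right].
      pose P k := (a k.+2 < g x)%R.
      have exP : exists k, P k.
        exists (Num.trunc (g x)^-1); rewrite /P /a invf_plt ?posrE//.
        rewrite (lt_trans (truncnS_gt _))// ltr_nat ltnS//.
      have [k Pk kmin] := ex_minnP exP.
      have Nk : (N <= k)%N.
        rewrite leqNgt; apply/negP => kN; move: Pk; rewrite /P ltNge.
        by rewrite (le_trans gN)// /a lef_pV2 ?posrE// ler_nat.
      exists k => /=; first by apply/negP; rewrite -leqNgt.
      split => //=; rewrite -/(P k) Pk/=.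
      (* For [k = 0] minimality gives no upper bound on [g x]; but then [N = 0], and [gN] is that
         bound. *)
      case: k Pk kmin Nk => [_ _|k Pk kmin _].
        by rewrite leqn0 => /eqP N0; rewrite -N0.
      by rewrite leNgt; apply/negP => /kmin; rewrite ltnn.
    apply: (le_trans (outer_measureU2 _ _ _)); apply: leeD2l.
    exact: outer_measure_sigma_subadditive_tail.
  by rewrite addeA leeD2r.
have cv : mu X + \sum_(N <= k <oo) mu (S k) @[N --> \oo] --> mu X + 0.
  apply: cvgeD; [by rewrite fin_num_adde_defr|exact: cvg_cst|].
  by apply: nneseries_tail_cvg => // k _; exact: outer_measure_ge0.
rewrite -[leRHS]adde0 -(cvg_lim _ cv)//.
apply: lime_ge; first exact: cvgP cv.
exact: nearW.
Qed.

End metric_outer_measure.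

Section hausdorff_measurability.
Variable R : realType.
Variables n d : nat.
Notation T := (HdT R n d).

(** Has the same underlying function as [Hd R n d], with the measure structure attached; conversion
    passes from one to the other. *)
Definition haus_measure : {measure set T -> \bar R} :=
  [the {outer_measure set 'rV[R]_n -> \bar R} of hausdorff_om R n d] : set T -> \bar R.

Lemma haus_measureE (A : set T) : haus_measure A = hausdorff_om R n d A.
Proof. by []. Qed.

Lemma lipschitz_measurable (g : 'rV[R]_n -> R) :
  (forall x y, `|g x - g y| <= enorm (x - y)) ->
  measurable_fun setT (g : T -> R).
Proof.
move=> lg; apply: (measurability _ (RGenOInfty.measurableE R)) => //.
move=> _ [_ [a ->] <-]; rewrite setTI.
rewrite (_ : _ @^-1` _ = ~` [set x | g x - a <= 0]); last first.
  apply/seteqP; split => x; rewrite /= in_itv/= andbT subr_le0 => h.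
    by apply/negP; rewrite -ltNge.
  by rewrite ltNge; apply/negP.
apply: measurableC; apply: (@lipschitz_le0_caratheodory R n d (fun x => g x - a)) => x y.
have -> : g x - a - (g y - a) = g x - g y by ring.
exact: lg.
Qed.

Lemma measurable_enormB (x : 'rV[R]_n) : measurable_fun setT ((fun y => enorm (y - x)) : T -> R).
Proof.
apply: lipschitz_measurable => u v; apply: (le_trans (enormB_le _ _)).
by rewrite opprB addrA subrK.
Qed.

Lemma measurable_coord (i : 'I_n) : measurable_fun setT ((fun y => y 0 i) : T -> R).
Proof.
apply: (@lipschitz_measurable (fun y => y 0 i)) => u v.
have := @sqn_coord_le R n (u - v) i _ (enorm_ge0 (u - v)).
by rewrite rowDE [(- v) 0 i]mxE sqr_enorm; apply.
Qed.

(** [H^d] scales by a constant factor on all sets, measurable or not, so the Caratheodory splitting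
    of a test set is transported by the affine bijection. *)
Lemma measurable_affine_haus (x : 'rV[R]_n) (h : R) : 0 < h ->
  measurable_fun setT ((fun y => x + h *: y) : T -> T).
Proof.
move=> h0 _ A mA; rewrite setTI.
suff : (hausdorff_om R n d).-caratheodory [set y | A (x + h *: y)] by [].
move=> X.
have E (Z : set 'rV[R]_n) := hausdorff_affine d Z x h0.
pose phi (y : 'rV[R]_n) := h^-1 *: (y - x).
have phiK y : phi (x + h *: y) = y.
  by rewrite /phi addrAC subrr add0r scalerA mulVf ?scale1r// gt_eqF.
have phiK' y : x + h *: phi y = y.
  by rewrite /phi scalerA divff ?scale1r ?gt_eqF// subrKC.
pose Y := [set y | X (phi y)].
have hd0 : (h ^+ d)%:E \is a fin_num by [].
have hdp : (0 < (h ^+ d)%:E)%E by rewrite lte_fin exprn_gt0.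
have XE (Z : set 'rV[R]_n) : hausdorff_om R n d Z = ((h ^+ d)^-1%:E * hausdorff_om R n d [set y | Z (phi y)])%E.
  rewrite (E [set y | Z (phi y)]) muleA -EFinM mulVf ?mul1e; last by rewrite expf_neq0// gt_eqF.
  by congr (hausdorff_om R n d _); apply/seteqP; split => y /=; rewrite phiK.
rewrite XE [X in (_ = X + _)%E]XE [X in (_ = _ + X)%E]XE.
rewrite -ge0_muleDr ?hausdorff_om_ge0//; congr (_ * _)%E.
rewrite (mA [set y | X (phi y)]); congr (hausdorff_om R n d _ + hausdorff_om R n d _)%E.
  by apply/seteqP; split => y /=; rewrite phiK'.
by apply/seteqP; split => y /=; rewrite phiK'.
Qed.

(** [H^d] is [h ^ d] times its image under the map from [y] to [x + h y]. *)
Lemma integral_blowup (A : set 'rV[R]_n) (x : 'rV[R]_n) (h : R) (f : T -> \bar R) :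
  0 < h -> measurable (A : set T) -> measurable_fun (A : set T) f ->
  (forall y, A y -> 0 <= f y)%E ->
  (\int[Hd R n d]_(y in (A : set T)) f y =
   (h ^+ d)%:E * \int[Hd R n d]_(y in (blowup A x h : set T)) f (x + h *: y)%R)%E.
Proof.
move=> h0 mA mf f0.
have hd0 : 0 <= h ^+ d by rewrite exprn_ge0// ltW.
pose nu := mscale (NngNum hd0) (image_measure haus_measure (measurable_affine_haus x h0)).
rewrite -[LHS]/(\int[haus_measure]_(y in (A : set T)) f y)%E.
transitivity (\int[nu]_(y in (A : set T)) f y)%E.
  apply: eq_measure_integral => Z mZ _.
  exact: (hausdorff_affine d Z x h0).
rewrite ge0_integral_mscale//; congr (_ * _)%E.
exact: integral_image_measure.
Qed.

End hausdorff_measurability.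

(** * Linear subspaces as isometric copies of R^d *)

Section tangent_plane.
Variable R : realType.

Lemma dotE n (u v : 'rV[R]_n) : (u *m v^T) 0 0 = dot u v.
Proof. by rewrite mxE; apply: eq_bigr => i _; rewrite mxE. Qed.

(** Gram-Schmidt, one unit vector [e] of [T] at a time. The part of [T] orthogonal to [e] is cut out
    by a kernel and has dimension one less by rank-nullity; squared distances add by Pythagoras. *)
Lemma subspace_isometry D d (T : {vspace 'rV[R]_D}) : \dim T = d ->
  exists Phi : 'rV[R]_d -> 'rV[R]_D,
  [/\ Phi 0 = 0, (forall u v, sqn (Phi u - Phi v) = sqn (u - v)) &
      forall y, y \in T <-> exists u, Phi u = y].
Proof.
elim: d T => [|d IH] T dT.
  move/eqP: dT; rewrite dimv_eq0 => /eqP ->.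
  exists (fun=> 0); split => // [u v|y].
    by rewrite subrr /sqn big_ord0 big1// => i _; rewrite mxE expr0n.
  rewrite memv0; split => [/eqP ->|[u ->]//]; by exists 0.
have vT : vpick T != 0 by rewrite vpick0 -dimv_eq0 dT.
have vn : enorm (vpick T) != 0 by apply: contraNN vT => /eqP /enorm0_eq0 ->.
pose e := (enorm (vpick T))^-1 *: vpick T.
have eT : e \in T by rewrite memvZ// memv_pick.
have e1 : sqn e = 1.
  by rewrite -sqr_enorm enormZ ger0_norm ?invr_ge0 ?enorm_ge0// mulVf// expr1n.
pose f : 'Hom('rV[R]_D, 'rV[R]_1) := linfun (mulmxr e^T).
have fE y : f y 0 0 = dot y e by rewrite lfunE /= dotE.
have kE y : (y \in lker f) = (dot y e == 0).
  rewrite memv_ker -fE; apply/eqP/eqP => [->|h]; first by rewrite mxE.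
  by apply/rowP => i; rewrite ord1 h mxE.
have dT' : \dim (T :&: lker f) = d.
  have := limg_ker_dim f T; rewrite dT.
  suff -> : \dim (f @: T) = 1%N by rewrite addn1 => -[].
  apply/eqP; rewrite eqn_leq; apply/andP; split.
    by have := dimvS (subvf (f @: T)%VS); rewrite dimvf.
  rewrite lt0n dimv_eq0; apply/eqP => fT0.
  have : f e \in (f @: T)%VS by rewrite memv_img.
  rewrite fT0 memv0 => /eqP fe0; have := fE e; rewrite fe0 mxE dotvv e1.
  by move/esym/eqP; rewrite oner_eq0.
have [Phi [P0 Piso PT]] := IH _ dT'.
have orth u : dot (Phi u) e = 0.
  have : Phi u \in (T :&: lker f)%VS by apply/PT; exists u.
  by rewrite memv_cap kE => /andP[_ /eqP].
exists (fun w : 'rV[R]_d.+1 => w 0 ord0 *: e + Phi (vtail w)); split.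
- rewrite (_ : vtail 0 = 0) ?P0 ?addr0 ?mxE ?scale0r//.
  by apply/rowP => i; rewrite !mxE.
- move=> u v.
  have -> : u 0 ord0 *: e + Phi (vtail u) - (v 0 ord0 *: e + Phi (vtail v)) =
     (u 0 ord0 - v 0 ord0) *: e + 1 *: (Phi (vtail u) - Phi (vtail v)).
    by rewrite scale1r scalerBl opprD addrACA.
  have o : dot e (Phi (vtail u) - Phi (vtail v)) = 0.
    by rewrite dotC -scaleN1r -[Phi (vtail u)]scale1r dotDl !orth !mulr0 addr0.
  rewrite sqnD o mulr0 addr0 e1 Piso expr1n mulr1 mul1r.
  rewrite [RHS]/sqn big_ord_recl; congr (_ ^+ 2 + _).
    by rewrite !mxE.
  by apply: eq_bigr => i _; rewrite !mxE.
- move=> y; split => [yT|[w <-]]; last first.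
    have : Phi (vtail w) \in (T :&: lker f)%VS by apply/PT; exists (vtail w).
    rewrite memv_cap => /andP[pT _].
    by apply: memvD => //; exact: memvZ.
  pose y' := y - dot y e *: e.
  have : y' \in (T :&: lker f)%VS.
    rewrite memv_cap (memvB yT (memvZ _ eT)) kE /y' -scaleNr -[y in y + _]scale1r dotDl dotvv e1.
    by rewrite mul1r mulr1 subrr eqxx.
  move/PT => [u uE]; exists (vcons (dot y e) u).
  rewrite vcons0E (_ : vtail _ = u) ?uE /y' ?subrKC//.
  by apply/rowP => i; rewrite mxE vconsSE.
Qed.

Lemma measurable_lincomb d0 (X : measurableType d0) (I : finType)
    (g : I -> X -> R) (c : I -> R) : (forall i, measurable_fun setT (g i)) ->
  measurable_fun setT (fun x => \sum_i g i x * c i).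
Proof. by move=> mg; apply: measurable_sum => i; apply: measurable_funM. Qed.

(** [T] is the fixed-point set of its projector, that is, finitely many equations between linear
    combinations of coordinates. *)
Lemma measurable_subspace D d (T : {vspace 'rV[R]_D}) :
  measurable ([set y | y \in T] : set (HdT R D d)).
Proof.
have mlin (f : {linear 'rV[R]_D -> 'rV[R]_D}) j :
    measurable_fun setT ((fun y => f y 0 j) : HdT R D d -> R).
  rewrite (_ : (fun y => _) = fun y : HdT R D d => \sum_i (y : 'rV[R]_D) 0 i * f (delta_mx 0 i) 0 j); last first.
    apply/funext => y; rewrite [in LHS](row_sum_delta y) linear_sum summxE.
    by apply: eq_bigr => i _; rewrite linearZ mxE.
  exact: (measurable_lincomb (fun i => f (delta_mx 0 i) 0 j) (fun i => @measurable_coord R D d i)).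
rewrite (_ : [set y | _] = \bigcap_(j in [set: 'I_D]) [set y : HdT R D d | projv T y 0 j = (y : 'rV[R]_D) 0 j]).
  apply: fin_bigcap_measurable => // j _.
  have m1 := mlin (projv T) j.
  have m2 := @measurable_coord R D d j.
  have := measurable_fun_eqr m1 m2 => /(_ measurableT [set true] I).
  rewrite setTI; congr measurable; apply/seteqP; split => y /= /eqP//.
apply/seteqP; split => y /= h.
  by move=> j _ /=; rewrite projv_id.
suff <- : projv T y = y by exact: memv_proj.
by apply/rowP => j; apply: h.
Qed.

End tangent_plane.

(** * Lebesgue volume against Hausdorff covers *)

Section isodiametric_hull.
Variable R : realType.

Lemma omega_gt0 d : 0 < omega R d.
Proof.
rewrite /omega; case: ifP => _; apply: divr_gt0; rewrite ?mulr_gt0 ?exprn_gt0 ?pi_gt0//.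
by rewrite ltr0n dfact_gt0.
Qed.

Lemma rational_dense n (y : 'rV[R]_n) (e : R) : 0 < e ->
  exists q : 'rV[rat]_n, enorm (map_mx ratr q - y) <= e.
Proof.
(* Coordinate errors [e / (n + 1)] suffice, since [n * e' ^ 2 <= e ^ 2], also for [n = 0]. *)
move=> e0; pose e' := e / n.+1%:R.
have e'0 : 0 < e' by rewrite divr_gt0.
have /choice[q qE] : forall i : 'I_n, exists q : rat, `|ratr q - y 0 i| <= e'.
  move=> i; have : y 0 i - e' < y 0 i + e' by lra.
  move=> /rat_in_itvoo[q]; rewrite in_itv/= => /andP[q1 q2]; exists q.
  by rewrite ler_distl (ltW q1) (ltW q2).
exists (\row_i q i); rewrite (enorm_le _ (ltW e0)) /sqn.
apply: (@le_trans _ _ (\sum_(i < n) e' ^+ 2)).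
  apply: ler_sum => i _; rewrite rowDE [(- y) 0 i]mxE mxE mxE.
  by rewrite -real_normK ?num_real// lerXn2r ?nnegrE// ltW.
rewrite sumr_const card_ord -mulr_natl /e' exprMn exprVn mulrCA.
rewrite ler_piMr ?sqr_ge0// ler_pdivrMr ?exprn_gt0// mul1r -natrX ler_nat.
by rewrite (leq_trans (leqnSn n))// -[leqLHS]expn1 leq_pexp2l.
Qed.

Lemma mrset_ball n (a : 'rV[R]_n) r : 0 <= r -> mrset [set u | enorm (u - a) <= r].
Proof.
move=> r0; have := mrset_affine (- a) 1 (@mrset_cball R n r); congr mrset.
by apply/seteqP; split => u /=; rewrite /cball /= scale1r addrC enorm_le.
Qed.

Lemma vol_ball n (a : 'rV[R]_n) r : 0 < r ->
  vol [set u | enorm (u - a) <= r] = (omega R n * r ^+ n)%:E.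
Proof.
move=> r0; rewrite (@vol_affine R n a 1) ?oner_neq0//; last exact/mrset_ball/ltW.
rewrite normr1 expr1n mul1e -cvolE -vol_cball//; congr vol.
by apply/seteqP; split => u /=; rewrite /cball /= scale1r addrC addKr enorm_le// ltW.
Qed.

(* The sets of a Hausdorff cover are arbitrary; the isodiametric inequality needs measurable ones. *)
Lemma mrset_hull n (C : set 'rV[R]_n) (r : R) :
  (forall u v, C u -> C v -> enorm (u - v) <= r) ->
  exists A : set 'rV[R]_n, [/\ mrset A, C `<=` A &
    forall u v, A u -> A v -> enorm (u - v) <= r].
Proof.
move=> Cr; pose a j : R := j.+1%:R^-1.
have a0 j : 0 < a j by rewrite invr_gt0.
(* Balls of radius [a j] about the rational points within [a j] of [C]. Each union over [k] is
   countable and contains [C]; a point in all of them is within [2 * a j] of [C] for every [j], so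
   the diameter does not grow in the limit. *)
pose B j k : set 'rV[R]_n := if @unpickle 'rV[rat]_n k is Some q then
  [set u | enorm (u - map_mx ratr q) <= a j /\ exists2 y, C y & enorm (map_mx ratr q - y) <= a j]
  else set0.
exists (\bigcap_j \bigcup_k B j k); split.
- rewrite /mrset preimage_bigcap; apply: bigcapT_measurable => j.
  rewrite preimage_bigcup; apply: bigcupT_measurable => k.
  rewrite /B; case: (unpickle k) => [q|]; last by rewrite preimage_set0.
  have [E|E] := pselect (exists2 y, C y & enorm (map_mx ratr q - y) <= a j).
    have := mrset_ball (map_mx ratr q) (ltW (a0 j)); rewrite /mrset; congr measurable.
    by apply/seteqP; split => u //= [].
  rewrite (_ : _ @^-1` _ = set0)//.
  by apply/seteqP; split => // u [].
- move=> u Cu j _; have [q qu] := rational_dense u (a0 j).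
  exists (pickle q) => //; rewrite /B pickleK /=; split; first by rewrite enorm_distC.
  by exists u.
- move=> u v Au Av; apply/ler_addgt0Pr => e e0.
  pose j := Num.trunc (4 / e).
  have aj : 4 * a j <= e.
    rewrite /a ler_pdivrMr// mulrC -ler_pdivrMr// ltW//.
    exact: truncnS_gt.
  have key w : (\bigcap_j \bigcup_k B j k) w -> exists2 y, C y & enorm (w - y) <= 2 * a j.
    move=> /(_ j I)[k _]; rewrite /B; case: (unpickle k) => // q [h1 [y Cy h2]].
    exists y => //; apply: (le_trans (enorm_dist _ (map_mx ratr q) _)); lra.
  have [u' Cu' hu] := key _ Au; have [v' Cv' hv] := key _ Av.
  have := Cr _ _ Cu' Cv'; rewrite enorm_distC in hv.
  have := enorm_dist u u' v; have := enorm_dist u' v' v; lra.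
Qed.

(** Adds the radius 0, needed for cover members of diameter 0. In dimension 0 radius 1 gives the
    same bound, as [0 ^+ 0 = 1]; otherwise let the radius tend to 0. *)
Lemma isodiametric_enorm n (A : set 'rV[R]_n) (r : R) : 0 <= r -> mrset A ->
  (forall u v, A u -> A v -> enorm (u - v) <= 2 * r) ->
  (vol A <= (omega R n * r ^+ n)%:E)%E.
Proof.
move=> r0 mA Ar.
have pos s : 0 < s -> r <= s -> (vol A <= (omega R n * s ^+ n)%:E)%E.
  move=> s0 rs; apply: isodiametric => // u v Au Av; rewrite -enorm_le; last by rewrite mulr_ge0// ltW.
  by apply: le_trans (Ar _ _ Au Av) _; rewrite ler_pM2l.
have [rp|] := ltP 0 r; first exact: pos.
move=> r0'; have {r0 r0'} rE : r = 0 by apply/eqP; rewrite eq_le r0 r0'.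
move: pos; rewrite rE; case: n A {Ar mA} => [|n] A pos.
  by have := pos 1 ltr01 ler01; rewrite !expr0.
rewrite expr0n/= mulr0; apply/lee_addgt0Pr => e e0; rewrite add0e.
have w0 := omega_gt0 n.+1.
pose s := Num.min 1 (e / omega R n.+1).
have s0 : 0 < s by rewrite lt_min ltr01 divr_gt0.
apply: (le_trans (pos _ s0 (ltW s0))); rewrite lee_fin mulrC -ler_pdivlMr//.
apply: (@le_trans _ _ s); last by rewrite /s ge_min lexx orbT.
by rewrite exprS ler_piMr ?(ltW s0)// exprn_ile1// ?(ltW s0)// /s ge_min lexx.
Qed.

(** Pull a cover of [S] back by [Phi]. Diameters do not increase, so the measurable hull of each
    preimage has volume at most the cost of the cover member; conclude by subadditivity of
    volume. *)
Lemma vol_le_hausdorff D d (Phi : 'rV[R]_d -> 'rV[R]_D) (B : set 'rV[R]_d)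
    (S : set 'rV[R]_D) (delta : R) :
  (forall u v, enorm (u - v) <= enorm (Phi u - Phi v)) -> mrset B ->
  (forall u, B u -> S (Phi u)) ->
  (vol B <= hausdorff_delta R D d delta S)%E.
Proof.
move=> Phiso mB BS; apply: hausdorff_delta_cover_le => F Fd SF.
have /choice[A AP] : forall k, exists A : set 'rV[R]_d,
    [/\ mrset A, (Phi @^-1` F k) `<=` A & (vol A <= haus_zeta d (F k))%E].
  move=> k; have [F0|/set0P[x Fx]] := eqVneq (F k) set0.
    exists set0; rewrite F0 preimage_set0 haus_zeta0; split => //.
      by rewrite /mrset preimage_set0.
    by rewrite /vol preimage_set0 measure0.
  have FN : F k !=set0 by exists x.
  have [A [mA FA Ad]] := @mrset_hull d (Phi @^-1` F k) (fine (diam R D (F k)))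
     (fun u v Fu Fv => le_trans (Phiso u v) (adm_diam (Fd k) Fu Fv)).
  exists A; split => //.
  have f0 : 0 <= fine (diam R D (F k)) by rewrite fine_ge0// diam_ge0.
  have := @isodiametric_enorm d A (fine (diam R D (F k)) / 2) _ mA.
  rewrite divr_ge0// mulrC divfK// => /(_ isT Ad).
  by rewrite /haus_zeta; case: asboolP => // FE; rewrite FE in Fx.
apply: (@le_trans _ _ (vol (\bigcup_k A k))).
  apply: le_measure; rewrite ?inE//.
  - rewrite preimage_bigcup; apply: bigcupT_measurable => k; by case: (AP k).
  - move=> v Bv; have [k _ Fk] := SF _ (BS _ Bv); exists k => //.
    by case: (AP k) => _ + _; apply.
rewrite /vol preimage_bigcup.
apply: (@le_trans _ _ (\sum_(k <oo) vol (A k))%E).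
  apply: measure_sigma_subadditive => //.
  - by move=> k; case: (AP k).
  - by apply: bigcupT_measurable => k; case: (AP k).
by apply: lee_nneseries => [k _ _|k _]; [exact: vol_ge0|case: (AP k)].
Qed.

End isodiametric_hull.

(** * Separated sets in the unit ball *)

Section packing.
Variable R : realType.

Lemma measure_disjoint_seq d0 (X : measurableType d0) (mu : {measure set X -> \bar R})
    (Y : eqType) (e : rel Y) (B : Y -> set X) (s : seq Y) :
  (forall a, measurable (B a)) -> (forall a b, e a b -> B a `&` B b = set0) ->
  pairwise e s ->
  measurable (\big[setU/set0]_(a <- s) B a) /\
  mu (\big[setU/set0]_(a <- s) B a) = (\sum_(a <- s) mu (B a))%E.
Proof.
move=> mB eB; elim: s => [|a s IH] /=; first by rewrite !big_nil.
rewrite !big_cons => /andP[/allP ae /IH[mU <-]]; split; first exact: measurableU.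
apply: measureU => //; rewrite big_distrr/= big_seq big1// => b bs.
exact/eB/ae.
Qed.

Lemma outer_measure_seq X (mu : {outer_measure set X -> \bar R}) (Y : Type)
    (B : Y -> set X) (s : seq Y) :
  (mu (\big[setU/set0]_(a <- s) B a) <= \sum_(a <- s) mu (B a))%E.
Proof.
elim: s => [|a s IH]; first by rewrite !big_nil outer_measure0.
by rewrite !big_cons (le_trans (outer_measureU2 _ _ _))// leeD2l.
Qed.

Lemma bigsetU_seqP X (Y : eqType) (B : Y -> set X) (s : seq Y) x :
  (\big[setU/set0]_(a <- s) B a) x <-> exists2 a, a \in s & B a x.
Proof.
elim: s => [|b s IH]; first by rewrite big_nil; split => // -[].
rewrite big_cons; split => [[Bx|/IH[a as_ Bx]]|[a]].
- by exists b; rewrite ?mem_head.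
- by exists a; rewrite // inE as_ orbT.
- by rewrite inE => /orP[/eqP ->|as_ Bx]; [left|right; apply/IH; exists a].
Qed.

Lemma sum_cst_seq (Y : Type) (s : seq Y) (c : R) :
  (\sum_(a <- s) c%:E = ((size s)%:R * c)%:E)%E.
Proof. by rewrite sumEFin big_const_seq count_predT iter_addr_0 mulr_natl. Qed.

Definition apart n (r : R) : rel 'rV[R]_n := fun u v => r < enorm (u - v).

(** Compare volumes: the balls of radius [r / 2] about the points are disjoint and lie in the ball
    of radius 2. *)
Lemma apart_size n (r : R) (s : seq 'rV[R]_n) : 0 < r <= 1 ->
  pairwise (@apart n r) s -> (forall a, a \in s -> enorm a <= 1) ->
  (size s)%:R * r ^+ n <= 4 ^+ n.
Proof.
move=> /andP[r0 r1] ps s1.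
have r20 : 0 < r / 2 by rewrite divr_gt0.
pose B (a : 'rV[R]_n) := @coords R n @^-1` [set u | enorm (u - a) <= r / 2].
have mB a : measurable (B a) by apply: mrset_ball; exact: ltW.
have eB a b : apart r a b -> B a `&` B b = set0.
  move=> ab; apply/seteqP; split => // u [/= ua ub].
  have h := enorm_dist a (coords u) b; have h' := enorm_distC a (coords u).
  move: ua ub ab; rewrite /B /apart /=; lra.
have [mU UE] := measure_disjoint_seq (msp_mu (Rn R n)) mB eB ps.
have : (msp_mu (Rn R n) (\big[setU/set0]_(a <- s) B a) <= (omega R n * 2 ^+ n)%:E)%E.
  rewrite -(@vol_ball R n 0 2)//; apply: le_measure; rewrite ?inE//.
    exact: mrset_ball.
  move=> u /bigsetU_seqP[a /s1 a1 /= ua]; rewrite /= subr0.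
  have := enormD (coords u - a) a; rewrite subrK.
  move: ua; rewrite /B /=; lra.
rewrite UE (eq_bigr (fun=> (omega R n * (r / 2) ^+ n)%:E)); last first.
  by move=> a _; exact: vol_ball.
rewrite sum_cst_seq lee_fin.
rewrite mulrCA ler_pM2l ?omega_gt0// exprMn mulrA exprVn ler_pdivrMr ?exprn_gt0//.
by rewrite -exprMn -natrM.
Qed.

(** A separated list of maximal length, which exists because lengths are bounded. A point farther
    than [r] from all of its members could be added to it. *)
Lemma packing n (r : R) : 0 < r <= 1 -> exists s : seq 'rV[R]_n,
  [/\ pairwise (@apart n r) s, (forall a, a \in s -> enorm a <= 1),
      (forall u, enorm u <= 1 -> exists2 a, a \in s & enorm (u - a) <= r) &
      (size s)%:R * r ^+ n <= 4 ^+ n].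
Proof.
move=> r01; have /andP[r0 r1] := r01.
pose P k := `[< exists s : seq 'rV[R]_n, [/\ size s = k, pairwise (@apart n r) s &
   (forall a, a \in s -> enorm a <= 1)] >].
have exP : exists k, P k by exists 0%N; apply/asboolP; exists [::].
have ubP k : P k -> (k <= Num.trunc (4 ^+ n / r ^+ n))%N.
  move=> /asboolP[s [<- ps s1]]; rewrite truncn_ge_nat ?divr_ge0 ?exprn_ge0 ?(ltW r0)//.
  by rewrite ler_pdivlMr ?exprn_gt0//; exact: apart_size.
case: (ex_maxnP exP ubP) => k /asboolP[s [sk ps s1]] kmax.
exists s; split => //; last exact: apart_size.
move=> u u1; apply: contrapT => nu.
have : P k.+1.
  apply/asboolP; exists (u :: s); split; first by rewrite /= sk.
    rewrite /= ps andbT; apply/allP => a as_; rewrite /apart ltNge; apply/negP => ua.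
    by apply: nu; exists a.
  by move=> a; rewrite inE => /orP[/eqP ->//|]; exact: s1.
by move/kmax; rewrite ltnn.
Qed.

End packing.

(** * Hausdorff measure of balls in a subspace *)

Section hausdorff_ball.
Variables (R : realType) (D d : nat) (T : {vspace 'rV[R]_D}).
Hypothesis dT : \dim T = d.
Local Notation H := (hausdorff_om R D d).
Local Notation mH := (haus_measure R D d).

Definition tball (a : 'rV[R]_D) (r : R) : set 'rV[R]_D :=
  [set y | y \in T /\ enorm (y - a) <= r].

Lemma measurable_tball a r : measurable (tball a r : set (HdT R D d)).
Proof.
rewrite (_ : tball a r = [set y | y \in T] `&` [set y | enorm (y - a) <= r])//.
apply: measurableI; first exact: measurable_subspace.
have := @measurable_enormB R D d a measurableT _ (measurable_itv `]-oo, r]).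
by rewrite setTI set_itvE.
Qed.

(** Dilations, and translations by elements of [T], preserve [T]. *)
Lemma hausdorff_tball a r : a \in T -> 0 < r -> (H (tball a r) = (r ^+ d)%:E * H (tball 0 1))%E.
Proof.
move=> aT r0; rewrite (hausdorff_affine d _ a r0); congr (_ * H _)%E.
apply/seteqP; split => y; rewrite /tball /= subr0 addrAC subrr add0r enormZ gtr0_norm//.
  move=> [yT yr]; split.
    have : r^-1 *: ((a + r *: y) - a) \in T by rewrite memvZ// memvB.
    by rewrite addrAC subrr add0r scalerA mulVf ?scale1r// gt_eqF.
  by rewrite -(ler_pM2l r0) mulr1.
by move=> [yT y1]; rewrite memvD ?memvZ// -[leRHS]mulr1 ler_pM2l.
Qed.

Lemma hausdorff_delta_tball delta a r : 0 < r -> 2 * r <= delta ->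
  (hausdorff_delta R D d delta (tball a r) <= (omega R d * r ^+ d)%:E)%E.
Proof.
move=> r0 rd.
have br x y : tball a r x -> tball a r y -> enorm (x - y) <= 2 * r.
  move=> [_ xr] [_ yr]; have := enorm_dist x a y; have := enorm_distC a y; lra.
apply: le_trans (haus_zeta_le d (ltW r0) br).
pose F (k : nat) : set 'rV[R]_D := if k is 0%N then tball a r else set0.
apply: (le_trans (@hausdorff_delta_le_cover R D d delta (tball a r) F _ _)).
- case => [|k]; last exact: haus_adm0.
  by apply: le_trans (diam_le br) _; rewrite lee_fin.
- by move=> x ?; exists 0%N.
- rewrite nneseries_recl//; last by move=> k _; exact: haus_zeta_ge0.
  rewrite eseries0 ?adde0// => k k1 _.
  by case: k k1 => // k _; exact: haus_zeta0.
Qed.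

(* The lower bound is the isodiametric inequality. If [beta = H (tball 0 1)] exceeded [omega], the balls of radius [r / 3]
   about a maximal [r]-separated subset of the unit ball would carry a fixed fraction of the measure of [tball 0 2],
   whereas as members of a cover each costs only [omega * (r / 3) ^ d]: so [hausdorff_delta (tball 0 2)] would stay
   below [H (tball 0 2)] by a constant, for all [delta]. *)
Lemma hausdorff_tball1 : H (tball 0 1) = (omega R d)%:E.
Proof.
have [Phi [P0 Piso PT]] := subspace_isometry dT.
have Penorm u v : enorm (Phi u - Phi v) = enorm (u - v) by rewrite !enormE Piso.
have PhiT u : Phi u \in T by apply/PT; exists u.
have w0 := omega_gt0 R d.
set beta := H (tball 0 1).
have lower : ((omega R d)%:E <= beta)%E.
  apply: le_trans (le_hausdorff_om_delta d _ ltr01).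
  have <- : vol [set u : 'rV[R]_d | enorm (u - 0) <= 1] = (omega R d)%:E.
    by rewrite vol_ball// expr1n mulr1.
  apply: (vol_le_hausdorff (Phi := Phi)) => [u v||u u1].
  - by rewrite Penorm.
  - exact: mrset_ball.
  - by split; rewrite ?PhiT// -P0 Penorm.
have cover s r : (forall u, enorm u <= 1 -> exists2 a, a \in s & enorm (u - a) <= r) ->
    tball 0 1 `<=` \big[setU/set0]_(a <- s) tball (Phi a) r.
  move=> sc y [/PT[u <-]]; rewrite -P0 Penorm subr0 => /sc[a as_ ua].
  by apply/bigsetU_seqP; exists a => //; split; rewrite ?PhiT ?Penorm.
(* Finiteness comes first, for the subtractions below. At most [4 ^ d / r ^ d] balls of radius [r]
   cover the unit ball, at cost [omega d * 4 ^ d], whatever [delta] is. *)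
have betafin : beta \is a fin_num.
  rewrite ge0_fin_numE ?hausdorff_om_ge0//.
  apply: (@le_lt_trans _ _ (omega R d * 4 ^+ d)%:E); last exact: ltry.
  apply: ge_ereal_sup => _ [delta /= + <-]; rewrite in_itv/= andbT => d0.
  pose r := Num.min 1 (delta / 2).
  have r0 : 0 < r by rewrite lt_min ltr01 divr_gt0.
  have r1 : r <= 1 by rewrite ge_min lexx.
  have rd : 2 * r <= delta by rewrite mulrC -ler_pdivlMr// /r ge_min lexx orbT.
  have r01 : 0 < r <= 1 by rewrite r0.
  have [s [_ _ sc sn]] := packing d r01.
  apply: (le_trans (le_outer_measure (hausdorff_delta R D d delta) _ _ (cover _ _ sc))).
  apply: (le_trans (outer_measure_seq _ _ _)).
  apply: (@le_trans _ _ (\sum_(a <- s) (omega R d * r ^+ d)%:E)%E).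
    by apply: lee_sum => a _; exact: hausdorff_delta_tball.
  rewrite sum_cst_seq lee_fin.
  by rewrite mulrCA ler_pM2l.
pose b := fine beta.
have bE : beta = b%:E by rewrite /b fineK.
have wb : omega R d <= b by rewrite -lee_fin -bE.
have b0 : 0 < b by exact: lt_le_trans wb.
rewrite bE; congr EFin; apply/eqP; rewrite eq_le wb andbT leNgt; apply/negP => bw.
have tballE a r : a \in T -> 0 < r -> H (tball a r) = (r ^+ d * b)%:E.
  by move=> aT r0; rewrite hausdorff_tball// -/beta bE EFinM.
(* Radius 2 leaves room for balls of radius [r / 3] about points of the unit ball. *)
pose Q := tball 0 2.
have QE : H Q = (2 ^+ d * b)%:E by apply: tballE => //; exact: mem0v.
have key delta : 0 < delta ->
    (hausdorff_delta R D d delta Q <= (2 ^+ d * b - (b - omega R d) / 3 ^+ d)%:E)%E.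
  move=> d0; pose r := Num.min 1 delta.
  have r0 : 0 < r by rewrite lt_min ltr01.
  have r1 : r <= 1 by rewrite ge_min lexx.
  have rd : r <= delta by rewrite /r ge_min lexx orbT.
  have r01 : 0 < r <= 1 by rewrite r0.
  have [s [sp s1 sc sn]] := packing d r01.
  have r30 : 0 < r / 3 by rewrite divr_gt0.
  pose B a := tball (Phi a) (r / 3).
  have BB a c : apart r a c -> B a `&` B c = set0.
    move=> ac; apply/seteqP; split => // y [[_ ya] [_ yc]].
    have h := enorm_dist (Phi a) y (Phi c); have h' := enorm_distC (Phi a) y.
    move: ac; rewrite Penorm in h; rewrite /apart; lra.
  have mB a : measurable (B a : set (HdT R D d)) by exact: measurable_tball.
  have [mU UE] := measure_disjoint_seq mH mB BB sp.
  set U := \big[_/_]_(a <- s) B a in mU UE.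
  have UE' : H U = ((size s)%:R * ((r / 3) ^+ d * b))%:E.
    rewrite -[LHS]/(mH U) UE (eq_bigr (fun=> ((r / 3) ^+ d * b)%:E)); last first.
      by move=> a _; rewrite -[LHS]/(H (B a)) tballE.
    by rewrite sum_cst_seq.
  (* The balls of radius [r] about the same centres cover the unit ball, so
     [b <= size s * r ^ d * b]; hence [U] has measure at least [b / 3 ^ d], independently of
     [delta]. *)
  have size1 : 1 <= (size s)%:R * r ^+ d.
    have : (b%:E <= ((size s)%:R * (r ^+ d * b))%:E)%E.
      rewrite -bE; apply: (le_trans (le_outer_measure H _ _ (cover _ _ sc))).
      apply: (le_trans (outer_measure_seq _ _ _)).
      rewrite (eq_bigr (fun=> (r ^+ d * b)%:E)); last by move=> a _; rewrite /= tballE.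
      by rewrite sum_cst_seq.
    by rewrite lee_fin mulrA -[X in X <= _ -> _]mul1r ler_pM2r.
  have UQ : U `<=` Q.
    move=> y /bigsetU_seqP[a as_ [yT ya]]; split => //.
    have := enormD (y - Phi a) (Phi a - Phi 0); rewrite subrKA P0 !subr0.
    have := Penorm a 0; rewrite P0 !subr0 => ->.
    have := s1 _ as_; lra.
  have mQ : measurable (Q : set (HdT R D d)) by exact: measurable_tball.
  have QUE : H (Q `\` U) = (2 ^+ d * b - (size s)%:R * ((r / 3) ^+ d * b))%:E.
    rewrite -[LHS]/(mH (Q `\` U)) measureD//; last first.
      by rewrite -[X in (X < _)%E]/(H Q) QE ltry.
    rewrite setIidr// -[X in (X - _)%E]/(H Q) -[X in (_ - X)%E]/(H U) QE UE'.
    by rewrite EFinB.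
  have QUU : Q `<=` U `|` (Q `\` U).
    by move=> y Qy; have [Uy|Uy] := pselect (U y); [left|right].
  apply: (le_trans (le_outer_measure (hausdorff_delta R D d delta) _ _ QUU)).
  apply: (le_trans (outer_measureU2 _ _ _)).
  apply: (@le_trans _ _ (((size s)%:R * (omega R d * (r / 3) ^+ d))%:E + H (Q `\` U))%E).
    apply: leeD; last exact: le_hausdorff_om_delta.
    apply: (le_trans (outer_measure_seq _ _ _)).
    apply: (@le_trans _ _ (\sum_(a <- s) (omega R d * (r / 3) ^+ d)%:E)%E).
      apply: lee_sum => a _; apply: hausdorff_delta_tball => //; lra.
    by rewrite sum_cst_seq.
  (* The total is [H Q] minus [size s * r ^ d * (b - omega d) / 3 ^ d], where [size1] bounds
     [size s * r ^ d] below by 1. *)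
  rewrite QUE -EFinD lee_fin exprMn exprVn.
  have c0 : 0 < 3 ^+ d :> R by rewrite exprn_gt0.
  have ci0 : 0 < (3 ^+ d)^-1 :> R by rewrite invr_gt0.
  have bw0 : 0 <= (b - omega R d) / 3 ^+ d by rewrite divr_ge0 ?subr_ge0 ?ltW.
  move: ((3 ^+ d)^-1) bw0 => t bw0.
  have := ler_wpM2r bw0 size1; rewrite mul1r; lra.
have : (H Q <= (2 ^+ d * b - (b - omega R d) / 3 ^+ d)%:E)%E.
  apply: ge_ereal_sup => _ [delta /= + <-]; rewrite in_itv/= andbT.
  exact: key.
rewrite QE lee_fin lerBrDl gerDr.
by rewrite leNgt divr_gt0 ?subr_gt0 ?exprn_gt0.
Qed.

(** Radius 0 depends on [d]: for [d = 0] the subspace is a point and all balls about it coincide;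
    for [d > 0] the measure of small balls tends to 0. *)
Lemma hausdorff_tballE r : 0 <= r -> H (tball 0 r) = (omega R d * r ^+ d)%:E.
Proof.
move=> r0; have [rp|] := ltP 0 r.
  by rewrite hausdorff_tball ?mem0v// hausdorff_tball1 -EFinM mulrC.
move=> r0'; have {r0 r0'} -> : r = 0 by apply/eqP; rewrite eq_le r0 r0'.
have [d0|d0] := posnP d.
  have T0 : T = 0%VS by apply/eqP; rewrite -dimv_eq0 dT d0.
  have -> : tball 0 0 = tball 0 1.
    by apply/seteqP; split => y [yT _]; split => //; move: yT; rewrite T0 memv0 => /eqP ->;
      rewrite subrr enorm0.
  by rewrite hausdorff_tball1 d0 expr0 mulr1.
rewrite expr0n eqn0Ngt d0 mulr0; apply/eqP; rewrite eq_le hausdorff_om_ge0 andbT.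
apply/lee_addgt0Pr => e e0; rewrite add0e.
have w0 := omega_gt0 R d.
pose s := Num.min 1 (e / omega R d).
have s0 : 0 < s by rewrite lt_min ltr01 divr_gt0.
have s1 : s <= 1 by rewrite ge_min lexx.
apply: (@le_trans _ _ (H (tball 0 s))).
  by apply: le_hausdorff_om => y [yT y0]; split => //; apply: le_trans y0 (ltW s0).
rewrite hausdorff_tball ?mem0v// hausdorff_tball1 -EFinM lee_fin -ler_pdivlMr//.
apply: (@le_trans _ _ s); last by rewrite /s ge_min lexx orbT.
by rewrite -(prednK d0) exprS ler_piMr ?(ltW s0)// exprn_ile1// (ltW s0).
Qed.

End hausdorff_ball.

(** * Radial integrals depend only on the measure of balls *)

Section radial_integrals.
Variable R : realType.

(** Differences of rays are the half-open intervals, a generating family stable under intersection;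
    finiteness on rays makes the subtraction legitimate. *)
Lemma measure_eq_rays (m1 m2 : {measure set (measurableTypeR R) -> \bar R}) :
  (forall r, m1 `]-oo, r]%classic = m2 `]-oo, r]%classic) ->
  (forall r, m1 `]-oo, r]%classic < +oo)%E ->
  forall A, measurable A -> m1 A = m2 A.
Proof.
move=> m12 m1oo A mA.
have oc (m : {measure set (measurableTypeR R) -> \bar R}) (a b : R) : a <= b ->
    (m `]-oo, b]%classic < +oo)%E ->
    m `]a, b]%classic = (m `]-oo, b]%classic - m `]-oo, a]%classic)%E.
  move=> ab moo.
  have -> : `]a, b]%classic = `]-oo, b]%classic `\` `]-oo, a]%classic :> set R.
    apply/seteqP; split => x /=; rewrite !in_itv/=.
      by move=> /andP[ax ->]; split => //; apply/negP; rewrite -ltNge.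
    by move=> [-> /negP]; rewrite -ltNge => ->.
  rewrite measureD// setIidr// => x /=; rewrite !in_itv/= => xa.
  exact: le_trans ab.
pose g (k : nat) : set (measurableTypeR R) := `]- k%:R, k%:R]%classic.
apply: (@measure_unique _ R (measurableTypeR R) (@ocitv R : set (set (measurableTypeR R))) g) => //.
- exact: ocitvI.
- by move=> k; exact: is_ocitv.
- apply/seteqP; split => // x _.
  exists (Num.trunc `|x|).+1 => //=; rewrite /g /= in_itv/=.
  have := truncnS_gt `|x|; rewrite ltr_norml => /andP[-> /ltW ->]//.
- move=> _ [[a b] _ <-] /=; have [ab|ba] := leP a b.
    by rewrite !oc// -m12// -m12.
  by rewrite set_itv_ge ?bnd_simp -?leNgt ?(ltW ba)// !measure0.
- move=> k; have k0 : - k%:R <= k%:R :> R by rewrite ge0_cp.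
  apply: le_lt_trans (m1oo k%:R); apply: le_measure; rewrite ?inE//.
    exact: measurable_itv.
  by move=> x; rewrite /g /= !in_itv/= => /andP[].
Qed.

Lemma measure_eq_nonneg_rays (m1 m2 : {measure set (measurableTypeR R) -> \bar R}) :
  (forall r, m1 (`]-oo, r]%classic `&` `[0, +oo[%classic) = m2 (`]-oo, r]%classic `&` `[0, +oo[%classic)) ->
  (forall r : R, m1 (`]-oo, r]%classic `&` `[0%R, +oo[%classic) < +oo)%E ->
  forall A : set (measurableTypeR R), measurable A -> A `<=` `[0%R, +oo[%classic -> m1 A = m2 A.
Proof.
move=> m12 m1oo A mA AD.
have mD : measurable (`[0, +oo[%classic : set (measurableTypeR R)) by exact: measurable_itv.
pose n1 : {measure set (measurableTypeR R) -> \bar R} := mrestr m1 mD.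
pose n2 : {measure set (measurableTypeR R) -> \bar R} := mrestr m2 mD.
have := @measure_eq_rays n1 n2 m12 m1oo A mA.
by rewrite /n1 /n2 /= /mrestr !setIidl.
Qed.

Lemma measurable_if_cst d0 (X : measurableType d0) (b : pred X) (f : X -> R) (c : R) :
  measurable [set x | b x] -> measurable_fun setT f ->
  measurable_fun setT (fun x => if b x then f x else c).
Proof.
move=> mb mf; apply: measurable_fun_if => //; last exact: measurable_funTS.
by apply: (measurable_fun_bool true); rewrite setTI.
Qed.

Variables (D d : nat) (T : {vspace 'rV[R]_D}).
Hypothesis dT : \dim T = d.

Lemma measurable_enorm_coords n : measurable_fun setT (@enorm R n \o @coords R n).
Proof.
rewrite (_ : _ \o _ = Num.sqrt \o (@sqn R n \o @coords R n))//.
apply: measurableT_comp; last exact: measurable_sqn.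
by apply: continuous_measurable_fun; exact: sqrt_continuous.
Qed.

(** Both sides integrate [k] over [[0, +oo[] against the image measure of the norm, and the two
    images agree on rays because balls have equal measure. *)
Lemma ge0_integral_radial (k : R -> \bar R) : measurable_fun setT k -> (forall t, 0 <= k t)%E ->
  (\int[haus_measure R D d]_(y in [set y : 'rV[R]_D | y \in T]) k (enorm (y : 'rV[R]_D)) =
   \int[msp_mu (Rn R d)]_v k (enorm (coords v)))%E.
Proof.
move=> mk k0.
(* Points off [T] are sent to -1, outside [[0, +oo[]: the restriction to [T] becomes a restriction
   of the image. *)
pose g (y : HdT R D d) : R := if (y : 'rV[R]_D) \in T then enorm (y : 'rV[R]_D) else -1.
have mT := @measurable_subspace R D d T.
have mg : measurable_fun setT g.
  apply: (measurable_if_cst (-1) mT); have := @measurable_enormB R D d 0.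
  by under eq_fun do rewrite subr0.
pose m1 := @image_measure R _ _ _ (measurableTypeR R) (haus_measure R D d) g mg.
pose m2 := @image_measure R _ _ _ (measurableTypeR R) (msp_mu (Rn R d)) _ (@measurable_enorm_coords d).
pose D0 : set (measurableTypeR R) := `[0, +oo[%classic.
have mD0 : measurable D0 by exact: measurable_itv.
have E1 r : m1 (`]-oo, r]%classic `&` D0) = if 0 <= r then (omega R d * r ^+ d)%:E else 0%E.
  rewrite image_measureE haus_measureE; case: ifPn => r0.
    rewrite -(hausdorff_tballE dT r0); congr (hausdorff_om R D d _).
    apply/seteqP; split => y; rewrite /D0 /tball /g /= !in_itv/= andbT subr0.
      by case: ifPn => yT [] //; rewrite ler0N1.
    by move=> [-> ->]; rewrite enorm_ge0.
  rewrite -(outer_measure0 (hausdorff_om R D d)); congr (hausdorff_om R D d _).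
  apply/seteqP; split => // y; rewrite /D0 /= !in_itv/= andbT => -[h1 h2].
  by move: r0; rewrite (le_trans h2 h1).
have E2 r : m2 (`]-oo, r]%classic `&` D0) = if 0 <= r then (omega R d * r ^+ d)%:E else 0%E.
  rewrite image_measureE; case: ifPn => r0; last first.
    rewrite -(measure0 (msp_mu (Rn R d))); congr (msp_mu (Rn R d) _).
    apply/seteqP; split => // y; rewrite /D0 /= !in_itv/= andbT => -[h1 h2].
    by move: r0; rewrite (le_trans h2 h1).
  rewrite (_ : _ @^-1` _ = @coords R d @^-1` [set u | enorm (u - 0) <= r]); last first.
    apply/seteqP; split => v; rewrite /D0 /= !in_itv/= andbT subr0; first by case.
    by move=> ->; rewrite enorm_ge0.
  have [rp|] := ltP 0 r; first exact: vol_ball.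
  move=> r0'; have {r0 r0'} -> : r = 0 by apply/eqP; rewrite eq_le r0 r0'.
  have [d0|d0] := posnP d.
    have -> : [set u : 'rV[R]_d | enorm (u - 0) <= 0] = [set u | enorm (u - 0) <= 1].
      apply/seteqP; split => u /= _; move: u; rewrite d0 => u;
        by rewrite subr0 enormE /sqn big_ord0 sqrtr0.
    by rewrite -[LHS]/(vol [set u : 'rV[R]_d | enorm (u - 0) <= 1]) vol_ball// d0 !expr0.
  have Z : omega R d * 0 ^+ d = 0 by rewrite expr0n eqn0Ngt d0 mulr0.
  rewrite Z; apply/eqP; rewrite eq_le measure_ge0 andbT.
  apply: (@le_trans _ _ (omega R d * 0 ^+ d)%:E); last by rewrite Z.
  apply: (@isodiametric_enorm R d [set u | enorm (u - 0) <= 0] 0 (lexx _)).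
    exact: mrset_ball.
  move=> u v /=; rewrite !subr0 mulr0 => u0 v0.
  have := enormD u (- v); rewrite enormN => /le_trans; apply.
  by rewrite -(addr0 0) lerD.
have m12 A : measurable A -> A `<=` D0 -> m1 A = m2 A.
  move=> mA AD.
  apply: (@measure_eq_nonneg_rays m1 m2 _ _ A mA AD) => r; first by rewrite E1 E2.
  by rewrite E1; case: ifP => _; rewrite ltry.
transitivity (\int[m1]_(t in D0) k t)%E.
  rewrite integral_image_measure//; last exact: measurable_funTS.
  have -> : g @^-1` D0 = [set y | y \in T].
    apply/seteqP; split => y; rewrite /g /D0 /= in_itv/= andbT.
      by case: ifPn => //; rewrite ler0N1.
    by move=> ->; exact: enorm_ge0.
  by apply: eq_integral => y; rewrite inE /g /= => ->.
rewrite (eq_measure_integral m2)//.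
rewrite integral_image_measure//; last exact: measurable_funTS.
congr (integral _ _ _); apply/seteqP; split => // v _.
by rewrite /D0 /= in_itv/= andbT enorm_ge0.
Qed.

Lemma integral_radial (k : R -> R) : measurable_fun setT k ->
  (\int[haus_measure R D d]_(y in [set y : 'rV[R]_D | y \in T]) (k (enorm (y : 'rV[R]_D)))%:E =
   \int[msp_mu (Rn R d)]_v (k (enorm (coords v)))%:E)%E.
Proof.
move=> /measurable_EFinP mk.
rewrite [LHS]integralE [RHS]integralE; congr (_ - _)%E.
  transitivity (\int[haus_measure R D d]_(y in [set y : 'rV[R]_D | y \in T]) (EFin \o k)^\+ (enorm (y : 'rV[R]_D)))%E.
    by apply: eq_integral => y _; rewrite !funeposE.
  rewrite (ge0_integral_radial (measurable_funepos mk) (fun x => funepos_ge0 (EFin \o k) x)).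
  by apply: eq_integral => y _; rewrite !funeposE.
transitivity (\int[haus_measure R D d]_(y in [set y : 'rV[R]_D | y \in T]) (EFin \o k)^\- (enorm (y : 'rV[R]_D)))%E.
    by apply: eq_integral => y _; rewrite !funenegE.
  rewrite (ge0_integral_radial (measurable_funeneg mk) (fun x => funeneg_ge0 (EFin \o k) x)).
  by apply: eq_integral => y _; rewrite !funenegE.
Qed.

End radial_integrals.

(** * The iterated integral as an integral over the product space *)

Section leb_iter.
Variable R : realType.

Lemma integrable_radial d (psi : R -> R) (s M : R) : measurable_fun setT psi ->
  (forall t, `|psi t| <= M) -> (forall t, 1 < t -> psi t = 0) -> 0 <= s ->
  (msp_mu (Rn R d)).-integrable setT (fun v => (psi (s + sqn (coords v)))%:E).
Proof.
move=> mpsi psiM psi1 s0; have M0 : 0 <= M by apply: le_trans (psiM 0).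
have mf : measurable_fun setT (fun v : Rn R d => psi (s + sqn (coords v))).
  apply: (measurableT_comp mpsi); apply: measurable_funD => //.
  exact: measurable_sqn.
have mi : measurable_fun setT (fun v : Rn R d => (\1_(@cball R d 1) (coords v))%:E : \bar R).
  by apply/measurable_EFinP; exact: (measurable_indic (@mrset_cball R d 1)).
apply/integrableP; split; first exact/measurable_EFinP.
apply: (@le_lt_trans _ _ (M%:E * vol (@cball R d 1))%E); last first.
  by rewrite lte_mul_pinfty// -ge0_fin_numE ?vol_ge0// vol_cball1_fin.
rewrite -integral_indic_coords; last exact: mrset_cball.
rewrite -ge0_integralZl//.
apply: ge0_le_integral => //.
- by apply: measurableT_comp => //; exact/measurable_EFinP.
- exact: measurable_funeM.
- move=> v _; rewrite abse_EFin -EFinM lee_fin indicE.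
  have [_|] := boolP (_ \in _); first by rewrite mulr1.
  move/negP; rewrite inE /cball /= expr1n => /negP; rewrite -ltNge => h.
  by rewrite psi1 ?normr0 ?mulr0// (lt_le_trans h)// lerDr.
Qed.

(** The offset [s] collects the squares of the coordinates already fixed, which makes the induction
    possible. Every level of [leb_iter] takes a real-valued integral, so slices must be integrable
    for no value to be lost. *)
Lemma leb_iterE d (psi : R -> R) (s M : R) : measurable_fun setT psi ->
  (forall t, `|psi t| <= M) -> (forall t, 1 < t -> psi t = 0) -> 0 <= s ->
  leb_iter d (fun u => psi (s + \sum_(t <- u) t ^+ 2)) =
  fine (\int[msp_mu (Rn R d)]_v (psi (s + sqn (coords v)))%:E)%E.
Proof.
move=> mpsi psiM psi1; elim: d s => [|d IH] s s0.
  rewrite /= big_nil /sqn; under eq_integral do rewrite big_ord0.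
  rewrite [RHS]/= integral_dirac//.
  by rewrite diracT mul1e.
have I1 := integrable_radial d.+1 mpsi psiM psi1 s0.
have := integral12_prod_meas1 (m1 := @lebesgue_measure R) (m2 := msp_mu (Rn R d)) I1.
rewrite -[X in _ = X]/(\int[msp_mu (Rn R d.+1)]_v (psi (s + sqn (coords v)))%:E)%E => <-.
rewrite /= /Rintegral; congr fine; apply: eq_integral => t _.
have st0 : 0 <= s + t ^+ 2 by rewrite addr_ge0// sqr_ge0.
have -> : (fun u => psi (s + \sum_(t0 <- (t :: u)) t0 ^+ 2)) =
   (fun u => psi ((s + t ^+ 2) + \sum_(t0 <- u) t0 ^+ 2)).
  by apply/funext => u; rewrite big_cons addrA.
rewrite IH// fineK; last first.
  by apply: integrable_fin_num => //; exact: integrable_radial psiM psi1 st0.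
apply: eq_integral => v _; rewrite /= -[row_mx _ _]/(vcons t (coords v)) sqn_vcons.
by rewrite addrA.
Qed.

End leb_iter.

(** * Risk of the kernel density estimator *)

Section kernel.
Variable R : realType.
Variable K : R -> R.
Hypothesis cK : {within `[0, +oo[, continuous K}.
Hypothesis K1 : forall t, 1 < t -> K t = 0.

(* [K] is unconstrained on the negative reals, whence the absolute value. *)
Lemma continuous_kernel_norm : continuous (fun x : R => K `|x|).
Proof.
move/subspace_continuousP : cK => cK' x.
have x0 : `[0, +oo[%classic `|x| by rewrite /= in_itv/= andbT.
apply: (@cvg_comp _ _ _ (fun t : R => `|t|) K (nbhs x) (within `[0, +oo[%classic (nbhs `|x|)) _ _ (cK' _ x0)).
move=> P nP.
have := @norm_continuous _ R x _ nP; apply: (@filterS _ (nbhs x)) => y; apply.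
by rewrite /= in_itv/= andbT.
Qed.

Lemma kernel_bounded : exists M : R, forall t : R, 0 <= t -> `|K t| <= M.
Proof.
have c1 : {within `[0, 1], continuous (fun t : R => `|K `|t| |)}.
  apply: continuous_subspaceT => t; apply: continuous_comp; last exact: norm_continuous.
  exact: continuous_kernel_norm.
have [u _ uM] := @EVT_max R _ 0 1 ler01 c1.
exists `|K `|u| |=> t t0; have [t1|t1] := leP t 1.
  have -> : t = `|t| by rewrite ger0_norm.
  by apply: uM; rewrite in_itv/= t0.
by rewrite K1// normr0.
Qed.

Lemma measurable_kernel_norm : measurable_fun setT (fun x : R => K `|x|).
Proof. by apply: continuous_measurable_fun; exact: continuous_kernel_norm. Qed.

(** Turns the normalization in (A.1) into the main term of (A.2). The kernel is read as [K] after
    the square root, a function of the squared norm, to which the coordinate induction applies. *)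
Lemma Hint_kernel (D d : nat) (T : {vspace 'rV[R]_D}) : \dim T = d ->
  Hint d [set y | y \in T] (fun y => K (enorm y)) =
  leb_iter d (fun u => K (Num.sqrt (\sum_(t <- u) t ^+ 2))).
Proof.
move=> dT; have [M KM] := kernel_bounded.
have mpsi : measurable_fun setT (fun x : R => K (Num.sqrt x)).
  rewrite (_ : (fun x => _) = (fun x => K `|x|) \o Num.sqrt); last first.
    by apply/funext => x /=; rewrite ger0_norm// sqrtr_ge0.
  apply: measurableT_comp; first exact: measurable_kernel_norm.
  by apply: continuous_measurable_fun; exact: sqrt_continuous.
transitivity (leb_iter d (fun u => K (Num.sqrt (0 + \sum_(t <- u) t ^+ 2)))); last first.
  by congr leb_iter; apply/funext => u; rewrite add0r.
rewrite (leb_iterE d (psi := fun x => K (Num.sqrt x)) (M := M))//; last 2 first.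
- by move=> t; apply: KM; exact: sqrtr_ge0.
- by move=> t t1; apply: K1; rewrite -sqrtr1 ltr_sqrt// (lt_trans _ t1).
under eq_integral do rewrite add0r.
rewrite /Hint; congr fine.
transitivity (\int[haus_measure R D d]_(y in [set y : 'rV[R]_D | y \in T]) (K `|enorm (y : 'rV[R]_D)|)%:E)%E.
  rewrite -[LHS]/(\int[haus_measure R D d]_(y in [set y : 'rV[R]_D | y \in T]) (K (enorm (y : 'rV[R]_D)))%:E)%E.
  by apply: eq_integral => y _; rewrite ger0_norm// enorm_ge0.
rewrite (integral_radial dT measurable_kernel_norm).
by apply: eq_integral => v _; rewrite ger0_norm// enorm_ge0.
Qed.

Lemma continuous_enorm n : continuous (@enorm R n).
Proof.
have H (r : seq 'I_n) : continuous (fun v : 'rV[R]_n => \sum_(i <- r) v 0 i ^+ 2 : R).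
  elim: r => [|i r IH].
    rewrite (_ : (fun v => _) = fun=> 0); first exact: cst_continuous.
    by apply/funext => v; rewrite big_nil.
  rewrite (_ : (fun v => _) = (fun v : 'rV[R]_n => v 0 i ^+ 2 : R) + (fun v => \sum_(i <- r) v 0 i ^+ 2));
    last by apply/funext => v; rewrite big_cons.
  move=> y; apply: continuousD; last exact: IH.
  apply: (@continuous_comp _ _ _ (fun v : 'rV[R]_n => v 0 i) (fun t => t ^+ 2)).
    exact: coord_continuous.
  exact: exprn_continuous.
move=> y; apply: (@continuous_comp _ _ _ (fun v : 'rV[R]_n => \sum_(i < n) v 0 i ^+ 2) Num.sqrt);
  [exact: H | exact: sqrt_continuous].
Qed.

Lemma cc_fun_radial n (k : R -> R) : continuous (fun x : R => k `|x|) ->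
  (forall t, 1 < t -> k t = 0) -> cc_fun (fun y : 'rV[R]_n => k (enorm y)).
Proof.
move=> ck k1; split.
  rewrite (_ : (fun y => _) = (fun x => k `|x|) \o @enorm R n); last first.
    by apply/funext => y /=; rewrite ger0_norm// enorm_ge0.
  move=> y; apply: continuous_comp; [exact: continuous_enorm|exact: ck].
exists [set v : 'rV[R]_n | forall i, `[(-1), 1]%classic (v ord0 i)]; split.
  apply: (@rV_compact R n (fun=> `[(-1), 1]%classic)) => _; exact: segment_compact.
move=> y; rewrite -existsNE => -[i]; rewrite /= in_itv/= -ler_norml => /negP.
rewrite -ltNge => yi; apply: k1; apply: (lt_le_trans yi).
rewrite -sqrtr_sqr /enorm ler_sqrt ?sumr_ge0// => [|j _]; last exact: sqr_ge0.
by rewrite (bigD1 i)//= lerDl sumr_ge0// => j _; exact: sqr_ge0.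
Qed.

End kernel.

(** * Densities, independence and second moments *)

Section density.
Local Open Scope ereal_scope.
Context d (X : measurableType d) (R : realType).
Variables (mu nu : {measure set X -> \bar R}) (E : set X) (g : X -> R).
Hypotheses (mE : measurable E) (mg : measurable_fun E g)
  (g0 : forall x, E x -> (0 <= g x)%R)
  (nuE : forall A, measurable A -> nu A = \int[mu]_(x in A `&` E) (g x)%:E).

Import HBNNSimple.

Lemma ge0_integral_density (f : X -> \bar R) :
  measurable_fun setT f -> (forall x, 0 <= f x) ->
  \int[nu]_x f x = \int[mu]_(x in E) (f x * (g x)%:E).
Proof.
move=> mf f0; pose h := nnsfun_approx measurableT mf.
have mgE : measurable_fun E (EFin \o g) by exact/measurable_EFinP.
have mi (n : nat) r : measurable_fun setT (fun x => (r * \1_(h n @^-1` [set r]) x)%:E).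
  by apply/measurable_EFinP; exact: measurable_funM.
transitivity (limn (fun n => \int[nu]_x (h n x)%:E)).
  rewrite -monotone_convergence//.
  - by apply: eq_integral => x _; apply/esym/cvg_lim => //; exact: cvg_nnsfun_approx.
  - by move=> n; exact/measurable_EFinP.
  - by move=> n x _; rewrite lee_fin.
  - by move=> x _ a b ab; rewrite lee_fin; exact/lefP/nd_nnsfun_approx.
transitivity (limn (fun n => \int[mu]_(x in E) ((h n x)%:E * (g x)%:E))); last first.
  rewrite -monotone_convergence//.
  - apply: eq_integral => x _; apply/cvg_lim => //.
    by apply: cvgeZr => //; exact: cvg_nnsfun_approx.
  - move=> n; apply: emeasurable_funM => //; apply: measurable_funTS.
    exact/measurable_EFinP.
  - by move=> n x Ex; rewrite mule_ge0// lee_fin// g0.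
  - move=> x Ex a b ab; rewrite lee_wpmul2r ?lee_fin ?g0//.
    exact/lefP/nd_nnsfun_approx.
congr (limn _); apply/funext => n.
transitivity (\int[nu]_x (\sum_(y \in range (h n)) (y * \1_(h n @^-1` [set y]) x)%:E)).
  by apply: eq_integral => x _; rewrite fimfunE -fsumEFin.
rewrite ge0_integral_fsum//; last by move=> y x _; exact: nnfun_muleindic_ge0.
transitivity (\int[mu]_(x in E) (\sum_(y \in range (h n))
    (y * \1_(h n @^-1` [set y]) x)%:E * (g x)%:E)); last first.
  apply: eq_integral => x xE.
  rewrite -ge0_mule_fsuml => [|y]; last exact: nnfun_muleindic_ge0.
  by rewrite fsumEFin // -(fimfunE _ x).
rewrite ge0_integral_fsum//; last 2 first.
  - by move=> y; apply: emeasurable_funM => //; exact: measurable_funTS.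
  - by move=> y x Ex; rewrite mule_ge0 ?lee_fin ?g0// -lee_fin nnfun_muleindic_ge0.
apply: eq_fsbigr => r rhn.
under eq_integral do rewrite EFinM.
rewrite integralZl_indic_nnsfun// integral_indic// setIT.
under [RHS]eq_integral do rewrite EFinM -muleA.
rewrite ge0_integralZl//; last 3 first.
- apply: emeasurable_funM => //; apply/measurable_EFinP; exact: measurable_funTS.
- by move=> x Ex; rewrite mule_ge0 ?lee_fin ?g0.
- by move: rhn; rewrite inE => -[x _ <-]; rewrite lee_fin.
congr (_ * _); rewrite nuE// setIC integral_mkcondr.
by apply: eq_integral => x _; rewrite epatch_indic muleC.
Qed.

End density.

Section independence.
Local Open Scope ereal_scope.
Context d (T : measurableType d) (R : realType) (P : probability T R).

(** The joint law agrees with the product of the marginals on rectangles, hence everywhere; then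
    Tonelli. *)
Lemma ge0_indep_integralM (Y Z : {RV P >-> R}) :
  (forall A B : set R, measurable A -> measurable B ->
     P (Y @^-1` A `&` Z @^-1` B) = P (Y @^-1` A) * P (Z @^-1` B)) ->
  (forall w, (0 <= Y w)%R) -> (forall w, (0 <= Z w)%R) ->
  \int[P]_w (Y w * Z w)%:E = \int[P]_w (Y w)%:E * \int[P]_w (Z w)%:E.
Proof.
move=> ind Y0 Z0.
have mYZ : measurable_fun setT (fun w => (Y w, Z w)) by exact/measurable_fun_pair.
pose YZ : {mfun T >-> (R * R)%type} := mfun_Sub (mem_set mYZ).
(* Absolute values make the integrand nonnegative on the whole plane without changing it at the
   values of [Y] and [Z]. *)
pose f (z : R * R) : \bar R := (`|z.1| * `|z.2|)%:E.
have mf : measurable_fun setT f.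
  by apply/measurable_EFinP/measurable_funM; exact: measurableT_comp.
have mn : measurable_fun setT (fun x : R => `|x|%:E).
  by apply/measurable_EFinP; apply: continuous_measurable_fun; exact: norm_continuous.
have f0 z : 0 <= f z by rewrite lee_fin mulr_ge0.
transitivity (\int[distribution P YZ]_z f z).
  rewrite ge0_integral_distribution//.
  by apply: eq_integral => w _; rewrite /f /= !ger0_norm.
rewrite (@eq_measure_integral _ _ _ _ (product_measure1 (distribution P Y) (distribution P Z))); last first.
  by move=> A mA _; apply/esym; apply: product_measure_unique.
rewrite (fubini_tonelli1 _ mf f0) /fubini_F /f.
transitivity (\int[distribution P Y]_y (`|y|%:E * \int[distribution P Z]_z `|z|%:E)).
  apply: eq_integral => y _; rewrite -ge0_integralZl//.
rewrite ge0_integralZr//; last by apply: integral_ge0.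
rewrite !ge0_integral_distribution//.
by congr (_ * _); apply: eq_integral => w _ /=; rewrite ger0_norm.
Qed.

End independence.

Section mean_square.
Context d (T : measurableType d) (R : realType) (P : probability T R).
Implicit Types f g : T -> R.

Definition bmeas f := measurable_fun setT f /\ exists M : R, forall w, `|f w| <= M.

Local Notation E f := (Rintegral P setT f).

Lemma bmeas_cst c : bmeas (fun=> c).
Proof. by split; [exact: measurable_cst | exists `|c|]. Qed.

Lemma bmeasD f g : bmeas f -> bmeas g -> bmeas (fun w => f w + g w).
Proof.
move=> [mf [M fM]] [mg [N gN]]; split; first exact: measurable_funD.
by exists (M + N) => w; rewrite (le_trans (ler_normD _ _))// lerD.
Qed.

Lemma bmeasM f g : bmeas f -> bmeas g -> bmeas (fun w => f w * g w).
Proof.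
move=> [mf [M fM]] [mg [N gN]]; split; first exact: measurable_funM.
by exists (M * N) => w; rewrite normrM ler_pM.
Qed.

Lemma bmeas_sum n (F : nat -> T -> R) : (forall i, bmeas (F i)) ->
  bmeas (fun w => \sum_(i < n) F i w).
Proof.
move=> bF; elim: n => [|n IH].
  by under eq_fun do rewrite big_ord0; exact: bmeas_cst.
by under eq_fun do rewrite big_ord_recr; exact: bmeasD.
Qed.

Lemma bmeas_integrable f : bmeas f -> P.-integrable setT (EFin \o f).
Proof.
move=> [mf [M fM]]; apply: measurable_bounded_integrable => //.
  by rewrite (le_lt_trans (probability_le1 _ _))// ltry.
exists M; split; first exact: num_real.
by move=> x /ltW Mx w _; exact: le_trans (fM w) Mx.
Qed.

Lemma meanD f g : bmeas f -> bmeas g -> E (fun w => f w + g w) = E f + E g.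
Proof. by move=> bf bg; rewrite RintegralD//; exact: bmeas_integrable. Qed.

Lemma meanZ c f : bmeas f -> E (fun w => c * f w) = c * E f.
Proof. by move=> bf; rewrite RintegralZl//; exact: bmeas_integrable. Qed.

Lemma mean_cst c : E (fun=> c) = c.
Proof. by rewrite Rintegral_cst//= probability_setT mulr1. Qed.

Lemma mean_sum n (F : nat -> T -> R) : (forall i, bmeas (F i)) ->
  E (fun w => \sum_(i < n) F i w) = \sum_(i < n) E (F i).
Proof.
move=> bF; elim: n => [|n IH].
  by under eq_Rintegral do rewrite big_ord0; rewrite mean_cst big_ord0.
under eq_Rintegral do rewrite big_ord_recr.
by rewrite meanD ?IH ?big_ord_recr//; exact: bmeas_sum.
Qed.

Definition indep f g := forall A B : set R, measurable A -> measurable B ->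
  P (f @^-1` A `&` g @^-1` B) = (P (f @^-1` A) * P (g @^-1` B))%E.

(** Adding the bounds [M] and [N] makes both functions nonnegative and keeps them independent; the
    extra terms cancel by linearity. *)
Lemma meanM f g : bmeas f -> bmeas g -> indep f g ->
  E (fun w => f w * g w) = E f * E g.
Proof.
move=> bf bg fg; have [mf [M fM]] := bf; have [mg [N gN]] := bg.
pose f' w := f w + M; pose g' w := g w + N.
have bf' : bmeas f' by apply: bmeasD => //; exact: bmeas_cst.
have bg' : bmeas g' by apply: bmeasD => //; exact: bmeas_cst.
have mshift (c : R) (A : set R) : measurable A -> measurable ((fun x => x + c) @^-1` A).
  move=> mA; rewrite -[_ @^-1` _]setTI.
  by apply: (@measurable_funD _ _ _ _ id (cst c)) => //; exact: measurable_cst.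
pose F : {RV P >-> R} := mfun_Sub (mem_set bf'.1).
pose G : {RV P >-> R} := mfun_Sub (mem_set bg'.1).
have := @ge0_indep_integralM _ _ _ P F G.
have E' u : bmeas u -> (\int[P]_w (u w)%:E = (E u)%:E)%E.
  by move=> /bmeas_integrable iu; rewrite fineK//; exact: integrable_fin_num.
rewrite /F /G /= !E'//; last exact: bmeasM.
rewrite -EFinM => H.
have {H} : E (fun w => f' w * g' w) = E f' * E g'.
  apply: EFin_inj; apply: H.
  - by move=> A B mA mB; exact: (fg _ _ (mshift M _ mA) (mshift N _ mB)).
  - by move=> w; rewrite -lerBlDr sub0r; have := fM w; rewrite ler_norml => /andP[].
  - by move=> w; rewrite -lerBlDr sub0r; have := gN w; rewrite ler_norml => /andP[].
have -> : (fun w => f' w * g' w) = (fun w => f w * g w + (N * f w + (M * g w + M * N))).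
  by apply/funext => w; rewrite /f' /g'; ring.
have bc := bmeas_cst; have bM c u : bmeas u -> bmeas (fun w => c * u w).
  by move=> bu; exact: bmeasM.
have b1 := bmeasM bf bg; have b2 := bM N _ bf; have b3 := bM M _ bg.
have b4 := bmeasD b3 (bc (M * N)); have b5 := bmeasD b2 b4.
rewrite /f' /g' !meanD// !meanZ// !mean_cst => H.
by apply: (addIr (N * E f + (M * E g + M * N))); rewrite H; ring.
Qed.

Variable Y : nat -> T -> R.
Variables (a v : R).
Hypotheses (bY : forall i, bmeas (Y i))
  (iY : forall i j, i != j -> indep (Y i) (Y j))
  (Ya : forall i, E (Y i) = a) (Yv : forall i, E (fun w => Y i w ^+ 2) = v).

(** [n] diagonal terms [v], and [n ^ 2 - n] mixed terms that factor by pairwise independence. *)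
Lemma mean_sqr_sum n : E (fun w => (\sum_(i < n) Y i w) ^+ 2) =
  n%:R * v + (n%:R ^+ 2 - n%:R) * a ^+ 2.
Proof.
elim: n => [|n IH].
  by under eq_Rintegral do rewrite big_ord0 expr0n; rewrite mean_cst /=; ring.
pose S w := \sum_(i < n) Y i w.
have bS : bmeas S by exact: bmeas_sum.
transitivity (E (fun w => S w ^+ 2 + (2 * (S w * Y n w) + Y n w ^+ 2))).
  by apply: eq_Rintegral => w _; rewrite big_ord_recr /= -/(S w); ring.
have b1 : bmeas (fun w => S w ^+ 2) by exact: bmeasM.
have b2 : bmeas (fun w => Y n w ^+ 2) by exact: bmeasM.
have b3 : bmeas (fun w => S w * Y n w) by exact: bmeasM.
have b4 : bmeas (fun w => 2 * (S w * Y n w)) by apply: bmeasM => //; exact: bmeas_cst.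
rewrite meanD//; last exact: bmeasD.
rewrite meanD// meanZ// IH Yv.
have -> : E (fun w => S w * Y n w) = n%:R * a ^+ 2.
  under eq_Rintegral do rewrite /S mulr_suml.
  rewrite (@mean_sum n (fun i w => Y i w * Y n w)); last by move=> i; exact: bmeasM.
  rewrite mulr_natl (eq_bigr (fun=> a ^+ 2)); first by rewrite sumr_const card_ord.
  by move=> i _; rewrite meanM ?Ya//; apply: iY; rewrite neq_ltn ltn_ord.
by rewrite -natr1; ring.
Qed.

(** Variance plus squared bias, with the variance of each term bounded by its second moment: the
    difference of the two sides is [al ^ 2 * n * a ^ 2]. *)
Lemma mean_square_error n al q :
  E (fun w => (al * \sum_(i < n) Y i w - q) ^+ 2) <=
  al ^+ 2 * (n%:R * v) + (al * (n%:R * a) - q) ^+ 2.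
Proof.
pose S w := \sum_(i < n) Y i w.
have bS : bmeas S by exact: bmeas_sum.
rewrite (_ : Rintegral _ _ _ =
    E (fun w => al ^+ 2 * S w ^+ 2 + (- 2 * al * q * S w + q ^+ 2))); last first.
  by apply: eq_Rintegral => w _; rewrite -/(S w); ring.
have b1 : bmeas (fun w => S w ^+ 2) by exact: bmeasM.
have bc := bmeas_cst.
have b2 : bmeas (fun w => al ^+ 2 * S w ^+ 2) by exact: bmeasM.
have b3 : bmeas (fun w => - 2 * al * q * S w) by exact: bmeasM.
rewrite meanD//; last exact: bmeasD.
rewrite meanD// !meanZ// mean_cst mean_sqr_sum mean_sum//.
rewrite (eq_bigr (fun=> a)) ?sumr_const ?card_ord// -(mulr_natl a n).
rewrite -subr_ge0 (_ : _ - _ = al ^+ 2 * a ^+ 2 * n%:R); last ring.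
by rewrite mulr_ge0// mulr_ge0// sqr_ge0.
Qed.

End mean_square.

(** * Means of the kernel as integrals over the blow-up *)

Section kernel_mean.
Variable R : realType.

Lemma measurable_mulEFin d0 (X : measurableType d0) (E : set X) (f g : X -> R) :
  measurable E -> measurable_fun setT f -> measurable_fun E g ->
  measurable_fun E (fun x => (f x)%:E * (g x)%:E)%E.
Proof.
move=> mE mf mg; apply: emeasurable_funM; apply/measurable_EFinP => //.
exact: measurable_funTS.
Qed.

(** Holds at the infinities too, which [fine] sends to 0 and a positive factor preserves. *)
Lemma fine_pmul (c : R) (x : \bar R) : 0 < c -> fine (c%:E * x)%E = c * fine x.
Proof.
move=> c0; case: x => [r| |] //=.
  by rewrite gt0_muley ?lte_fin//= mulr0.
by rewrite gt0_muleNy ?lte_fin//= mulr0.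
Qed.

(** Covers infinity minus infinity, which is [-oo] on both sides, so the means of signed kernels can
    be treated without first proving integrability. *)
Lemma ge0_muleBr_pos (c : R) (x y : \bar R) : 0 < c -> (0 <= x -> 0 <= y ->
  c%:E * x - c%:E * y = c%:E * (x - y))%E.
Proof.
move=> c0; case: x => [r| |] //; case: y => [s| |] // _ _.
- exact: (congr1 EFin (esym (mulrBr _ _ _))).
- by rewrite gt0_muley ?lte_fin//= gt0_muleNy ?lte_fin.
- by rewrite gt0_muley ?lte_fin//= gt0_muley ?lte_fin.
- by rewrite gt0_muley ?lte_fin//= gt0_muleNy ?lte_fin.
Qed.

Variables (D d : nat) (Om : set 'rV[R]_D) (p : 'rV[R]_D -> R).
Variable (P : probability (HdT R D d) R).
Variables (dT : measure_display) (Ts : measurableType dT) (Prob : probability Ts R).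
Variable (X : Ts -> 'rV[R]_D).
Hypothesis mOm : measurable (Om : set (HdT R D d)).
Hypothesis pP : forall A : set (HdT R D d), measurable A ->
  P A = (\int[Hd R D d]_(y in A `&` Om) (p y)%:E)%E.
Hypothesis mX : measurable_fun setT (X : Ts -> HdT R D d).
Hypothesis XP : forall A : set (HdT R D d), measurable A ->
  Prob ((X : Ts -> HdT R D d) @^-1` A) = P A.
Hypothesis mp : measurable_fun (Om : set (HdT R D d)) (p : HdT R D d -> R).
Hypothesis p0 : forall x, Om x -> 0 < p x.

Lemma measurable_rescaled_kernel (k : R -> R) x h : measurable_fun setT (fun t : R => k `|t|) ->
  0 < h -> measurable_fun setT ((fun y => k (enorm (y - x) / h)) : HdT R D d -> R).
Proof.
move=> mk h0.
have mkh : measurable_fun setT (fun t : R => k `|t / h|).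
  by apply: (measurableT_comp mk); exact: measurable_funM.
have -> : (fun y : 'rV[R]_D => k (enorm (y - x) / h)) =
    (fun t : R => k `|t / h|) \o (fun y : 'rV[R]_D => enorm (y - x)).
  by apply/funext => y /=; rewrite ger0_norm// divr_ge0 ?enorm_ge0// ltW.
exact: (measurableT_comp mkh (@measurable_enormB R D d x)).
Qed.

(** Three changes of measure: from [Prob] to the law [P], from [P] to its density, and from [Om] to
    its blow-up, where [|y - x| / h] becomes [|y|]. *)
Lemma ge0_mean_kernel (k : R -> R) x h : measurable_fun setT (fun t : R => k `|t|) ->
  (forall t, 0 <= k t) -> 0 < h ->
  (\int[Prob]_w (k (enorm (X w - x) / h))%:E = (h ^+ d)%:E *
    \int[haus_measure R D d]_(y in blowup Om x h) (k (enorm (y : 'rV[R]_D)) * p (x + h *: (y : 'rV[R]_D)))%:E)%E.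
Proof.
move=> mk k0 h0.
have mphi := measurable_rescaled_kernel x mk h0.
pose phi : HdT R D d -> \bar R := fun y => (k (enorm ((y : 'rV[R]_D) - x) / h))%:E.
have mphiE : measurable_fun setT phi by exact/measurable_EFinP.
have phi0 y : (0 <= phi y)%E by rewrite lee_fin.
transitivity (\int[P]_y phi y)%E.
  rewrite (eq_measure_integral (image_measure Prob mX)) ?integral_image_measure//.
  by move=> A mA _; rewrite image_measureE; exact/esym/XP.
rewrite (@ge0_integral_density _ _ R (haus_measure R D d) P Om p mOm mp _ _ phi mphiE phi0); last 2 first.
- by move=> y /p0/ltW.
- exact: pP.
rewrite -[LHS]/(\int[Hd R D d]_(y in Om) (phi y * (p y)%:E))%E.
rewrite (@integral_blowup R D d Om x h (fun y => phi y * (p y)%:E)%E h0 mOm); last 2 first.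
- exact: (measurable_mulEFin mOm mphi mp).
- by move=> y Oy; rewrite mule_ge0// lee_fin ltW// p0.
congr (_ * _)%E.
rewrite -[LHS]/(\int[haus_measure R D d]_(y in blowup Om x h) (phi (x + h *: (y : 'rV[R]_D))%R * (p (x + h *: (y : 'rV[R]_D))%R)%:E))%E.
apply: eq_integral => y _; rewrite /phi -EFinM.
by rewrite addrC addKr enormZ ger0_norm ?(ltW h0)// mulrAC divff ?gt_eqF// mul1r.
Qed.

(** Since [p] is positive on [Om], the positive and negative parts of the product are those of [k]
    times [p]. *)
Lemma mean_kernel (k : R -> R) x h : measurable_fun setT (fun t : R => k `|t|) ->
  0 < h ->
  \int[Prob]_w (k (enorm (X w - x) / h)) =
  h ^+ d * Hint d (blowup Om x h) (fun y => k (enorm y) * p (x + h *: y)).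
Proof.
move=> mk h0; have hd : 0 < h ^+ d by exact: exprn_gt0.
rewrite /Hint -fine_pmul// /Rintegral; congr fine.
have maxE (s : R) : (Num.max s 0)%:E = Order.max s%:E 0%E by rewrite -EFin_max.
have mpos (u : R -> R) : measurable_fun setT u -> measurable_fun setT (fun t => Num.max (u t) 0).
  by move=> mu; exact: measurable_maxr.
have Hp := @ge0_mean_kernel (fun t => Num.max (k t) 0) x h (mpos _ mk) _ h0.
have Hn := @ge0_mean_kernel (fun t => Num.max (- k t) 0) x h
  (mpos _ (measurable_funN mk)) _ h0.
rewrite -[X in _ = (_ * X)%E]/(\int[haus_measure R D d]_(y in blowup Om x h) (k (enorm (y : 'rV[R]_D)) * p (x + h *: (y : 'rV[R]_D)))%:E)%E.
rewrite integralE [in RHS]integralE -ge0_muleBr_pos//; last 2 first.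
- by apply: integral_ge0 => y _; exact: funepos_ge0.
- by apply: integral_ge0 => y _; exact: funeneg_ge0.
have maxM (s r : R) : 0 < r -> Num.max (s * r) 0 = Num.max s 0 * r.
  by move=> r0; rewrite maxr_pMl ?ltW// mul0r.
congr (_ - _)%E.
- transitivity (\int[Prob]_w (Num.max (k (enorm (X w - x) / h)) 0)%:E)%E.
    by apply: eq_integral => w _; rewrite funeposE maxE.
  rewrite Hp//; last by move=> t; rewrite le_max lexx orbT.
  congr (_ * _)%E; apply: eq_integral => y; rewrite inE => Oy.
  by rewrite funeposE -maxE maxM// p0.
- transitivity (\int[Prob]_w (Num.max (- k (enorm (X w - x) / h)) 0)%:E)%E.
    by apply: eq_integral => w _; rewrite funenegE maxE.
  rewrite Hn//; last by move=> t; rewrite le_max lexx orbT.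
  congr (_ * _)%E; apply: eq_integral => y; rewrite inE => Oy.
  by rewrite funenegE -EFinN -maxE -mulNr maxM// p0.
Qed.

End kernel_mean.

Section risk.
Variable R : realType.
Variables (D d : nat) (Om : set 'rV[R]_D) (p : 'rV[R]_D -> R).
Variable (P : probability (HdT R D d) R).
Variables (dT : measure_display) (Ts : measurableType dT) (Prob : probability Ts R).
Variables (X : nat -> Ts -> 'rV[R]_D) (K : R -> R).
Hypothesis mOm : measurable (Om : set (HdT R D d)).
Hypothesis pP : forall A : set (HdT R D d), measurable A ->
  P A = (\int[Hd R D d]_(y in A `&` Om) (p y)%:E)%E.
Hypothesis mX : forall i, measurable_fun setT (X i : Ts -> HdT R D d).
Hypothesis XP : forall i (A : set (HdT R D d)), measurable A ->
  Prob ((X i : Ts -> HdT R D d) @^-1` A) = P A.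
Hypothesis indX : forall s : seq nat, uniq s -> forall A : nat -> set (HdT R D d),
  (forall i, measurable (A i)) ->
  Prob (\bigcap_(i in [set j | j \in s]) (X i : Ts -> HdT R D d) @^-1` A i) =
  (\prod_(i <- s) Prob ((X i : Ts -> HdT R D d) @^-1` A i))%E.
Hypothesis mp : measurable_fun (Om : set (HdT R D d)) (p : HdT R D d -> R).
Hypothesis p0 : forall x, Om x -> 0 < p x.
Hypothesis cK : {within `[0, +oo[, continuous K}.
Hypothesis K1 : forall t, 1 < t -> K t = 0.

Lemma kde_risk x h n : 0 < h -> (0 < n)%N ->
  ('E_Prob[fun w => ((kde d K X n h x w - p x) ^+ 2)%R] <=
   ((n%:R * h ^+ d)^-1 * Hint d (blowup Om x h) (fun y => K (enorm y) ^+ 2 * p (x + h *: y)) +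
    (Hint d (blowup Om x h) (fun y => K (enorm y) * p (x + h *: y)) - p x) ^+ 2)%:E)%E.
Proof.
move=> h0 n0; have hd : 0 < h ^+ d by exact: exprn_gt0.
have nd : (n%:R : R) != 0 by rewrite pnatr_eq0 -lt0n.
have mk := measurable_kernel_norm cK.
have mphi := @measurable_rescaled_kernel R D d K x h mk h0.
pose phi : HdT R D d -> R := fun y => K (enorm ((y : 'rV[R]_D) - x) / h).
pose Y i w := phi (X i w).
have [M KM] := kernel_bounded cK K1.
have bY i : bmeas (Y i).
  split; first exact: (measurableT_comp mphi (mX i)).
  by exists M => w; apply: KM; rewrite divr_ge0 ?enorm_ge0// ltW.
have mphiI (A : set R) : measurable A -> measurable (phi @^-1` A).
  by move=> mA; rewrite -[_ @^-1` _]setTI; exact: mphi.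
have iY i j : i != j -> indep Prob (Y i) (Y j).
  move=> ij A B mA mB.
  (* Joint independence is applied to the list [[:: i; j]], so only the values of [C] at these two
     indices matter. *)
  pose C l := if l == i then phi @^-1` A else phi @^-1` B.
  have mC l : measurable (C l) by rewrite /C; case: ifP => _; exact: mphiI.
  have uij : uniq [:: i; j] by rewrite /= inE ij.
  have := indX uij mC; rewrite !big_cons big_nil mule1 {2 3}/C eqxx eq_sym (negbTE ij).
  move=> <-; congr (Prob _); apply/seteqP; split => w /=.
    by move=> [Aw Bw] l; rewrite /= !inE => /orP[] /eqP ->;
      rewrite /C ?eqxx//= eq_sym (negbTE ij).
  move=> H; split.
    by have := H i; rewrite /C eqxx; apply; rewrite /= inE eqxx.
  by have := H j; rewrite /C eq_sym (negbTE ij); apply; rewrite /= !inE eqxx orbT.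
pose b := Hint d (blowup Om x h) (fun y => K (enorm y) * p (x + h *: y)).
pose b2 := Hint d (blowup Om x h) (fun y => K (enorm y) ^+ 2 * p (x + h *: y)).
have Ya i : Rintegral Prob setT (Y i) = h ^+ d * b.
  exact: (mean_kernel mOm pP (mX i) (XP i) mp p0 x mk h0).
have mk2 : measurable_fun setT (fun t : R => K `|t| ^+ 2) by exact: measurable_funX.
have Yv i : Rintegral Prob setT (fun w => Y i w ^+ 2) = h ^+ d * b2.
  exact: (@mean_kernel R D d Om p P _ Ts Prob (X i) mOm pP (mX i) (XP i) mp p0 (fun t => K t ^+ 2) x h mk2 h0).
(* Each [Y i] has mean [h ^ d * b] and second moment [h ^ d * b2]. The factor [h ^ d] cancels in the
   bias; in the variance one inverse power of it remains. *)
have := mean_square_error bY iY Ya Yv n (n%:R * h ^+ d)^-1 (p x).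
rewrite (_ : _ * (_ * (h ^+ d * b)) = b); last by field; rewrite nd gt_eqF.
rewrite (_ : _ * (_ * (h ^+ d * b2)) = (n%:R * h ^+ d)^-1 * b2); last by field; rewrite nd gt_eqF.
rewrite -lee_fin; apply: le_trans.
rewrite unlock fineK//; apply: integrable_fin_num => //.
apply: bmeas_integrable.
have bS : bmeas (fun w => (n%:R * h ^+ d)^-1 * (\sum_(i < n) Y i w) - p x).
  apply: bmeasD; last exact: bmeas_cst.
  by apply: bmeasM; [exact: bmeas_cst | exact: bmeas_sum].
by have := bmeasM bS bS.
Qed.

End risk.

(** * Choice of the bandwidth and conclusion *)

Section rates.
Variables (R : realType) (d : nat) (m c : R).
Hypotheses (m0 : 0 < m) (c0 : 0 < c).

Let s : R := d%:R + 2 * m.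
Let s0 : 0 < s. Proof. by rewrite ltr_wpDl// mulr_gt0. Qed.
Let bw n := c * n%:R `^ (- s^-1).

Lemma bandwidth_gt0 n : (0 < n)%N -> 0 < bw n.
Proof. by move=> n0; rewrite mulr_gt0// powR_gt0// ltr0n. Qed.

(** Solving for [n] gives the threshold [(c / e) ^ s]; since it is nonnegative, exceeding it also
    forces [0 < n]. *)
Lemma bandwidth_small e : 0 < e -> exists N, forall n, (N <= n)%N -> (0 < n)%N /\ bw n < e.
Proof.
move=> e0; have ce : 0 <= (c / e) `^ s by exact: powR_ge0.
exists (Num.bound ((c / e) `^ s)) => n Nn.
have cn : (c / e) `^ s < n%:R by rewrite (lt_le_trans (archi_boundP ce))// ler_nat.
have n0 : 0 < n%:R :> R by exact: le_lt_trans cn.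
split; first by rewrite -(ltr0n R).
rewrite /bw powRN ltr_pdivrMr ?powR_gt0// mulrC -ltr_pdivrMr//.
have ce1 : 0 <= c / e by rewrite divr_ge0// ltW.
have sE : ((c / e) `^ s) `^ s^-1 = c / e.
  by rewrite -powRrM divff ?powRr1//; exact: lt0r_neq0.
rewrite -[ltLHS]sE gt0_ltr_powR ?invr_gt0//.
by rewrite nnegrE ltW.
Qed.

(** The exponent is [d / s - 1 = - 2 m / s], the same as for the squared bias; this balance is what
    determines the bandwidth exponent [1 / (d + 2 m)]. *)
Lemma bandwidth_variance n : (0 < n)%N ->
  (n%:R * bw n ^+ d)^-1 = (c ^+ d)^-1 * n%:R `^ (- (2 * m / s)).
Proof.
move=> n0; have n1 : 0 < n%:R :> R by rewrite ltr0n.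
rewrite /bw exprMn -[(_ `^ _) ^+ d]powR_mulrn ?powR_ge0// -powRrM mulrCA invfM.
congr (_ * _); rewrite -{1}(powRr1 (ltW n1)) -powRD; last by rewrite (gt_eqF n1) implybT.
rewrite -powRN; congr (_ `^ _); rewrite /s; field.
exact: lt0r_neq0.
Qed.

Lemma bandwidth_bias n : (bw n `^ m) ^+ 2 = (c `^ m) ^+ 2 * n%:R `^ (- (2 * m / s)).
Proof.
rewrite /bw powRM ?powR_ge0 ?(ltW c0)// exprMn; congr (_ * _).
rewrite -powRrM -powR_mulrn ?powR_ge0// -powRrM; congr (_ `^ _); field.
exact: lt0r_neq0.
Qed.

End rates.

Theorem theorem1p1 (R : realType) (D d : nat) (Om : set 'rV[R]_D)
  (p : 'rV[R]_D -> R) (P : probability (HdT R D d) R)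
  (dT : measure_display) (Ts : measurableType dT) (Prob : probability Ts R)
  (X : nat -> Ts -> 'rV[R]_D) (K : R -> R) (m c : R) :
  (* Om is d-rectifiable (and H^d-measurable) *)
  rectifiable d Om -> measurable (Om : set (HdT R D d)) ->
  (* P is a probability on Om with density p w.r.t. H^d *)
  (forall A : set (HdT R D d), measurable A ->
     P A = (\int[Hd R D d]_(y in A `&` Om) (p y)%:E)%E) ->
  (* X_1, X_2, ... are i.i.d. with law P *)
  (forall i, measurable_fun setT (X i : Ts -> HdT R D d)) ->
  (forall i (A : set (HdT R D d)), measurable A ->
     Prob ((X i : Ts -> HdT R D d) @^-1` A) = P A) ->
  (forall s : seq nat, uniq s -> forall A : nat -> set (HdT R D d),
     (forall i, measurable (A i)) ->
     Prob (\bigcap_(i in [set j | j \in s]) (X i : Ts -> HdT R D d) @^-1` A i) =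
     (\prod_(i <- s) Prob ((X i : Ts -> HdT R D d) @^-1` A i))%E) ->
  (* (A.1) *)
  {within `[0, +oo[, continuous K} ->
  (forall t, 1 < t -> K t = 0) ->
  leb_iter d (fun u => K (Num.sqrt (\sum_(t <- u) t ^+ 2))) = 1 ->
  (* (A.2) *)
  0 < m ->
  weight_on d Om p ->
  {ae Hd R D d, forall x : HdT R D d, Om x ->
     exists T : {vspace 'rV[R]_D}, approx_tangent d Om p x T /\
       forall f : 'rV[R]_D -> R, cc_fun f ->
         exists (M h0 : R), 0 < h0 /\ forall h, 0 < h < h0 ->
           `| Hint d (blowup Om x h) (fun y => f y * p (x + h *: y))
              - p x * Hint d [set y | y \in T] f | <= M * h `^ m} ->
  (* conclusion *)
  0 < c ->
  {ae Hd R D d, forall x : HdT R D d, Om x ->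
     exists (C : R) (N : nat), forall n : nat, (N <= n)%N ->
       ('E_Prob[fun w => ((kde d K X n (c * n%:R `^ (- (d%:R + 2 * m)^-1)) x w - p x) ^+ 2)%R]
         <= (C * n%:R `^ (- (2 * m / (d%:R + 2 * m))))%:E)%E}.

Proof.
move=> _ mOm pP mX XP indX cK K1 intK m0 [mp p0 _] A2 c0.
have K21 t : 1 < t -> K t ^+ 2 = 0 by move=> /K1 ->; rewrite expr0n.
have cKn := continuous_kernel_norm cK.
have cK2n : continuous (fun t : R => K `|t| ^+ 2).
  by move=> t; apply: (@continuous_comp _ _ _ (fun t => K `|t|) (fun t => t ^+ 2)); [exact: cKn | exact: exprn_continuous].
(* The null set of (A.2) serves again, by contraposition: the rate holds wherever (A.2) does. *)
case: A2 => B [mB B0 PB]; exists B; split => //.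
apply: (subset_trans _ PB) => x nQ Hx; apply: nQ => Ox; have [T [[dimT _] A2T]] := Hx Ox.
have [M1 [h1 [h10 H1]]] := A2T _ (cc_fun_radial D cKn K1).
have [M2 [h2 [h20 H2]]] := A2T _ (cc_fun_radial D (k := fun t => K t ^+ 2) cK2n K21).
rewrite (Hint_kernel cK K1 dimT) intK mulr1 in H1.
pose q2 := p x * Hint d [set y | y \in T] (fun y => K (enorm y) ^+ 2).
(* The bound 1 on the bandwidth gives [h ^ m <= 1], so the error term of the second moment is
   absorbed into a constant. *)
have e0 : 0 < Num.min (Num.min h1 h2) 1 by rewrite !lt_min h10 h20 ltr01.
have [N HN] := @bandwidth_small R d m c m0 c0 _ e0.
(* The first summand comes from the variance, the integral of the squared kernel being at most
   [|q2| + |M2|]; the second is the square of the bias bound [M1 * h ^ m]. *)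
exists ((`|q2| + `|M2|) * (c ^+ d)^-1 + M1 ^+ 2 * (c `^ m) ^+ 2), N => n Nn.
have [n0 he] := HN n Nn; have h0 := bandwidth_gt0 d m c0 n0.
have VE := @bandwidth_variance R d m c m0 n n0.
have BE := @bandwidth_bias R d m c m0 c0 n.
move: h0 he VE BE; set h := c * _ => h0 he VE BE.
move: he; rewrite !lt_min => /andP[/andP[hh1 hh2] hlt1].
apply: (le_trans (kde_risk mOm pP mX XP indX mp p0 cK K1 x h0 n0)).
rewrite lee_fin mulrDl; apply: lerD.
  rewrite VE mulrC mulrA ler_wpM2r ?powR_ge0// ler_wpM2r ?invr_ge0 ?exprn_ge0 ?(ltW c0)//.
  have := H2 h; rewrite h0 hh2 => /(_ isT); rewrite ler_norml -/q2 => /andP[_].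
  rewrite lerBlDl => /le_trans; apply; apply: lerD; first exact: ler_norm.
  have hm1 : h `^ m <= 1.
    have := @ge0_ler_powR R m (ltW m0) h 1; rewrite powR1 !nnegrE => -> //; exact: ltW.
  rewrite (le_trans (ler_wpM2r (powR_ge0 h m) (ler_norm M2)))//.
  by rewrite -[leRHS]mulr1 ler_wpM2l.
rewrite -mulrA -BE -exprMn -[leLHS]real_normK ?num_real//.
rewrite lerXn2r ?nnegrE//; last by apply: H1; rewrite h0.
by apply: (le_trans (normr_ge0 _)); apply: H1; rewrite h0.
Qed.
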